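(* Let $T=(T,\mu,\iota)$ be a monad on an augmented virtual double category $\mathcal K$ and let `weak' (as a qualifier of vertical $T$-morphisms, with corresponding subscript $w\in\{\mathrm c,\mathrm l,\mathrm{ps}\}$) mean either `colax', `lax' or `pseudo'. Given colax $T$-algebras $A_0,\dotsc,A_n$ and $M$, consider the following conditions on a path of horizontal $T$-morphisms $(J_1\colon A_0\nrightarrow A_1,\dotsc,J_n\colon A_{n-1}\nrightarrow A_n)$ and a weak vertical $T$-morphism $d\colon A_0\to M$, where $m\colon TM\to M$ and $a_0\colon TA_0\to A_0$ denote the structure maps of $M$ and $A_0$ (throughout, the parenthesised `(weak)' in `(weak) left Kan extension' and `(weak) left exact' is either everywhere included or everywhere omitted): (p) the algebraic structure of $M$ preserves the (weak) left Kan extension of $d$ along $(J_1,\dotsc,J_n)$, while both paths $(\mu_{J_1},\dotsc,\mu_{J_n})$ and $(\iota_{J_1},\dotsc,\iota_{J_n})$ are (weak) left $(m\circ Td)$-exact; (e) the path of structure cells $(\bar J_1,\dotsc,\bar J_n)$ is (weak) left $d$-exact, while both paths $(\mu_{J_1},\dotsc,\mu_{J_n})$ and $(\iota_{J_1},\dotsc,\iota_{J_n})$ are (weak) left $(d\circ a_0)$-exact; (l) the forgetful functor $U\colon T\text{-}\mathsf{Alg}_{(\mathrm c,w)}\to\mathcal K$ creates the (weak) left Kan extension of $d$ along $(J_1,\dotsc,J_n)$. The following hold: (a) if `weak' means `lax' then (p) implies (l); (b) if `weak' means `colax' then (e) implies (l); (c) if `weak' means `pseudo' then any two of (p), (e)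 and (l) imply the third. Moreover, if the restrictions $J_n(\mathrm{id},f)$ exist in $\mathcal K$ and are preserved by $T$, for all $f\colon B\to A_n$, then the result analogous to (a) for pointwise (weak) left Kan extensions holds as well. In this case the forgetful functor $U\colon T\text{-}\mathsf{Alg}_{(\mathrm c,\mathrm{ps},\mathrm{lbc})}\to\mathcal K$ too creates the pointwise left Kan extension of $d$ along $(J_1,\dotsc,J_n)$ (where now $d$ is a pseudo $T$-morphism and the $J_i$ satisfy the left Beck-Chevalley condition), under the assumption of (p).
   Context: **Augmented virtual double category (avdc)** $\mathcal K$: it consists of objects; a category of vertical morphisms $f\colon A\to C$ between these objects; horizontal morphisms $J\colon A\nrightarrow B$ between objects; and cells. A cell $\phi\colon\underline J\Rightarrow\underline K$ has a horizontal source $\underline J=(J_1,\dotsc,J_n)$, a path $J_i\colon A_{i-1}\nrightarrow A_i$ of length $n\ge0$ (the empty path at $A_0$ is written $(A_0)$); a horizontal target $\underline K$, a path from $C$ to $D$ of length at most $1$ (so $\underline K=K\colon C\nrightarrow D$, or $\underline K=(C)$ with $C=D$, also written $\phi\colon\underline J\Rightarrow C$); a vertical source $f\colon A_0\to C$ and a vertical target $g\colon A_n\to D$. It is unary if $\underline K$ has length $1$, nullary if $\underline K$ has length $0$, vertical if $\underline J$ and $\underline K$ are both empty (written $\phi\colon f\Rightarrow g$), horizontal if $f$ and $g$ are identities. Given $n\ge1$ cells $\phi_i\colon\underline J_i\Rightarrow\underline K_i$, the vertical target of each being the vertical source of the next, and a cell $\psi\colon\underline K_1\frown\dotsb\frown\underline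 K_n\Rightarrow\underline L$ ($\frown$ denotes concatenation), there is a composite $\psi\circ(\phi_1,\dotsc,\phi_n)\colon\underline J_1\frown\dotsb\frown\underline J_n\Rightarrow\underline L$ whose vertical source (target) is that of $\psi$ composed with that of $\phi_1$ ($\phi_n$). There are identity cells $\mathrm{id}_J\colon J\Rightarrow J$ (horizontal) and $\mathrm{id}_f\colon f\Rightarrow f$ (vertical), with $\mathrm{id}_h\circ(\mathrm{id}_f)=\mathrm{id}_{h\circ f}$; $\mathrm{id}_A:=\mathrm{id}_{\mathrm{id}_A}$. Axioms: $\chi\circ(\psi_1\circ(\phi_{11},\dotsc,\phi_{1m_1}),\dotsc,\psi_n\circ(\phi_{n1},\dotsc,\phi_{nm_n}))=(\chi\circ(\psi_1,\dotsc,\psi_n))\circ(\phi_{11},\dotsc,\phi_{nm_n})$ whenever the left-hand side makes sense; $\mathrm{id}_C\circ(\phi)=\phi$, $\mathrm{id}_K\circ(\phi)=\phi$, $\phi\circ(\mathrm{id}_A)=\phi$, $\phi\circ(\mathrm{id}_{J_1},\dotsc,\mathrm{id}_{J_n})=\phi$ and $\psi\circ(\phi_1,\dotsc,\phi_i,\mathrm{id}_{f_i},\phi_{i+1},\dotsc,\phi_n)=\psi\circ(\phi_1,\dotsc,\phi_n)$ whenever these make sense. Notation: $h\circ\phi:=\mathrm{id}_h\circ(\phi)$, $\psi\circ f:=\psi\circ(\mathrm{id}_f)$; for adjacent cells $\phi\colon\underline J\Rightarrow\underline K$, $\psi\colon\underline H\Rightarrow\underline L$ with $\underline K\frown\underline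 L$ of length $\le1$, $\phi\odot\psi:=\mathrm{id}_{\underline K\frown\underline L}\circ(\phi,\psi)$, where $\mathrm{id}_{(C)}$ means $\mathrm{id}_C$. **Functors, transformations, monads.** A functor of avdcs maps objects, vertical and horizontal morphisms and cells, preserving sources, targets, composites and identities strictly. A transformation $\xi\colon F\Rightarrow G$ consists of a natural transformation $\xi_A\colon FA\to GA$ on vertical categories and cells $\xi_J\colon FJ\Rightarrow GJ$ with vertical source $\xi_A$ and target $\xi_B$, for $J\colon A\nrightarrow B$, with $G\phi\circ\xi_{\underline J}=\xi_{\underline K}\circ F\phi$ for every cell $\phi\colon\underline J\Rightarrow\underline K$, where $\xi_{\underline J}=(\xi_{J_1},\dotsc,\xi_{J_n})$, or $\xi_A$ if $\underline J=(A)$. A monad $T=(T,\mu,\iota)$ on $\mathcal K$ is a monad in the $2$-category of avdcs so obtained. **Colax $T$-algebras.** A colax $T$-algebra $(A,a,\bar a,\tilde a)$: an object $A$, vertical $a\colon TA\to A$, vertical cells $\bar a\colon a\circ\mu_A\Rightarrow a\circ Ta$ and $\tilde a\colon a\circ\iota_A\Rightarrow\mathrm{id}_A$ with $(\bar a\circ T\mu_A)\odot(a\circ T\bar a)=(\bar a\circ\mu_{TA})\odot(\bar a\circ T^2a)$ and $(\bar a\circ\iota_{TA})\odot(\tilde a\circ a)=\mathrm{id}_a=(\bar a\circ T\iota_A)\odot(a\circ T\tilde a)$. A lax $T$-morphism $(f,\bar f)\colon A\to C$ is a vertical $f$ with a vertical cell $\bar f\colon c\circ Tf\Rightarrow f\circ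 a$ such that $(\bar c\circ T^2f)\odot(c\circ T\bar f)\odot(\bar f\circ Ta)=(\bar f\circ\mu_A)\odot(f\circ\bar a)$ and $(\bar f\circ\iota_A)\odot(f\circ\tilde a)=\tilde c\circ f$. A colax $T$-morphism has $\bar f\colon f\circ a\Rightarrow c\circ Tf$ such that $(f\circ\bar a)\odot(\bar f\circ Ta)\odot(c\circ T\bar f)=(\bar f\circ\mu_A)\odot(\bar c\circ T^2f)$ and $(\bar f\circ\iota_A)\odot(\tilde c\circ f)=f\circ\tilde a$. Pseudo $T$-morphism: $\bar f$ invertible. A horizontal $T$-morphism $(J,\bar J)\colon A\nrightarrow B$ is $J\colon A\nrightarrow B$ with a structure cell $\bar J\colon TJ\Rightarrow J$, vertical source $a$ and target $b$, such that $(\bar J\circ\mu_J)\odot\bar b=\bar a\odot(\bar J\circ T\bar J)$ and $(\bar J\circ\iota_J)\odot\tilde b=\tilde a\odot\mathrm{id}_J$. A $T$-cell is a cell $\phi\colon\underline J\Rightarrow\underline K$ between such, with vertical source $f$ and target $g$, such that for lax $f,g$: $(\underline{\bar K}\circ T\phi)\odot\bar g=\bar f\odot(\phi\circ(\bar J_1,\dotsc,\bar J_n))$; for colax $f,g$: $\bar f\odot(\underline{\bar K}\circ T\phi)=(\phi\circ(\bar J_1,\dotsc,\bar J_n))\odot\bar g$; here $\underline{\bar K}=\bar K$, or $\mathrm{id}_c$ if $\underline K=(C)$, and $(\bar J_1,\dotsc,\bar J_n)$ means $\mathrm{id}_{a_0}$ if $n=0$. $T\text{-}\mathsf{Alg}_{(\mathrm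 c,w)}$ is the avdc of colax $T$-algebras, $w$-type vertical $T$-morphisms ($\mathrm c$: colax, $\mathrm l$: lax, $\mathrm{ps}$: pseudo), horizontal $T$-morphisms and $T$-cells, with structure lifted from $\mathcal K$. $T\text{-}\mathsf{Alg}_{(\mathrm c,\mathrm{ps},\mathrm{lbc})}\subset T\text{-}\mathsf{Alg}_{(\mathrm c,\mathrm{ps})}$ is obtained by restricting to horizontal $T$-morphisms that satisfy the left Beck-Chevalley condition (below). **Restrictions, cocartesian paths.** A cell $\psi\colon\underline J\Rightarrow\underline K$ with $\underline J$ of length $\le1$, vertical source $f$ and target $g$, is cartesian if every cell $\chi\colon\underline H\Rightarrow\underline K$ with vertical source $f\circ h$ and target $g\circ k$ factors uniquely as $\chi=\psi\circ\phi$ with $\phi\colon\underline H\Rightarrow\underline J$ having vertical source $h$ and target $k$. If $\underline J=J$ has length $1$ then $J$ is the restriction $\underline K(f,g)$; $T$ preserves it if the $T$-image of the cartesian cell is cartesian. A path $(\phi_1,\dotsc,\phi_n)$ of unary cells $\phi_i\colon\underline J_i\Rightarrow K_i$, $K_i\colon C_{i-1}\nrightarrow C_i$, with successive vertical sources/targets $f_0,\dotsc,f_n$, is weakly cocartesian if every cell $\psi$ with horizontal source $\underline J_1\frown\dotsb\frown\underline J_n$, vertical source $h\circ f_0$ and target $k\circ f_n$ factors uniquely as $\psi'\circ(\phi_1,\dotsc,\phi_n)$ with $\psi'$ having horizontal source $(K_1,\dotsc,K_n)$, vertical source $h$ and target $k$. It is cocartesian if moreover the restrictions $J'(\mathrm{id},f_0)$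 and $J''(f_n,\mathrm{id})$ exist for all $J'\colon A'\nrightarrow C_0$, $J''\colon C_n\nrightarrow A''$, and for all paths $(J'_1,\dotsc,J'_p)$ ending at $C_0$ and $(J''_1,\dotsc,J''_q)$ starting at $C_n$, $p,q\ge0$, the path $(\mathrm{id}_{J'_1},\dotsc,\mathrm{id}_{J'_{p-1}},\mathrm{cart},\phi_1,\dotsc,\phi_n,\mathrm{cart},\mathrm{id}_{J''_2},\dotsc,\mathrm{id}_{J''_q})$ is weakly cocartesian, with $\mathrm{cart}$ the cartesian cells defining $J'_p(\mathrm{id},f_0)$ and $J''_1(f_n,\mathrm{id})$ (left, resp. right, part omitted if $p=0$, resp. $q=0$). If $\phi_n\colon(H_1,\dotsc,H_m)\Rightarrow K_n$ has $m\ge1$ and vertical target $\mathrm{id}_A$, the path is right pointwise cocartesian if for every $f\colon B\to A$: $H_m(\mathrm{id},f)$ exists iff $K_n(\mathrm{id},f)$ does, and in that case $(\phi_1,\dotsc,\phi_{n-1},\phi_n')$ is cocartesian, where $\phi_n\circ(\mathrm{id},\dotsc,\mathrm{id},\mathrm{cart})=\mathrm{cart}\circ\phi'_n$. A horizontal $T$-morphism $(J,\bar J)\colon A\nrightarrow B$ satisfies the left Beck-Chevalley condition if $J(\mathrm{id},b)$ exists and the factorisation $\bar J'\colon TJ\Rightarrow J(\mathrm{id},b)$ of $\bar J$ through $J(\mathrm{id},b)\Rightarrow J$ is right pointwise cocartesian (as a path of length $1$). **Kan extensions, exactness.** Let $\eta\colon(J_1,\dotsc,J_n)\Rightarrow M$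 be a nullary cell with vertical source $d\colon A_0\to M$ and target $l\colon A_n\to M$. It defines $l$ as the left Kan extension of $d$ along $(J_1,\dotsc,J_n)$ if for every path $\underline H$ of length $m\ge0$ from $A_n$ to $B_m$ and $k\colon B_m\to M$, each nullary cell $\phi\colon(J_1,\dotsc,J_n)\frown\underline H\Rightarrow M$ with vertical source $d$ and target $k$ factors uniquely as $\phi=\eta\odot\phi'$ with $\phi'\colon\underline H\Rightarrow M$ having vertical source $l$ and target $k$; as the weak left Kan extension if this holds for $m=0$. If $n\ge1$ it defines $l$ as the pointwise (weak) left Kan extension if, for every $f\colon B\to A_n$ such that $J_n(\mathrm{id},f)$ exists, $\eta\circ(\mathrm{id},\dotsc,\mathrm{id},\mathrm{cart})$ defines $l\circ f$ as the (weak) left Kan extension of $d$ along $(J_1,\dotsc,J_n(\mathrm{id},f))$. A path $(\phi_1,\dotsc,\phi_n)$, $n\ge1$, of unary cells $\phi_i\colon\underline J_i\Rightarrow K_i$, $K_i\colon C_{i-1}\nrightarrow C_i$, where $\phi_i$ has vertical source $f_{i-1}$ and vertical target $f_i$, is (pointwise) (weak) left $d$-exact, $d\colon C_0\to M$, if for every nullary $\eta\colon(K_1,\dotsc,K_n)\Rightarrow M$ defining $l$ as the (pointwise) (weak) left Kan extension of $d$ along $(K_1,\dotsc,K_n)$, $\eta\circ(\phi_1,\dotsc,\phi_n)$ defines $l\circ f_n$ as the (pointwise) (weak) left Kan extension of $d\circ f_0$ along $\underline J_1\frown\dotsb\frown\underline J_n$. The algebraic structure of $M$ preserves the (pointwise)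 (weak) left Kan extension of a vertical morphism $d$ along $(J_1,\dotsc,J_n)$ (in $\mathcal K$) if, for any cell $\eta$ defining $l$ as such a Kan extension, $m\circ T\eta$ defines $m\circ Tl$ as the (pointwise) (weak) left Kan extension of $m\circ Td$ along $(TJ_1,\dotsc,TJ_n)$. **Creation.** A functor $U$ creates the (pointwise) (weak) left Kan extension of $d$ along $(J_1,\dotsc,J_n)$ if for every cell $\psi$ that defines the (pointwise) (weak) left Kan extension of $Ud$ along $(UJ_1,\dotsc,UJ_n)$ there is a unique cell $\phi$ (with horizontal source $(J_1,\dotsc,J_n)$, vertical source $d$) with $U\phi=\psi$, and $\phi$ defines the (pointwise) (weak) left Kan extension of $d$ along $(J_1,\dotsc,J_n)$. *)

(* Defs.v *)
Set Warnings "-notation-overridden".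
From Stdlib Require Import ClassicalEpsilon ProofIrrelevance.
From mathcomp Require Import ssreflect ssrfun ssrbool eqtype ssrnat seq.
Set Implicit Arguments. Unset Strict Implicit. Unset Printing Implicit Defensive.

(* Augmented virtual double categories are presented with a single type for each
   kind of data and with sources and targets as functions, so that strict
   equalities of boundaries are plain equalities.  Operations are total; their
   axioms, and every later use, concern composable arguments only, and the values
   on other arguments are junk.

   A path of horizontal morphisms is a list, its endpoints being recorded
   separately (they matter when the list is empty): the source of a cell phi runs
   from vdom (vsrc phi) to vdom (vtgt phi), its target, a path of length at most 1
   represented by an option, from vcod (vsrc phi) to vcod (vtgt phi). *)

Definition oseq (E : Type) (o : option E) : seq E := if o is Some x then [:: x] else [::].

Record avdc_graph := AvdcGraph {
  ob : Type; vmor : Type; hmor : Type; cell : Type;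
  vdom : vmor -> ob; vcod : vmor -> ob;
  hdom : hmor -> ob; hcod : hmor -> ob;
  hsrc : cell -> seq hmor; htgt : cell -> option hmor;
  vsrc : cell -> vmor; vtgt : cell -> vmor }.

(* [linked s t x p y]: the edges of p form a path from x to y. *)
Fixpoint linked (X E : Type) (s t : E -> X) (x : X) (p : seq E) (y : X) : Prop :=
  if p is e :: p' then s e = x /\ linked s t (t e) p' y else x = y.

Section Graph.
Variable G : avdc_graph.

Definition hpath : ob G -> seq (hmor G) -> ob G -> Prop := linked (@hdom G) (@hcod G).
Definition chain : vmor G -> seq (cell G) -> vmor G -> Prop := linked (@vsrc G) (@vtgt G).
Definition hsrcs (phis : seq (cell G)) : seq (hmor G) := flatten (map (@hsrc G) phis).
Definition htgts (phis : seq (cell G)) : seq (hmor G) := pmap (@htgt G) phis.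

Record is_cell (phi : cell G) Js o f g : Prop := IsCell {
  cell_hsrc : hsrc phi = Js; cell_htgt : htgt phi = o;
  cell_vsrc : vsrc phi = f; cell_vtgt : vtgt phi = g }.

Definition is_vcell (phi : cell G) f g : Prop := is_cell phi [::] None f g.

(* psi o (phis) makes sense; f is the first vertical source of phis and g the last
   vertical target.  The condition comp_ver only adds something when all
   horizontal targets are empty. *)
Record composable (psi : cell G) (f : vmor G) (phis : seq (cell G)) (g : vmor G) : Prop :=
  Composable {
    comp_nonnil : phis <> [::];
    comp_chain : chain f phis g;
    comp_hor : hsrc psi = htgts phis;
    comp_ver : vcod f = vdom (vsrc psi) }.
End Graph.

(* [vcomp g f] is g after f. In ccompA, d is the list of the (psi_i, (phi_ij)_j);
   the hypotheses say that both sides of the axiom make sense. *)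
Record avdc := Avdc {
  graph :> avdc_graph;
  vid : ob graph -> vmor graph;
  vcomp : vmor graph -> vmor graph -> vmor graph;
  hidc : hmor graph -> cell graph;
  vidc : vmor graph -> cell graph;
  ccomp : cell graph -> seq (cell graph) -> cell graph;

  vdom_id : forall A : ob graph, vdom (vid A) = A;
  vcod_id : forall A : ob graph, vcod (vid A) = A;
  vdom_comp : forall g f : vmor graph, vcod f = vdom g -> vdom (vcomp g f) = vdom f;
  vcod_comp : forall g f : vmor graph, vcod f = vdom g -> vcod (vcomp g f) = vcod g;
  vcompA : forall h g f : vmor graph, vcod f = vdom g -> vcod g = vdom h ->
    vcomp h (vcomp g f) = vcomp (vcomp h g) f;
  vcomp1f : forall f : vmor graph, vcomp (vid (vcod f)) f = f;
  vcompf1 : forall f : vmor graph, vcomp f (vid (vdom f)) = f;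

  hsrc_path : forall phi : cell graph, hpath (vdom (vsrc phi)) (hsrc phi) (vdom (vtgt phi));
  htgt_path : forall phi : cell graph, hpath (vcod (vsrc phi)) (oseq (htgt phi)) (vcod (vtgt phi));

  hidc_cell : forall J, is_cell (hidc J) [:: J] (Some J) (vid (hdom J)) (vid (hcod J));
  vidc_cell : forall f, is_vcell (vidc f) f f;
  ccomp_cell : forall (psi : cell graph) f phis g, composable psi f phis g ->
    is_cell (ccomp psi phis) (hsrcs phis) (htgt psi) (vcomp (vsrc psi) f) (vcomp (vtgt psi) g);

  ccomp_vidc : forall h f : vmor graph, vcod f = vdom h -> ccomp (vidc h) [:: vidc f] = vidc (vcomp h f);
  ccompA : forall chi (d : seq (cell graph * seq (cell graph))) h k f g,
    composable chi h (map fst d) k ->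
    chain f (flatten (map snd d)) g ->
    List.Forall (fun p => exists f' g', composable p.1 f' p.2 g') d ->
    ccomp chi (map (fun p => ccomp p.1 p.2) d)
    = ccomp (ccomp chi (map fst d)) (flatten (map snd d));
  ccomp1v : forall phi : cell graph, htgt phi = None -> ccomp (vidc (vid (vcod (vsrc phi)))) [:: phi] = phi;
  ccomp1h : forall (phi : cell graph) K, htgt phi = Some K -> ccomp (hidc K) [:: phi] = phi;
  ccompv1 : forall phi : cell graph, hsrc phi = [::] -> ccomp phi [:: vidc (vid (vdom (vsrc phi)))] = phi;
  ccomph1 : forall phi : cell graph, hsrc phi <> [::] -> ccomp phi (map hidc (hsrc phi)) = phi;
  ccomp_ins : forall (psi : cell graph) s1 s2 f g h,
    composable psi f (s1 ++ s2) g -> composable psi f (s1 ++ vidc h :: s2) g ->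
    ccomp psi (s1 ++ vidc h :: s2) = ccomp psi (s1 ++ s2) }.

Arguments vid {a} _. Arguments vcomp {a} _ _. Arguments hidc {a} _. Arguments vidc {a} _.
Arguments ccomp {a} _ _.

Notation "g ∘ f" := (vcomp g f) (at level 40, left associativity).

Section Ops.
Variable K : avdc.
Definition lwhisk (h : vmor K) (phi : cell K) : cell K := ccomp (vidc h) [:: phi].
Definition rwhisk (psi : cell K) (f : vmor K) : cell K := ccomp psi [:: vidc f].
Definition id_tgt (phi : cell K) : cell K :=
  if htgt phi is Some L then hidc L else vidc (vid (vcod (vsrc phi))).
(* The identity in front of [phi; psi] is that of the concatenated target, which is
   meant to have length at most 1. *)
Definition hpaste (phi psi : cell K) : cell K :=
  ccomp (if htgt phi is Some L then hidc L else id_tgt psi) [:: phi; psi].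
End Ops.
Notation "h ◁ phi" := (lwhisk h phi) (at level 41, right associativity).
Notation "psi ▷ f" := (rwhisk psi f) (at level 40, left associativity).
Notation "phi ⊙ psi" := (hpaste phi psi) (at level 50, left associativity).

Section Linked.
Variables (X E : Type) (s t : E -> X).
Lemma linked_cat x p q z : linked s t x (p ++ q) z <-> exists2 y, linked s t x p y & linked s t y q z.
Proof.
elim: p x => [|e p IH] x /=; first by split=> [H|[y -> //]]; exists x.
split=> [[<- /IH [y Hp Hq]]|[y [<- Hp] Hq]]; first by exists y.
by split=> //; apply/IH; exists y.
Qed.
Lemma linked_uniq x p y z : linked s t x p y -> linked s t x p z -> y = z.
Proof. by elim: p x => [|e p IH] x /=; [move=> <- <-|case=> _ /IH H [_ /H]]. Qed.
Lemma linked_src x p y x' y' : p <> [::] -> linked s t x p y -> linked s t x' p y' -> x = x' /\ y = y'.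
Proof. by case: p => //= e p _ [<- H] [<- H']; split=> //; apply: linked_uniq H H'. Qed.
End Linked.

Lemma htgts_cat (G : avdc_graph) (s1 s2 : seq (cell G)) : htgts (s1 ++ s2) = htgts s1 ++ htgts s2.
Proof. exact: pmap_cat. Qed.
Lemma hsrcs_cat (G : avdc_graph) (s1 s2 : seq (cell G)) : hsrcs (s1 ++ s2) = hsrcs s1 ++ hsrcs s2.
Proof. by rewrite /hsrcs map_cat flatten_cat. Qed.

Section Lemmas.
Variable K : avdc.
Implicit Types (phi psi chi : cell K) (f g h : vmor K) (s : seq (cell K)).

Lemma hsrc_hidc J : hsrc (hidc J : cell K) = [:: J]. Proof. exact: cell_hsrc (hidc_cell J). Qed.
Lemma htgt_hidc J : htgt (hidc J : cell K) = Some J. Proof. exact: cell_htgt (hidc_cell J). Qed.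
Lemma vsrc_hidc J : vsrc (hidc J : cell K) = vid (hdom J). Proof. exact: cell_vsrc (hidc_cell J). Qed.
Lemma vtgt_hidc J : vtgt (hidc J : cell K) = vid (hcod J). Proof. exact: cell_vtgt (hidc_cell J). Qed.
Lemma hsrc_vidc f : hsrc (vidc f : cell K) = [::]. Proof. exact: cell_hsrc (vidc_cell f). Qed.
Lemma htgt_vidc f : htgt (vidc f : cell K) = None. Proof. exact: cell_htgt (vidc_cell f). Qed.
Lemma vsrc_vidc f : vsrc (vidc f : cell K) = f. Proof. exact: cell_vsrc (vidc_cell f). Qed.
Lemma vtgt_vidc f : vtgt (vidc f : cell K) = f. Proof. exact: cell_vtgt (vidc_cell f). Qed.
Definition idE := (hsrc_hidc, htgt_hidc, vsrc_hidc, vtgt_hidc, hsrc_vidc, htgt_vidc, vsrc_vidc, vtgt_vidc, @vdom_id K, @vcod_id K).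

Lemma vtgt_dom_nil phi : hsrc phi = [::] -> vdom (vtgt phi) = vdom (vsrc phi).
Proof. by move=> E; have := hsrc_path phi; rewrite E. Qed.
Lemma vtgt_cod_nil phi : htgt phi = None -> vcod (vtgt phi) = vcod (vsrc phi).
Proof. by move=> E; have := htgt_path phi; rewrite E. Qed.
Lemma hsrc_path1 phi J : hsrc phi = [:: J] -> vdom (vsrc phi) = hdom J /\ vdom (vtgt phi) = hcod J.
Proof. by move=> E; have := hsrc_path phi; rewrite E => -[]. Qed.
Lemma htgt_path1 phi J : htgt phi = Some J -> vcod (vsrc phi) = hdom J /\ vcod (vtgt phi) = hcod J.
Proof. by move=> E; have := htgt_path phi; rewrite E => -[]. Qed.


Lemma htgts_path f s g : chain f s g -> hpath (vcod f) (htgts s) (vcod g).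
Proof.
elim: s f => [|phi s IH] f /=; first by move=> ->.
case=> <- /IH; have := htgt_path phi; rewrite /htgts /=; case: (htgt phi) => [J|] /=.
  by case=> e1 e2 H; split=> //; rewrite e2.
by move=> ->.
Qed.

Lemma hsrcs_path f s g : chain f s g -> hpath (vdom f) (hsrcs s) (vdom g).
Proof.
elim: s f => [|phi s IH] f /=; first by move=> ->.
by case=> <- /IH H; apply/linked_cat; exists (vdom (vtgt phi)) => //; apply: hsrc_path.
Qed.

Lemma comp_ver_tgt psi f s g : composable psi f s g -> vcod g = vdom (vtgt psi).
Proof.
case=> _ /htgts_path H E V; have := hsrc_path psi; rewrite E -V => H'.
exact: linked_uniq H H'.
Qed.

Lemma composable_uniq psi f s g f' g' : composable psi f s g -> chain f' s g' -> f = f' /\ g = g'.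
Proof. by case=> n c _ _ c'; apply: (linked_src n c c'). Qed.

Lemma hsrc_ccomp psi f s g : composable psi f s g -> hsrc (ccomp psi s) = hsrcs s.
Proof. by move/ccomp_cell=> []. Qed.
Lemma htgt_ccomp psi f s g : composable psi f s g -> htgt (ccomp psi s) = htgt psi.
Proof. by move/ccomp_cell=> []. Qed.
Lemma vsrc_ccomp psi f s g : composable psi f s g -> vsrc (ccomp psi s) = vsrc psi ∘ f.
Proof. by move/ccomp_cell=> []. Qed.
Lemma vtgt_ccomp psi f s g : composable psi f s g -> vtgt (ccomp psi s) = vtgt psi ∘ g.
Proof. by move/ccomp_cell=> []. Qed.

Lemma id_tgt_hsrc phi : hsrc (id_tgt phi) = oseq (htgt phi).
Proof. by rewrite /id_tgt; case: (htgt phi) => [J|] /=; rewrite idE. Qed.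
Lemma id_tgt_htgt phi : htgt (id_tgt phi) = htgt phi.
Proof. by rewrite /id_tgt; case: (htgt phi) => [J|] /=; rewrite idE. Qed.
Lemma id_tgt_vsrc phi : vsrc (id_tgt phi) = vid (vcod (vsrc phi)).
Proof.
rewrite /id_tgt; case E: (htgt phi) => [J|] /=; rewrite idE //.
by have [-> _] := htgt_path1 E.
Qed.
Lemma id_tgt_vtgt phi : vtgt (id_tgt phi) = vid (vcod (vtgt phi)).
Proof.
rewrite /id_tgt; case E: (htgt phi) => [J|] /=; rewrite idE //.
  by have [_ ->] := htgt_path1 E.
by rewrite vtgt_cod_nil.
Qed.
Lemma id_tgt_comp phi : composable (id_tgt phi) (vsrc phi) [:: phi] (vtgt phi).
Proof.
split=> //=; last by rewrite id_tgt_vsrc vdom_id.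
by rewrite id_tgt_hsrc; case: (htgt phi).
Qed.
Lemma ccomp_id_tgt phi : ccomp (id_tgt phi) [:: phi] = phi.
Proof.
rewrite /id_tgt; case E: (htgt phi) => [J|] /=; first by rewrite ccomp1h.
by rewrite ccomp1v.
Qed.

Lemma ccomp_drop psi s1 s2 f g h : composable psi f (s1 ++ vidc h :: s2) g -> s1 ++ s2 <> [::] ->
  composable psi f (s1 ++ s2) g /\ ccomp psi (s1 ++ vidc h :: s2) = ccomp psi (s1 ++ s2).
Proof.
move=> C n; suff C' : composable psi f (s1 ++ s2) g by split=> //; apply: ccomp_ins C' C.
case: C => _ c e v; split=> //.
  case/linked_cat: c => y c1 /= [e1 c2]; apply/linked_cat; exists y => //.
  by move: c2; rewrite /= vtgt_vidc -e1 vsrc_vidc.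
by rewrite e !htgts_cat /= /htgts /= htgt_vidc.
Qed.

Lemma ccomp_insert psi s1 s2 f g h : composable psi f (s1 ++ s2) g -> chain f s1 h ->
  composable psi f (s1 ++ vidc h :: s2) g /\ ccomp psi (s1 ++ vidc h :: s2) = ccomp psi (s1 ++ s2).
Proof.
move=> C c; suff C' : composable psi f (s1 ++ vidc h :: s2) g by split=> //; apply: ccomp_ins C C'.
case: C => n c' e v; split=> //; first by case: (s1).
  apply/linked_cat; exists h => //=; rewrite idE vtgt_vidc; split=> //.
  by case/linked_cat: c' => y /(linked_uniq c) ->.
by rewrite e !htgts_cat /= /htgts /= htgt_vidc.
Qed.

Lemma chain_id_tgt f s g : chain f s g -> chain (vid (vcod f)) (map (@id_tgt K) s) (vid (vcod g)).
Proof.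
elim: s f => [|phi s IH] f /=; first by move=> ->.
by case=> <- /IH H; split; rewrite ?id_tgt_vsrc ?id_tgt_vtgt.
Qed.
Lemma htgts_id_tgt s : htgts (map (@id_tgt K) s) = htgts s.
Proof. by elim: s => //= phi s IH; rewrite /htgts /= id_tgt_htgt -!/(htgts _) IH. Qed.

Lemma ccomp_id_aux psi s1 s f g : composable psi f (s1 ++ map (@id_tgt K) s) g ->
  s1 ++ map hidc (htgts s) <> [::] ->
  ccomp psi (s1 ++ map (@id_tgt K) s) = ccomp psi (s1 ++ map hidc (htgts s)).
Proof.
elim: s s1 => //= phi s IH s1 C.
rewrite /htgts /= -/(htgts s).
case E: (htgt phi) => [J|] /= n.
  have e: id_tgt phi = hidc J by rewrite /id_tgt E.
  by rewrite e -!cat_rcons in C n *; apply: IH C n.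
have e: id_tgt phi = vidc (vid (vcod (vsrc phi))) by rewrite /id_tgt E.
rewrite e in C *.
have m: s1 ++ map (@id_tgt K) s <> [::].
  by move: n => /=; case: (s1) => //=; case: (s).
by case: (ccomp_drop C m) => C' ->; apply: IH C' n.
Qed.

Lemma ccomp_nil_id psi s f g : composable psi f (map (@id_tgt K) s) g -> htgts s = [::] ->
  ccomp psi (map (@id_tgt K) s) = psi.
Proof.
elim: s f => [|phi s IH] f C; first by case: C.
rewrite /htgts /=; case E: (htgt phi) => [//|] /= Es.
case: s IH C Es => [|psi' s] IH C Es.
  have e: hsrc psi = [::] by rewrite (comp_hor C) /htgts /= id_tgt_htgt E.
  rewrite /= /id_tgt E; suff -> : vcod (vsrc phi) = vdom (vsrc psi) by rewrite ccompv1.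
  case: C => _ /= [<- _] _ <-; by rewrite id_tgt_vsrc vcod_id.
have e: id_tgt phi = vidc (vid (vcod (vsrc phi))) by rewrite /id_tgt E.
rewrite map_cons e in C *.
have [] := @ccomp_drop _ [::] _ _ _ _ C; first by [].
by rewrite /= => C' ->; apply: IH C' Es.
Qed.

Lemma ccomp_ids psi f s g : composable psi f s g ->
  composable psi (vid (vcod f)) (map (@id_tgt K) s) (vid (vcod g)) /\
  ccomp psi (map (@id_tgt K) s) = psi.
Proof.
case=> n c e v.
have C: composable psi (vid (vcod f)) (map (@id_tgt K) s) (vid (vcod g)).
  split=> //; [by case: (s) n|exact: chain_id_tgt|by rewrite htgts_id_tgt|by rewrite vcod_id].
split=> //.
case E: (htgts s) => [|J Js]; first exact: ccomp_nil_id C E.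
rewrite -[X in ccomp psi X]cat0s (@ccomp_id_aux _ [::] _ _ _ C) ?E //=.
by rewrite -[_ :: _]/(map hidc (J :: Js)) -E -e ccomph1 // e E.
Qed.

Lemma ForallE_map_id s f g : chain f s g ->
  List.Forall (fun p => exists f' g', composable p.1 f' p.2 g') [seq (id_tgt phi, [:: phi]) | phi <- s].
Proof. by elim: s f => //= phi s IH f [_ /IH H]; constructor=> //; exists (vsrc phi), (vtgt phi); apply: id_tgt_comp. Qed.

Lemma map_fst_id s : map fst [seq (id_tgt phi, [:: phi]) | phi <- s] = map (@id_tgt K) s.
Proof. by rewrite -map_comp. Qed.
Lemma map_snd_id s : flatten (map snd [seq (id_tgt phi, [:: phi]) | phi <- s]) = s.
Proof. by elim: s => //= phi s ->. Qed.
Lemma map_comp_id s : map (fun p => ccomp p.1 p.2) [seq (id_tgt phi, [:: phi]) | phi <- s] = s.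
Proof. by elim: s => //= phi s ->; rewrite ccomp_id_tgt. Qed.

Lemma ccomp_block chi psi s1 b s2 f f1 g1 g :
  composable psi f1 b g1 ->
  chain f s1 f1 -> chain g1 s2 g ->
  hsrc chi = htgts s1 ++ oseq (htgt psi) ++ htgts s2 ->
  vcod f = vdom (vsrc chi) ->
  vsrc psi = vid (vcod f1) -> vtgt psi = vid (vcod g1) ->
  ccomp chi (s1 ++ ccomp psi b :: s2)
  = ccomp (ccomp chi (map (@id_tgt K) s1 ++ psi :: map (@id_tgt K) s2)) (s1 ++ b ++ s2).
Proof.
move=> C c1 c2 e v v1 v2.
pose i := fun phi : cell K => (id_tgt phi, [:: phi]).
have := @ccompA K chi (map i s1 ++ (psi, b) :: map i s2) (vid (vcod f)) (vid (vcod g)) f g.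
rewrite !map_cat !map_cons !flatten_cat /= !map_fst_id !map_snd_id !map_comp_id; apply.
- split; first by case: (map _ s1).
  + apply/linked_cat; exists (vid (vcod f1)); first exact: chain_id_tgt.
    by split=> //; rewrite v2; apply: chain_id_tgt.
  + by rewrite e htgts_cat -cat1s htgts_cat !htgts_id_tgt /htgts /=; case: (htgt psi).
  + by rewrite vcod_id.
- apply/linked_cat; exists f1 => //; apply/linked_cat; exists g1 => //; exact: comp_chain C.
- apply/List.Forall_app; split; first exact: ForallE_map_id c1.
  by constructor; [exists f1, g1|exact: ForallE_map_id c2].
Qed.

End Lemmas.

Section OpsLemmas.
Variable K : avdc.
Implicit Types (phi psi chi : cell K) (f g h k : vmor K) (s : seq (cell K)).

Definition ocat (o o' : option (hmor K)) := if o is Some L then Some L else o'.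
Definition o1 (o o' : option (hmor K)) := o = None \/ o' = None.

Lemma hpaste_comp phi psi : vtgt phi = vsrc psi -> o1 (htgt phi) (htgt psi) ->
  composable (if htgt phi is Some L then hidc L else id_tgt psi) (vsrc phi) [:: phi; psi] (vtgt psi).
Proof.
move=> e o; split=> //=; rewrite /htgts /=.
  case E: (htgt phi) o => [L|] /=; last by rewrite id_tgt_hsrc; case: (htgt psi).
  by case=> // ->; rewrite hsrc_hidc.
case E: (htgt phi) o => [L|] /= o; rewrite ?idE ?id_tgt_vsrc ?idE; first by case: (htgt_path1 E).
by rewrite -e vtgt_cod_nil.
Qed.

Lemma hpaste_cell phi psi Js Hs o o' f g h :
  is_cell phi Js o f g -> is_cell psi Hs o' g h -> o1 o o' -> is_cell (phi ⊙ psi) (Js ++ Hs) (ocat o o') f h.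
Proof.
case=> <- <- <- e [<- <- e' <-] oo; rewrite -e in e'.
have C := hpaste_comp (esym e') oo.
have [p1 p2 p3 p4] := ccomp_cell C.
split; rewrite /hpaste ?p1 ?p2 ?p3 ?p4.
- by rewrite /hsrcs /= cats0.
- by case: (htgt phi) => [L|]; rewrite ?id_tgt_htgt ?idE.
- case E: (htgt phi) oo => [L|] oo; rewrite ?id_tgt_vsrc ?idE.
    by case: (htgt_path1 E) => <- _; rewrite vcomp1f.
  by rewrite e' (vtgt_cod_nil E) vcomp1f.
- case E: (htgt phi) oo => [L|] oo; rewrite ?id_tgt_vtgt ?idE ?vcomp1f //.
  case: oo => // E'; case: (htgt_path1 E) => _ <-.
  by rewrite -e' -(vtgt_cod_nil E') vcomp1f.
Qed.

Lemma ccomp_pair psi1 psi2 s1 s2 f g h : composable psi1 f s1 g -> composable psi2 g s2 h ->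
  vtgt psi1 = vsrc psi2 -> o1 (htgt psi1) (htgt psi2) ->
  ccomp psi1 s1 ⊙ ccomp psi2 s2 = ccomp (psi1 ⊙ psi2) (s1 ++ s2).
Proof.
move=> C1 C2 e o; have C := hpaste_comp e o.
have := @ccompA K _ [:: (psi1, s1); (psi2, s2)] _ _ f h C.
rewrite /= cats0 /hpaste => <-.
- by rewrite (htgt_ccomp C1) /id_tgt (htgt_ccomp C2) (vsrc_ccomp C2) vcod_comp // (comp_ver C2).
- by apply/linked_cat; exists g; [apply: comp_chain C1|apply: comp_chain C2].
- by constructor; [exists f, g|constructor; [exists g, h|]].
Qed.

Lemma ccomp_hpaste chi phi psi s1 s2 f g : composable chi f (s1 ++ phi :: psi :: s2) g ->
  o1 (htgt phi) (htgt psi) ->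
  composable chi f (s1 ++ (phi ⊙ psi) :: s2) g /\
  ccomp chi (s1 ++ (phi ⊙ psi) :: s2) = ccomp chi (s1 ++ phi :: psi :: s2).
Proof.
move=> [n c e v] o.
case/linked_cat: (c) => f1 c1 [e1 [e2 c2]].
have H : is_cell (phi ⊙ psi) (hsrc phi ++ hsrc psi) (ocat (htgt phi) (htgt psi)) f1 (vtgt psi).
  by apply: hpaste_cell o => //; split.
have C : composable chi f (s1 ++ (phi ⊙ psi) :: s2) g.
  split=> //; first by case: (s1).
    by apply/linked_cat; exists f1 => //=; rewrite (cell_vsrc H) (cell_vtgt H).
  rewrite e !htgts_cat /htgts /= (cell_htgt H); congr (_ ++ _).
  by case: (htgt phi) o => [L|] //; case: (htgt psi) => //= J [].
split=> //.
have Cp := hpaste_comp (esym e2) o; rewrite e1 in Cp.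
rewrite /hpaste (ccomp_block Cp c1 c2) //=.
- have [Ci] := ccomp_ids C; rewrite map_cat /= => Ei.
  congr (ccomp _ _); rewrite -[RHS]Ei; congr (ccomp _ (_ ++ _ :: _)).
  rewrite {2}/id_tgt (cell_htgt H) (cell_vsrc H) /ocat.
  case E: (htgt phi) => [L|] //; rewrite /id_tgt; case: (htgt psi) => [L'|//] //.
  by rewrite e2 (vtgt_cod_nil E) e1.
- rewrite e !htgts_cat /htgts /=; congr (_ ++ _).
  case: (htgt phi) o => [L|] /= o; rewrite ?id_tgt_htgt ?htgt_hidc; last by case: (htgt psi).
  by case: o => // ->.
- case E: (htgt phi) => [L|]; rewrite ?id_tgt_vsrc ?idE.
    by case: (htgt_path1 E) => <- _; rewrite e1.
  by rewrite e2 (vtgt_cod_nil E) e1.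
- case E: (htgt phi) o => [L|] o; rewrite ?id_tgt_vtgt ?idE //.
  by case: o => // E'; case: (htgt_path1 E) => _ <-; rewrite -e2 (vtgt_cod_nil E').
Qed.

Lemma hpaste_id_tgt phi psi Js Hs f g h o o' : is_cell phi Js o f g -> is_cell psi Hs o' g h -> o1 o o' ->
  id_tgt (phi ⊙ psi) = if htgt phi is Some L then hidc L else id_tgt psi.
Proof.
move=> H1 H2 oo; rewrite {1}/id_tgt; have [_ -> -> _] := hpaste_cell H1 H2 oo.
rewrite /id_tgt (cell_htgt H1) (cell_htgt H2) (cell_vsrc H2).
case: o H1 oo => [L|] //= H1 _; case: o' H2 => // H2.
by rewrite -(cell_vtgt H1) (vtgt_cod_nil (cell_htgt H1)) (cell_vsrc H1).
Qed.

Lemma hpasteA phi psi chi Js Hs Is o o' o'' f g h k :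
  is_cell phi Js o f g -> is_cell psi Hs o' g h -> is_cell chi Is o'' h k ->
  o1 o o' -> o1 o o'' -> o1 o' o'' -> (phi ⊙ psi) ⊙ chi = phi ⊙ (psi ⊙ chi).
Proof.
move=> H1 H2 H3 q1 q2 q3.
have H12 := hpaste_cell H1 H2 q1. have H23 := hpaste_cell H2 H3 q3.
have q : o1 (ocat o o') o'' by case: (o) q1 q2 => //= *; left.
have q' : o1 o (ocat o' o'') by case: (o) q1 q2 => //= L; [case=> // -> [] // ->; right|left].
have C1 : composable (if htgt (phi ⊙ psi) is Some L then hidc L else id_tgt chi) f [:: phi ⊙ psi; chi] k.
  have := @hpaste_comp (phi ⊙ psi) chi; rewrite !(cell_vtgt H12, cell_vsrc H12, cell_vsrc H3, cell_vtgt H3, cell_htgt H12, cell_htgt H3).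
  by apply.
have C2 : composable (if htgt phi is Some L then hidc L else id_tgt (psi ⊙ chi)) f [:: phi; psi ⊙ chi] k.
  have := @hpaste_comp phi (psi ⊙ chi); rewrite !(cell_vtgt H1, cell_vsrc H1, cell_vsrc H23, cell_vtgt H23, cell_htgt H23, cell_htgt H1).
  by apply.
pose i := if htgt phi is Some L then hidc L else id_tgt (psi ⊙ chi).
have Ei : i = if htgt (phi ⊙ psi) is Some L then hidc L else id_tgt chi.
  rewrite /i (cell_htgt H12) (cell_htgt H1); case: (o) => [L|] //=.
  by rewrite (hpaste_id_tgt H2 H3 q3) (cell_htgt H2).
rewrite [LHS]/hpaste [RHS]/hpaste -Ei -/i.
rewrite -Ei -/i in C1 C2.
have C3 : composable i f [:: phi; psi; chi] k.
  split=> //; first by rewrite /chain /= (cell_vsrc H1) (cell_vtgt H1) (cell_vsrc H2) (cell_vtgt H2) (cell_vsrc H3) (cell_vtgt H3).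
    rewrite (comp_hor C1) /htgts /= (cell_htgt H12) (cell_htgt H1) (cell_htgt H2).
    by case: (o) q1 => [L|] //= -[] // ->.
  exact: comp_ver C1.
rewrite -(cell_htgt H1) -(cell_htgt H2) in q1; rewrite -(cell_htgt H3) -(cell_htgt H2) in q3.
have [_ /= ->] := @ccomp_hpaste i phi psi [::] [:: chi] f k C3 q1.
by have [_ /= ->] := @ccomp_hpaste i psi chi [:: phi] [::] f k C3 q3.
Qed.

Lemma lwhisk_comp h phi Js f g : is_cell phi Js None f g -> vcod f = vdom h -> composable (vidc h) f [:: phi] g.
Proof. by case=> e1 e2 e3 e4 e; split=> //; [rewrite idE /htgts /= e2|rewrite idE]. Qed.
Lemma rwhisk_comp k psi o f g : is_cell psi [::] o f g -> vcod k = vdom f -> composable psi k [:: vidc k] k.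
Proof. by case=> e1 e2 e3 e4 e; split=> //; [split; rewrite /= ?idE|rewrite e1 /htgts /= idE|rewrite e3]. Qed.

Lemma lwhisk_cell h phi Js f g : is_cell phi Js None f g -> vcod f = vdom h ->
  is_cell (h ◁ phi) Js None (h ∘ f) (h ∘ g).
Proof.
by move=> H e; have [e1 e2 e3 e4] := ccomp_cell (lwhisk_comp H e); split; rewrite /lwhisk ?e1 ?e2 ?e3 ?e4 ?idE // /hsrcs /= cats0 (cell_hsrc H).
Qed.
Lemma rwhisk_cell k psi o f g : is_cell psi [::] o f g -> vcod k = vdom f ->
  is_cell (psi ▷ k) [::] o (f ∘ k) (g ∘ k).
Proof.
move=> H e; have [e1 e2 e3 e4] := ccomp_cell (rwhisk_comp H e); split; rewrite /rwhisk ?e1 ?e2 ?e3 ?e4 /hsrcs /= ?idE //.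
all: by rewrite ?(cell_htgt H) ?(cell_vsrc H) ?(cell_vtgt H).
Qed.

Lemma hpaste1 phi : phi ⊙ vidc (vtgt phi) = phi.
Proof.
have oo : o1 (htgt phi) (htgt (vidc (vtgt phi) : cell K)) by right; rewrite idE.
have C := hpaste_comp (esym (vsrc_vidc (vtgt phi))) oo.
rewrite /hpaste; case: (@ccomp_drop K _ [:: phi] [::] _ _ _ C) => // C' ->.
have -> : (if htgt phi is Some L then hidc L else id_tgt (vidc (vtgt phi))) = id_tgt phi.
  rewrite /id_tgt htgt_vidc vsrc_vidc; case E: (htgt phi) => [//|].
  by rewrite (vtgt_cod_nil E).
exact: ccomp_id_tgt.
Qed.
Lemma hpasteE1 phi g : vtgt phi = g -> phi ⊙ vidc g = phi.
Proof. by move=> <-; apply: hpaste1. Qed.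
Lemma hpaste1E phi g : vsrc phi = g -> vidc g ⊙ phi = phi.
Proof.
move=> <-.
have oo : o1 (htgt (vidc (vsrc phi) : cell K)) (htgt phi) by left; rewrite idE.
have C := hpaste_comp (vtgt_vidc (vsrc phi)) oo.
rewrite /hpaste; case: (@ccomp_drop K _ [::] [:: phi] _ _ _ C) => // C' ->.
rewrite htgt_vidc; exact: ccomp_id_tgt.
Qed.

Lemma lwhisk_hpaste h phi psi Js Hs f g k : is_cell phi Js None f g -> is_cell psi Hs None g k ->
  vcod f = vdom h -> h ◁ (phi ⊙ psi) = (h ◁ phi) ⊙ (h ◁ psi).
Proof.
move=> H1 H2 e.
have e' : vcod g = vdom h by rewrite -(cell_vtgt H1) (vtgt_cod_nil (cell_htgt H1)) (cell_vsrc H1).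
rewrite [RHS](ccomp_pair (lwhisk_comp H1 e) (lwhisk_comp H2 e')); last 2 first.
- by rewrite !idE.
- by left; rewrite idE.
rewrite hpasteE1 ?idE //=.
have C: composable (vidc h) f [:: phi; psi] k.
  split=> //; rewrite ?idE //=; first by rewrite /chain /= (cell_vsrc H1) (cell_vtgt H1) (cell_vsrc H2) (cell_vtgt H2).
  by rewrite /htgts /= (cell_htgt H1) (cell_htgt H2).
by have [|_ E] := @ccomp_hpaste (vidc h) phi psi [::] [::] f k C; [left; apply: cell_htgt H1|apply: E].
Qed.

Lemma rwhisk_hpaste phi psi o o' f g h k : is_cell phi [::] o f g -> is_cell psi [::] o' g h ->
  o1 o o' -> vcod k = vdom f -> (phi ⊙ psi) ▷ k = (phi ▷ k) ⊙ (psi ▷ k).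
Proof.
move=> H1 H2 oo e.
have e' : vcod k = vdom g by rewrite -(cell_vtgt H1) (vtgt_dom_nil (cell_hsrc H1)) (cell_vsrc H1).
rewrite [RHS](ccomp_pair (rwhisk_comp H1 e) (rwhisk_comp H2 e')); last 2 first.
- by rewrite (cell_vtgt H1) (cell_vsrc H2).
- by rewrite (cell_htgt H1) (cell_htgt H2).
have H := hpaste_cell H1 H2 oo.
have [] := @ccomp_insert K (phi ⊙ psi) [::] [:: vidc k] k k k (rwhisk_comp H e); first by [].
by move=> /= _ ->.
Qed.

Lemma ccomp_ccomp1 chi psi s f g f' g' : composable chi f' [:: psi] g' -> composable psi f s g ->
  ccomp chi [:: ccomp psi s] = ccomp (ccomp chi [:: psi]) s.
Proof.
move=> C1 C2; have := @ccompA K chi [:: (psi, s)] _ _ f g C1.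
rewrite /= cats0; apply; first exact: comp_chain C2.
by constructor=> //; exists f, g.
Qed.

Lemma lwhisk_comp2 h k phi Js f g : is_cell phi Js None f g -> vcod f = vdom h -> vcod h = vdom k ->
  k ◁ (h ◁ phi) = (k ∘ h) ◁ phi.
Proof.
move=> H e e'; rewrite /lwhisk (ccomp_ccomp1 (lwhisk_comp (vidc_cell h) e') (lwhisk_comp H e)).
by rewrite ccomp_vidc.
Qed.
Lemma lwhisk_ccomp h psi s f g : htgt psi = None -> composable psi f s g -> vcod (vsrc psi) = vdom h ->
  h ◁ ccomp psi s = ccomp (h ◁ psi) s.
Proof.
move=> E C e; rewrite /lwhisk -(ccomp_ccomp1 (f' := vsrc psi) (g' := vtgt psi) _ C) //.
by apply: lwhisk_comp e; split.
Qed.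
Lemma rwhisk_comp2 h k psi o f g : is_cell psi [::] o f g -> vcod h = vdom f -> vcod k = vdom h ->
  (psi ▷ h) ▷ k = psi ▷ (h ∘ k).
Proof.
move=> H e e'; rewrite /rwhisk -(ccomp_ccomp1 (rwhisk_comp H e) (rwhisk_comp (vidc_cell h) e')).
by rewrite ccomp_vidc.
Qed.
Lemma lrwhisk h k psi f g : is_vcell psi f g -> vcod k = vdom f -> vcod f = vdom h ->
  h ◁ (psi ▷ k) = (h ◁ psi) ▷ k.
Proof.
move=> H e e'; rewrite {2}/rwhisk /lwhisk (ccomp_ccomp1 (f := k) (g := k) (lwhisk_comp H e')) //.
exact: rwhisk_comp H e.
Qed.
Lemma rwhisk_vid psi o f g k : is_cell psi [::] o f g -> k = vid (vdom f) -> psi ▷ k = psi.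
Proof. by move=> H ->; rewrite -(cell_vsrc H) /rwhisk ccompv1 //; apply: cell_hsrc H. Qed.
Lemma lwhisk_vid phi Js f g h : is_cell phi Js None f g -> h = vid (vcod f) -> h ◁ phi = phi.
Proof. by move=> H ->; rewrite -(cell_vsrc H) /lwhisk ccomp1v //; apply: cell_htgt H. Qed.
Lemma rwhisk_vidc h f : vcod f = vdom h -> vidc h ▷ f = vidc (h ∘ f).
Proof. exact: ccomp_vidc. Qed.
Lemma lwhisk_vidc h f : vcod f = vdom h -> h ◁ vidc f = vidc (h ∘ f).
Proof. exact: ccomp_vidc. Qed.

Lemma cell_interchange phi psi Js f g h k : is_cell phi Js None f g -> is_vcell psi h k -> vcod f = vdom h ->
  (psi ▷ f) ⊙ (k ◁ phi) = (h ◁ phi) ⊙ (psi ▷ g).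
Proof.
move=> H1 H2 e.
have eg : vcod g = vcod f by rewrite -(cell_vtgt H1) (vtgt_cod_nil (cell_htgt H1)) (cell_vsrc H1).
have ek : vdom k = vdom h by rewrite -(cell_vtgt H2) (vtgt_dom_nil (cell_hsrc H2)) (cell_vsrc H2).
have Cp : composable psi f [:: phi] g.
  split=> //; first by split; rewrite ?(cell_vsrc H1) ?(cell_vtgt H1).
    by rewrite (cell_hsrc H2) /htgts /= (cell_htgt H1).
  by rewrite (cell_vsrc H2).
transitivity (ccomp psi [:: phi]).
  rewrite (ccomp_pair (rwhisk_comp H2 e) (g := f) (h := g)); first last.
  - by left; apply: cell_htgt H2.
  - by rewrite idE (cell_vtgt H2).
  - by apply: lwhisk_comp H1 _; rewrite ek.
  rewrite hpasteE1 ?(cell_vtgt H2) //.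
  by have [|_] := @ccomp_insert K psi [::] [:: phi] f g f Cp.
symmetry; rewrite (ccomp_pair (f := f) (g := g) (h := g)); first last.
- by right; apply: cell_htgt H2.
- by rewrite idE (cell_vsrc H2).
- by apply: rwhisk_comp H2 _; rewrite eg.
- exact: lwhisk_comp H1 e.
rewrite hpaste1E ?(cell_vsrc H2) //.
by have [|_] := @ccomp_insert K psi [:: phi] [::] f g g Cp; first by split; [apply: cell_vsrc H1|apply: cell_vtgt H1].
Qed.
End OpsLemmas.

Record functor (K L : avdc) := Functor {
  Fo : ob K -> ob L; Fv : vmor K -> vmor L; Fh : hmor K -> hmor L; Fc : cell K -> cell L;
  F_vdom : forall f, vdom (Fv f) = Fo (vdom f);
  F_vcod : forall f, vcod (Fv f) = Fo (vcod f);
  F_hdom : forall J, hdom (Fh J) = Fo (hdom J);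
  F_hcod : forall J, hcod (Fh J) = Fo (hcod J);
  F_cell : forall phi, is_cell (Fc phi) (map Fh (hsrc phi)) (omap Fh (htgt phi)) (Fv (vsrc phi)) (Fv (vtgt phi));
  F_vid : forall A, Fv (vid A) = vid (Fo A);
  F_vcomp : forall g f, vcod f = vdom g -> Fv (g ∘ f) = Fv g ∘ Fv f;
  F_hidc : forall J, Fc (hidc J) = hidc (Fh J);
  F_vidc : forall f, Fc (vidc f) = vidc (Fv f);
  F_ccomp : forall psi f phis g, composable psi f phis g ->
    Fc (ccomp psi phis) = ccomp (Fc psi) (map Fc phis) }.

Section FunctorLemmas.
Variables (K L : avdc) (F : functor K L).
Lemma F_hsrc phi : hsrc (Fc F phi) = map (Fh F) (hsrc phi). Proof. exact: cell_hsrc (F_cell F phi). Qed.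
Lemma F_htgt phi : htgt (Fc F phi) = omap (Fh F) (htgt phi). Proof. exact: cell_htgt (F_cell F phi). Qed.
Lemma F_vsrc phi : vsrc (Fc F phi) = Fv F (vsrc phi). Proof. exact: cell_vsrc (F_cell F phi). Qed.
Lemma F_vtgt phi : vtgt (Fc F phi) = Fv F (vtgt phi). Proof. exact: cell_vtgt (F_cell F phi). Qed.
Lemma F_chain f s g : chain f s g -> chain (Fv F f) (map (Fc F) s) (Fv F g).
Proof. by elim: s f => [|phi s IH] f /=; [move=> ->|case=> <- /IH H; split; rewrite ?F_vsrc ?F_vtgt]. Qed.
Lemma F_htgts s : htgts (map (Fc F) s) = map (Fh F) (htgts s).
Proof. by elim: s => //= phi s; rewrite /htgts /= F_htgt => ->; case: (htgt phi). Qed.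
Lemma F_hsrcs s : hsrcs (map (Fc F) s) = map (Fh F) (hsrcs s).
Proof. by elim: s => //= phi s; rewrite /hsrcs /= F_hsrc map_cat => ->. Qed.
Lemma F_composable psi f s g : composable psi f s g -> composable (Fc F psi) (Fv F f) (map (Fc F) s) (Fv F g).
Proof.
case=> n c e v; split; [by case: (s) n|exact: F_chain|by rewrite F_hsrc e F_htgts|].
by rewrite F_vcod v F_vsrc F_vdom.
Qed.
Lemma F_is_cell phi Js o f g : is_cell phi Js o f g -> is_cell (Fc F phi) (map (Fh F) Js) (omap (Fh F) o) (Fv F f) (Fv F g).
Proof. by case=> <- <- <- <-; apply: F_cell. Qed.
Lemma F_lwhisk h phi Js f g : is_cell phi Js None f g -> vcod f = vdom h -> Fc F (h ◁ phi) = Fv F h ◁ Fc F phi.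
Proof. by move=> H e; rewrite /lwhisk (F_ccomp F (lwhisk_comp H e)) F_vidc. Qed.
Lemma F_rwhisk k psi o f g : is_cell psi [::] o f g -> vcod k = vdom f -> Fc F (psi ▷ k) = Fc F psi ▷ Fv F k.
Proof. by move=> H e; rewrite /rwhisk (F_ccomp F (rwhisk_comp H e)) /= F_vidc. Qed.
Lemma F_hpaste phi psi : vtgt phi = vsrc psi -> o1 (htgt phi) (htgt psi) -> Fc F (phi ⊙ psi) = Fc F phi ⊙ Fc F psi.
Proof.
move=> e o; rewrite /hpaste (F_ccomp F (hpaste_comp e o)) /= /id_tgt !F_htgt F_vsrc F_vcod.
by case: (htgt phi) => [?|]; case: (htgt psi) => [?|] /=; rewrite ?F_hidc ?F_vidc ?F_vid.
Qed.
End FunctorLemmas.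

Section FunctorConstructions.
Definition fid_subproof (K : avdc) (phi : cell K) :
  is_cell phi (map id (hsrc phi)) (omap id (htgt phi)) (vsrc phi) (vtgt phi).
Proof. by split; rewrite ?map_id //; case: (htgt phi). Qed.
Lemma fid_ccomp (K : avdc) (psi : cell K) f phis g : composable psi f phis g ->
  ccomp psi phis = ccomp psi (map id phis).
Proof. by rewrite map_id. Qed.

Definition fid (K : avdc) : functor K K :=
  @Functor K K id id id id (fun _ => erefl) (fun _ => erefl) (fun _ => erefl) (fun _ => erefl)
    (@fid_subproof K) (fun _ => erefl) (fun _ _ _ => erefl) (fun _ => erefl) (fun _ => erefl)
    (@fid_ccomp K).

Variables (K L M : avdc) (G : functor L M) (F : functor K L).
Definition fcomp : functor K M.
Proof.
apply: (@Functor K M (fun A => Fo G (Fo F A)) (fun f => Fv G (Fv F f))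
  (fun J => Fh G (Fh F J)) (fun phi => Fc G (Fc F phi))).
- by move=> f; rewrite !F_vdom.
- by move=> f; rewrite !F_vcod.
- by move=> J; rewrite !F_hdom.
- by move=> J; rewrite !F_hcod.
- move=> phi; split; rewrite ?F_hsrc ?F_htgt ?F_vsrc ?F_vtgt //; first by rewrite -map_comp.
  by case: (htgt phi).
- by move=> A; rewrite !F_vid.
- by move=> g f e; rewrite !F_vcomp // F_vcod F_vdom e.
- by move=> J; rewrite !F_hidc.
- by move=> f; rewrite !F_vidc.
- move=> psi f s g C; rewrite (F_ccomp F C) (F_ccomp G (F_composable F C)).
  by rewrite -map_comp.
Defined.
End FunctorConstructions.

Section Transformations.
Variables (K L : avdc) (F G : functor K L).

Definition trans_path (xv : ob K -> vmor L) (xh : hmor K -> cell L) (A : ob K) (Js : seq (hmor K)) : seq (cell L) :=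
  if Js is [::] then [:: vidc (xv A)] else map xh Js.
Definition trans_tgt (xv : ob K -> vmor L) (xh : hmor K -> cell L) (C : ob K) (o : option (hmor K)) : cell L :=
  if o is Some J then xh J else vidc (xv C).

(* trans_path is the list of cells written xi_J in the naturality axiom, which is
   the vertical identity of xi_A for the empty path at A. *)
Record transformation := Transformation {
  xv : ob K -> vmor L;
  xh : hmor K -> cell L;
  xv_dom : forall A, vdom (xv A) = Fo F A;
  xv_cod : forall A, vcod (xv A) = Fo G A;
  xv_nat : forall f, Fv G f ∘ xv (vdom f) = xv (vcod f) ∘ Fv F f;
  xh_cell : forall J, is_cell (xh J) [:: Fh F J] (Some (Fh G J)) (xv (hdom J)) (xv (hcod J));
  xh_nat : forall phi,
    ccomp (Fc G phi) (trans_path xv xh (vdom (vsrc phi)) (hsrc phi))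
    = ccomp (trans_tgt xv xh (vcod (vsrc phi)) (htgt phi)) [:: Fc F phi] }.
End Transformations.

Record monad (K : avdc) := Monad {
  mfun :> functor K K;
  mmu : transformation (fcomp mfun mfun) mfun;
  miota : transformation (fid K) mfun;
  mmuA_v : forall A, xv mmu A ∘ Fv mfun (xv mmu A) = xv mmu A ∘ xv mmu (Fo mfun A);
  mmuA_h : forall J, ccomp (xh mmu J) [:: Fc mfun (xh mmu J)] = ccomp (xh mmu J) [:: xh mmu (Fh mfun J)];
  mmu1_v : forall A, xv mmu A ∘ Fv mfun (xv miota A) = vid (Fo mfun A);
  mmu1_h : forall J, ccomp (xh mmu J) [:: Fc mfun (xh miota J)] = hidc (Fh mfun J);
  m1mu_v : forall A, xv mmu A ∘ xv miota (Fo mfun A) = vid (Fo mfun A);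
  m1mu_h : forall J, ccomp (xh mmu J) [:: xh miota (Fh mfun J)] = hidc (Fh mfun J) }.

Notation "T $o A" := (Fo (mfun T) A) (at level 8, A at level 2, right associativity).
Notation "T $v f" := (Fv (mfun T) f) (at level 8, f at level 2, right associativity).
Notation "T $h J" := (Fh (mfun T) J) (at level 8, J at level 2, right associativity).
Notation "T $c phi" := (Fc (mfun T) phi) (at level 8, phi at level 2, right associativity).

Section Algebras.
Variables (K : avdc) (T : monad K).
Local Notation mu := (xv (mmu T)).
Local Notation iota := (xv (miota T)).
Local Notation mu_h := (xh (mmu T)).
Local Notation iota_h := (xh (miota T)).

Record colax_algebra := ColaxAlgebra {
  al_ob : ob K;
  al_str : vmor K;
  al_assoc : cell K;
  al_unit : cell K;
  al_str_dom : vdom al_str = T $o al_ob;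
  al_str_cod : vcod al_str = al_ob;
  al_assoc_cell : is_vcell al_assoc (al_str ∘ mu al_ob) (al_str ∘ T $v al_str);
  al_unit_cell : is_vcell al_unit (al_str ∘ iota al_ob) (vid al_ob);
  al_assocE : (al_assoc ▷ T $v (mu al_ob)) ⊙ (al_str ◁ T $c al_assoc)
    = (al_assoc ▷ mu (T $o al_ob)) ⊙ (al_assoc ▷ T $v (T $v al_str));
  al_unitlE : (al_assoc ▷ iota (T $o al_ob)) ⊙ (al_unit ▷ al_str) = vidc al_str;
  al_unitrE : (al_assoc ▷ T $v (iota al_ob)) ⊙ (al_str ◁ T $c al_unit) = vidc al_str }.

Record lax_morphism (A C : colax_algebra) (f : vmor K) (fb : cell K) : Prop := LaxMorphism {
  lax_cell : is_vcell fb (al_str C ∘ T $v f) (f ∘ al_str A);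
  lax_assocE : (al_assoc C ▷ T $v (T $v f)) ⊙ (al_str C ◁ T $c fb) ⊙ (fb ▷ T $v (al_str A))
    = (fb ▷ mu (al_ob A)) ⊙ (f ◁ al_assoc A);
  lax_unitE : (fb ▷ iota (al_ob A)) ⊙ (f ◁ al_unit A) = al_unit C ▷ f }.

Record colax_morphism (A C : colax_algebra) (f : vmor K) (fb : cell K) : Prop := ColaxMorphism {
  colax_cell : is_vcell fb (f ∘ al_str A) (al_str C ∘ T $v f);
  colax_assocE : (f ◁ al_assoc A) ⊙ (fb ▷ T $v (al_str A)) ⊙ (al_str C ◁ T $c fb)
    = (fb ▷ mu (al_ob A)) ⊙ (al_assoc C ▷ T $v (T $v f));
  colax_unitE : (fb ▷ iota (al_ob A)) ⊙ (al_unit C ▷ f) = f ◁ al_unit A }.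

Definition vinvertible (phi : cell K) : Prop :=
  exists psi, [/\ is_vcell psi (vtgt phi) (vsrc phi),
    phi ⊙ psi = vidc (vsrc phi) & psi ⊙ phi = vidc (vtgt phi)].
End Algebras.

(* Pseudo morphisms are taken to be lax morphisms with invertible structure cell;
   the two equations for T-cells are then equivalent, and the lax one is used. *)
Inductive weakness := Colax | Lax | Pseudo.

Section TAlgData.
Variables (K : avdc) (T : monad K).
Local Notation mu := (xv (mmu T)).
Local Notation iota := (xv (miota T)).
Local Notation mu_h := (xh (mmu T)).
Local Notation iota_h := (xh (miota T)).

Definition w_morphism (w : weakness) (A C : colax_algebra T) (f : vmor K) (fb : cell K) : Prop :=
  match w with
  | Colax => colax_morphism A C f fb
  | Lax => lax_morphism A C f fb
  | Pseudo => lax_morphism A C f fb /\ vinvertible fb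
  end.

Record vTmor (w : weakness) := VTmor {
  vt_dom : colax_algebra T; vt_cod : colax_algebra T;
  vt_map : vmor K; vt_cell : cell K;
  vt_map_dom : vdom vt_map = al_ob vt_dom;
  vt_map_cod : vcod vt_map = al_ob vt_cod;
  vt_ok : w_morphism w vt_dom vt_cod vt_map vt_cell }.

Record hTmor := HTmor {
  ht_dom : colax_algebra T; ht_cod : colax_algebra T;
  ht_map : hmor K; ht_cell : cell K;
  ht_map_dom : hdom ht_map = al_ob ht_dom;
  ht_map_cod : hcod ht_map = al_ob ht_cod;
  ht_str_cell : is_cell ht_cell [:: T $h ht_map] (Some ht_map) (al_str ht_dom) (al_str ht_cod);
  ht_assocE : ccomp ht_cell [:: mu_h ht_map] ⊙ al_assoc ht_cod
    = al_assoc ht_dom ⊙ ccomp ht_cell [:: T $c ht_cell];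
  ht_unitE : ccomp ht_cell [:: iota_h ht_map] ⊙ al_unit ht_cod = al_unit ht_dom ⊙ hidc ht_map }.

Definition str_path (A : colax_algebra T) (Js : seq hTmor) : seq (cell K) :=
  if Js is [::] then [:: vidc (al_str A)] else map ht_cell Js.
Definition str_tgt (C : colax_algebra T) (o : option hTmor) : cell K :=
  if o is Some J then ht_cell J else vidc (al_str C).

Section TCellEquation.
Variables (w : weakness) (Js : seq hTmor) (o : option hTmor) (f g : vTmor w) (phi : cell K).
Definition lax_Tcell_eq : Prop :=
  ccomp (str_tgt (vt_cod f) o) [:: T $c phi] ⊙ vt_cell g
  = vt_cell f ⊙ ccomp phi (str_path (vt_dom f) Js).
Definition colax_Tcell_eq : Prop :=
  vt_cell f ⊙ ccomp (str_tgt (vt_cod f) o) [:: T $c phi]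
  = ccomp phi (str_path (vt_dom f) Js) ⊙ vt_cell g.
Definition Tcell_eq : Prop := if w is Colax then colax_Tcell_eq else lax_Tcell_eq.
End TCellEquation.

(* A T-cell carries its boundary in T-algebras: tc_cell alone does not determine
   the structures on its sources and targets. *)
Record Tcell (w : weakness) := TCell {
  tc_hsrc : seq hTmor; tc_htgt : option hTmor;
  tc_vsrc : vTmor w; tc_vtgt : vTmor w;
  tc_cell : cell K;
  tc_src_path : linked ht_dom ht_cod (vt_dom tc_vsrc) tc_hsrc (vt_dom tc_vtgt);
  tc_tgt_path : linked ht_dom ht_cod (vt_cod tc_vsrc) (oseq tc_htgt) (vt_cod tc_vtgt);
  tc_is_cell : is_cell tc_cell (map ht_map tc_hsrc) (omap ht_map tc_htgt) (vt_map tc_vsrc) (vt_map tc_vtgt);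
  tc_eq : Tcell_eq tc_hsrc tc_htgt tc_vsrc tc_vtgt tc_cell }.

Definition TAlg_graph (w : weakness) : avdc_graph := {|
  ob := colax_algebra T; vmor := vTmor w; hmor := hTmor; cell := Tcell w;
  vdom := @vt_dom w; vcod := @vt_cod w; hdom := ht_dom; hcod := ht_cod;
  hsrc := @tc_hsrc w; htgt := @tc_htgt w; vsrc := @tc_vsrc w; vtgt := @tc_vtgt w |}.
End TAlgData.

Ltac bnd_ctx := match goal with
  | H : vdom ?f = _ |- context [vdom ?f] => rewrite H
  | H : vcod ?f = _ |- context [vcod ?f] => rewrite H
  | H : hdom ?f = _ |- context [hdom ?f] => rewrite H
  | H : hcod ?f = _ |- context [hcod ?f] => rewrite H
  end.
Ltac bnd := repeat first
  [ progress rewrite ?F_vdom ?F_vcod ?F_hdom ?F_hcod ?al_str_dom ?al_str_cod ?xv_dom ?xv_cod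
      ?vdom_id ?vcod_id ?vt_map_dom ?vt_map_cod ?ht_map_dom ?ht_map_cod /=
  | bnd_ctx
  | rewrite vdom_comp; [|solve [bnd]]
  | rewrite vcod_comp; [|solve [bnd]] ]; try done.
Ltac vnorm := repeat first
  [ rewrite F_vcomp; [|solve [bnd]]
  | rewrite vcompA; [|solve [bnd]|solve [bnd]] ]; try done.

Section VCells.
Variable K : avdc.
Lemma is_cell_conv (phi : cell K) Js o f g f' g' : is_cell phi Js o f g -> f = f' -> g = g' -> is_cell phi Js o f' g'.
Proof. by move=> H <- <-. Qed.
Lemma vcell_hpaste (phi psi : cell K) f g h : is_vcell phi f g -> is_vcell psi g h -> is_vcell (phi ⊙ psi) f h.
Proof. by move=> H1 H2; apply: (hpaste_cell H1 H2); left. Qed.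
Lemma vpasteA (phi psi chi : cell K) f g h k : is_vcell phi f g -> is_vcell psi g h -> is_vcell chi h k ->
  phi ⊙ psi ⊙ chi = phi ⊙ (psi ⊙ chi).
Proof. by move=> H1 H2 H3; apply: (hpasteA H1 H2 H3); left. Qed.
Lemma vcomp1E (f : vmor K) A : vcod f = A -> vid A ∘ f = f.
Proof. by move=> <-; apply: vcomp1f. Qed.
Lemma vcompE1 (f : vmor K) A : vdom f = A -> f ∘ vid A = f.
Proof. by move=> <-; apply: vcompf1. Qed.
End VCells.

Section TMorphisms.
Variables (K : avdc) (T : monad K).
Local Notation mu := (xv (mmu T)).
Local Notation iota := (xv (miota T)).

Lemma mu_nat (f : vmor K) A C : vdom f = A -> vcod f = C -> T $v f ∘ mu A = mu C ∘ T $v (T $v f).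
Proof. by move=> <- <-; rewrite -(xv_nat (mmu T)). Qed.
Lemma iota_nat (f : vmor K) A C : vdom f = A -> vcod f = C -> T $v f ∘ iota A = iota C ∘ f.
Proof. by move=> <- <-; rewrite -(xv_nat (miota T)). Qed.

Lemma al_assoc_cell2 (A : colax_algebra T) f : vcod f = T $o (T $o (al_ob A)) ->
  is_vcell (al_assoc A ▷ f) (al_str A ∘ mu (al_ob A) ∘ f) (al_str A ∘ T $v (al_str A) ∘ f).
Proof. by move=> e; apply: rwhisk_cell (al_assoc_cell A) _; bnd. Qed.

Section Id.
Variable A : colax_algebra T.
Lemma lax_id : lax_morphism A A (vid (al_ob A)) (vidc (al_str A)).
Proof.
split.
- by apply: is_cell_conv (vidc_cell _) _ _; rewrite ?F_vid ?vcompE1 ?vcomp1E //; bnd.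
- rewrite !F_vid F_vidc lwhisk_vidc ?rwhisk_vidc; try by bnd.
  rewrite (rwhisk_vid (al_assoc_cell A)); last by bnd.
  rewrite (lwhisk_vid (al_assoc_cell A)); last by bnd.
  by rewrite !hpasteE1 ?hpaste1E ?(cell_vtgt (al_assoc_cell A)) ?(cell_vsrc (al_assoc_cell A)).
- rewrite (rwhisk_vid (al_unit_cell A)); last by bnd.
  rewrite (lwhisk_vid (al_unit_cell A)); last by bnd.
  by rewrite rwhisk_vidc ?hpaste1E ?(cell_vsrc (al_unit_cell A)) //; bnd.
Qed.
Lemma colax_id : colax_morphism A A (vid (al_ob A)) (vidc (al_str A)).
Proof.
split.
- by apply: is_cell_conv (vidc_cell _) _ _; rewrite ?F_vid ?vcompE1 ?vcomp1E //; bnd.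
- rewrite !F_vid F_vidc lwhisk_vidc ?rwhisk_vidc; try by bnd.
  rewrite (rwhisk_vid (al_assoc_cell A)); last by bnd.
  rewrite (lwhisk_vid (al_assoc_cell A)); last by bnd.
  by rewrite !hpasteE1 ?hpaste1E ?(cell_vtgt (al_assoc_cell A)) ?(cell_vsrc (al_assoc_cell A)).
- rewrite (rwhisk_vid (al_unit_cell A)); last by bnd.
  rewrite (lwhisk_vid (al_unit_cell A)); last by bnd.
  by rewrite rwhisk_vidc ?hpaste1E ?(cell_vsrc (al_unit_cell A)) //; bnd.
Qed.
Lemma vinvertible_vidc (f : vmor K) : vinvertible (vidc f).
Proof. by exists (vidc f); split; rewrite ?hpasteE1 ?idE //; apply: vidc_cell. Qed.
End Id.

Section Comp.
Variables (A C E : colax_algebra T) (f g : vmor K) (fb gb : cell K).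
Hypotheses (fd : vdom f = al_ob A) (fc : vcod f = al_ob C) (gd : vdom g = al_ob C) (gc : vcod g = al_ob E).
Local Notation a := (al_str A). Local Notation c := (al_str C). Local Notation e := (al_str E).

Lemma lax_comp : lax_morphism A C f fb -> lax_morphism C E g gb ->
  lax_morphism A E (g ∘ f) ((gb ▷ T $v f) ⊙ (g ◁ fb)).
Proof.
move=> Lf Lg.
have Hf := lax_cell Lf; have Hg := lax_cell Lg.
have HTf : is_vcell (T $c fb) (T $v c ∘ T $v (T $v f)) (T $v f ∘ T $v a).
  by apply: is_cell_conv (F_is_cell T Hf) _ _ => /=; vnorm.
have HTg : is_vcell (T $c gb) (T $v e ∘ T $v (T $v g)) (T $v g ∘ T $v c).
  by apply: is_cell_conv (F_is_cell T Hg) _ _ => /=; vnorm.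
have H1 : is_vcell (gb ▷ T $v f) (e ∘ T $v g ∘ T $v f) (g ∘ c ∘ T $v f).
  by apply: rwhisk_cell Hg _; bnd.
have H2 : is_vcell (g ◁ fb) (g ∘ c ∘ T $v f) (g ∘ f ∘ a).
  by apply: is_cell_conv (lwhisk_cell Hf _) _ _; bnd; vnorm.
have H12 := vcell_hpaste H1 H2.
split.
- by apply: is_cell_conv H12 _ _; vnorm.
- set v0 := e ∘ mu (al_ob E) ∘ T $v (T $v g) ∘ T $v (T $v f).
  set v1 := e ∘ T $v e ∘ T $v (T $v g) ∘ T $v (T $v f).
  set v2 := e ∘ T $v g ∘ T $v c ∘ T $v (T $v f).
  set v3 := e ∘ T $v g ∘ T $v f ∘ T $v a.
  set v4 := g ∘ c ∘ T $v f ∘ T $v a.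
  set v5 := g ∘ f ∘ a ∘ T $v a.
  set v6 := g ∘ c ∘ T $v c ∘ T $v (T $v f).
  set v7 := g ∘ c ∘ mu (al_ob C) ∘ T $v (T $v f).
  set v8 := g ∘ f ∘ a ∘ mu (al_ob A).
  have EP : al_assoc E ▷ T $v (T $v (g ∘ f)) = al_assoc E ▷ T $v (T $v g) ▷ T $v (T $v f).
    by rewrite (rwhisk_comp2 (al_assoc_cell E)); bnd; vnorm.
  have EQ : e ◁ T $c ((gb ▷ T $v f) ⊙ (g ◁ fb))
     = (e ◁ T $c gb) ▷ T $v (T $v f) ⊙ ((e ∘ T $v g) ◁ T $c fb).
    rewrite F_hpaste; [|by rewrite (cell_vtgt H1) (cell_vsrc H2)|by left; apply: cell_htgt H1].
    rewrite (F_rwhisk T Hg); last by bnd.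
    rewrite (F_lwhisk T Hf); last by bnd.
    rewrite (lwhisk_hpaste (rwhisk_cell HTg _) (is_cell_conv (lwhisk_cell HTf _) _ erefl)); bnd; vnorm.
    by rewrite (lrwhisk HTg) ?(lwhisk_comp2 HTf); bnd.
  have ER : ((gb ▷ T $v f) ⊙ (g ◁ fb)) ▷ T $v a = gb ▷ (T $v f ∘ T $v a) ⊙ (g ◁ (fb ▷ T $v a)).
    rewrite (rwhisk_hpaste H1 H2); [|by left|by bnd].
    by rewrite (rwhisk_comp2 Hg) ?(lrwhisk Hf); bnd.
  have HP : is_vcell (al_assoc E ▷ T $v (T $v g) ▷ T $v (T $v f)) v0 v1.
    by apply: rwhisk_cell; [apply: al_assoc_cell2|]; bnd.
  have HQ1 : is_vcell ((e ◁ T $c gb) ▷ T $v (T $v f)) v1 v2.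
    by apply: rwhisk_cell; [apply: is_cell_conv (lwhisk_cell HTg _) _ _|]; bnd; vnorm.
  have HQ2 : is_vcell ((e ∘ T $v g) ◁ T $c fb) v2 v3.
    by apply: is_cell_conv (lwhisk_cell HTf _) _ _; bnd; vnorm.
  have HR1 : is_vcell (gb ▷ (T $v f ∘ T $v a)) v3 v4.
    by apply: is_cell_conv (rwhisk_cell Hg _) _ _; bnd; vnorm.
  have HR2 : is_vcell (g ◁ (fb ▷ T $v a)) v4 v5.
    by apply: is_cell_conv (lwhisk_cell (rwhisk_cell Hf _) _) _ _; bnd; vnorm.
  have HS1 : is_vcell (gb ▷ T $v c ▷ T $v (T $v f)) v2 v6.
    by apply: is_cell_conv (rwhisk_cell (rwhisk_cell Hg _) _) _ _; bnd; vnorm.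
  have HS2 : is_vcell (g ◁ (c ◁ T $c fb)) v6 v4.
    by apply: is_cell_conv (lwhisk_cell (lwhisk_cell HTf _) _) _ _; bnd; vnorm.
  have HU1 : is_vcell (gb ▷ mu (al_ob C) ▷ T $v (T $v f)) v0 v7.
    rewrite /v0 /v7 -(vcompA (f := T $v (T $v g)) (g := mu (al_ob E))); [|by bnd..].
    rewrite -(mu_nat gd gc); vnorm.
    by apply: rwhisk_cell; [apply: rwhisk_cell Hg _|]; bnd.
  have HU2 : is_vcell (g ◁ (al_assoc C ▷ T $v (T $v f))) v7 v6.
    by apply: is_cell_conv (lwhisk_cell (al_assoc_cell2 _) _) _ _; bnd; vnorm.
  have HW1 : is_vcell ((g ◁ fb) ▷ mu (al_ob A)) v7 v8.
    rewrite /v7 -(vcompA (f := T $v (T $v f)) (g := mu (al_ob C))); [|by bnd..].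
    rewrite -(mu_nat fd fc); vnorm.
    by apply: rwhisk_cell; bnd.
  have HW2 : is_vcell ((g ∘ f) ◁ al_assoc A) v8 v5.
    by apply: is_cell_conv (lwhisk_cell (al_assoc_cell A) _) _ _; bnd; vnorm.
  have X : ((e ∘ T $v g) ◁ T $c fb) ⊙ (gb ▷ (T $v f ∘ T $v a))
      = (gb ▷ T $v c ▷ T $v (T $v f)) ⊙ (g ◁ (c ◁ T $c fb)).
    rewrite -(cell_interchange HTf Hg); last by bnd.
    by rewrite (rwhisk_comp2 Hg) ?(lwhisk_comp2 HTf); bnd.
  have Y1 : (al_assoc E ▷ T $v (T $v g) ▷ T $v (T $v f)) ⊙ ((e ◁ T $c gb) ▷ T $v (T $v f)) ⊙ (gb ▷ T $v c ▷ T $v (T $v f))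
      = (gb ▷ mu (al_ob C) ▷ T $v (T $v f)) ⊙ (g ◁ (al_assoc C ▷ T $v (T $v f))).
    have G1 : is_vcell (al_assoc E ▷ T $v (T $v g)) (e ∘ mu (al_ob E) ∘ T $v (T $v g)) (e ∘ T $v e ∘ T $v (T $v g)).
      by apply: al_assoc_cell2; bnd.
    have G2 : is_vcell (e ◁ T $c gb) (e ∘ T $v e ∘ T $v (T $v g)) (e ∘ T $v g ∘ T $v c).
      by apply: is_cell_conv (lwhisk_cell HTg _) _ _; bnd; vnorm.
    have G3 : is_vcell (gb ▷ T $v c) (e ∘ T $v g ∘ T $v c) (g ∘ c ∘ T $v c) by apply: rwhisk_cell Hg _; bnd.
    have G4 : is_vcell (gb ▷ mu (al_ob C)) (e ∘ T $v g ∘ mu (al_ob C)) (g ∘ c ∘ mu (al_ob C)) by apply: rwhisk_cell Hg _; bnd.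
    have G5 : is_vcell (g ◁ al_assoc C) (g ∘ c ∘ mu (al_ob C)) (g ∘ c ∘ T $v c).
      by apply: is_cell_conv (lwhisk_cell (al_assoc_cell C) _) _ _; bnd; vnorm.
    rewrite -(rwhisk_hpaste G1 G2); [|by left|by bnd].
    rewrite -(rwhisk_hpaste (vcell_hpaste G1 G2) G3); [|by left|by bnd].
    rewrite (lax_assocE Lg) (rwhisk_hpaste G4 G5); [|by left|by bnd].
    by rewrite (lrwhisk (al_assoc_cell C)); bnd.
  have Y2 : (g ◁ (al_assoc C ▷ T $v (T $v f))) ⊙ (g ◁ (c ◁ T $c fb)) ⊙ (g ◁ (fb ▷ T $v a))
      = ((g ◁ fb) ▷ mu (al_ob A)) ⊙ ((g ∘ f) ◁ al_assoc A).
    have G1 : is_vcell (al_assoc C ▷ T $v (T $v f)) (c ∘ mu (al_ob C) ∘ T $v (T $v f)) (c ∘ T $v c ∘ T $v (T $v f)).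
      by apply: al_assoc_cell2; bnd.
    have G2 : is_vcell (c ◁ T $c fb) (c ∘ T $v c ∘ T $v (T $v f)) (c ∘ T $v f ∘ T $v a).
      by apply: is_cell_conv (lwhisk_cell HTf _) _ _; bnd; vnorm.
    have G3 : is_vcell (fb ▷ T $v a) (c ∘ T $v f ∘ T $v a) (f ∘ a ∘ T $v a) by apply: rwhisk_cell Hf _; bnd.
    have G4 : is_vcell (fb ▷ mu (al_ob A)) (c ∘ T $v f ∘ mu (al_ob A)) (f ∘ a ∘ mu (al_ob A)) by apply: rwhisk_cell Hf _; bnd.
    have G5 : is_vcell (f ◁ al_assoc A) (f ∘ a ∘ mu (al_ob A)) (f ∘ a ∘ T $v a).
      by apply: is_cell_conv (lwhisk_cell (al_assoc_cell A) _) _ _; bnd; vnorm.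
    rewrite -(lwhisk_hpaste G1 G2); last by bnd.
    rewrite -(lwhisk_hpaste (vcell_hpaste G1 G2) G3); last by bnd.
    rewrite (lax_assocE Lf) (lwhisk_hpaste G4 G5); last by bnd.
    by rewrite (lrwhisk Hf) ?(lwhisk_comp2 (al_assoc_cell A)); bnd.
  rewrite EP EQ ER -(vpasteA HP HQ1 HQ2) -(vpasteA (vcell_hpaste (vcell_hpaste HP HQ1) HQ2) HR1 HR2).
  rewrite (vpasteA (vcell_hpaste HP HQ1) HQ2 HR1) X.
  rewrite -(vpasteA (vcell_hpaste HP HQ1) HS1 HS2) Y1.
  rewrite (vpasteA (vcell_hpaste HU1 HU2) HS2 HR2) (vpasteA HU1 HU2 (vcell_hpaste HS2 HR2)).
  rewrite -(vpasteA HU2 HS2 HR2) Y2 -(vpasteA HU1 HW1 HW2); congr (_ ⊙ _).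
  rewrite (rwhisk_hpaste H1 H2); [|by left|by bnd]; congr (_ ⊙ _).
  rewrite !(rwhisk_comp2 Hg) -?(mu_nat fd fc) //; bnd.
- have G1 : is_vcell (gb ▷ iota (al_ob C)) (e ∘ T $v g ∘ iota (al_ob C)) (g ∘ c ∘ iota (al_ob C)).
    by apply: rwhisk_cell Hg _; bnd.
  have G2 : is_vcell (g ◁ al_unit C) (g ∘ c ∘ iota (al_ob C)) g.
    by apply: is_cell_conv (lwhisk_cell (al_unit_cell C) _) _ _; bnd; rewrite ?vcompE1 //; vnorm.
  have G3 : is_vcell (fb ▷ iota (al_ob A)) (c ∘ T $v f ∘ iota (al_ob A)) (f ∘ a ∘ iota (al_ob A)).
    by apply: rwhisk_cell Hf _; bnd.
  have G4 : is_vcell (f ◁ al_unit A) (f ∘ a ∘ iota (al_ob A)) f.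
    by apply: is_cell_conv (lwhisk_cell (al_unit_cell A) _) _ _; bnd; rewrite ?vcompE1 //; vnorm.
  set v0 := e ∘ T $v g ∘ T $v f ∘ iota (al_ob A).
  set v1 := g ∘ c ∘ T $v f ∘ iota (al_ob A).
  set v2 := g ∘ f ∘ a ∘ iota (al_ob A).
  have I1 : is_vcell (gb ▷ T $v f ▷ iota (al_ob A)) v0 v1 by apply: rwhisk_cell H1 _; bnd.
  have I2 : is_vcell ((g ◁ fb) ▷ iota (al_ob A)) v1 v2 by apply: rwhisk_cell H2 _; bnd.
  have I3 : is_vcell ((g ∘ f) ◁ al_unit A) v2 (g ∘ f).
    by apply: is_cell_conv (lwhisk_cell (al_unit_cell A) _) _ _; bnd; rewrite ?vcompE1; bnd; vnorm.
  rewrite (rwhisk_hpaste H1 H2); [|by left|by bnd].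
  rewrite (vpasteA I1 I2 I3).
  rewrite -(lwhisk_comp2 (al_unit_cell A)); [|by bnd..].
  rewrite -(lrwhisk Hf) -?(lwhisk_hpaste G3 G4) ?(lax_unitE Lf); [|by bnd..].
  rewrite (lrwhisk (al_unit_cell C)); [|by bnd..].
  rewrite (rwhisk_comp2 Hg); [|by bnd..].
  rewrite (iota_nat fd fc) -(rwhisk_comp2 Hg); [|by bnd..].
  rewrite -(rwhisk_hpaste G1 G2); [|by left|by bnd].
  rewrite (lax_unitE Lg) (rwhisk_comp2 (al_unit_cell E)) //; bnd.
Qed.
Lemma colax_comp : colax_morphism A C f fb -> colax_morphism C E g gb ->
  colax_morphism A E (g ∘ f) ((g ◁ fb) ⊙ (gb ▷ T $v f)).
Proof.
move=> Lf Lg.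
have Hf := colax_cell Lf; have Hg := colax_cell Lg.
have HTf : is_vcell (T $c fb) (T $v f ∘ T $v a) (T $v c ∘ T $v (T $v f)).
  by apply: is_cell_conv (F_is_cell T Hf) _ _ => /=; vnorm.
have HTg : is_vcell (T $c gb) (T $v g ∘ T $v c) (T $v e ∘ T $v (T $v g)).
  by apply: is_cell_conv (F_is_cell T Hg) _ _ => /=; vnorm.
have H1 : is_vcell (gb ▷ T $v f) (g ∘ c ∘ T $v f) (e ∘ T $v g ∘ T $v f).
  by apply: rwhisk_cell Hg _; bnd.
have H2 : is_vcell (g ◁ fb) (g ∘ f ∘ a) (g ∘ c ∘ T $v f).
  by apply: is_cell_conv (lwhisk_cell Hf _) _ _; bnd; vnorm.
have H12 := vcell_hpaste H2 H1.
split.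
- by apply: is_cell_conv H12 _ _; vnorm.
- set v5 := g ∘ f ∘ a ∘ mu (al_ob A).
  set v6 := g ∘ f ∘ a ∘ T $v a.
  set v7 := g ∘ c ∘ T $v f ∘ T $v a.
  set v8 := e ∘ T $v g ∘ T $v f ∘ T $v a.
  set v9 := e ∘ T $v g ∘ T $v c ∘ T $v (T $v f).
  set v10 := e ∘ T $v e ∘ T $v (T $v g) ∘ T $v (T $v f).
  set w7 := g ∘ c ∘ T $v c ∘ T $v (T $v f).
  set w1 := g ∘ c ∘ mu (al_ob C) ∘ T $v (T $v f).
  set w0 := e ∘ mu (al_ob E) ∘ T $v (T $v g) ∘ T $v (T $v f).
  have EP : al_assoc E ▷ T $v (T $v (g ∘ f)) = al_assoc E ▷ T $v (T $v g) ▷ T $v (T $v f).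
    by rewrite (rwhisk_comp2 (al_assoc_cell E)); bnd; vnorm.
  have EQ : e ◁ T $c ((g ◁ fb) ⊙ (gb ▷ T $v f))
     = ((e ∘ T $v g) ◁ T $c fb) ⊙ (e ◁ T $c gb) ▷ T $v (T $v f).
    rewrite F_hpaste; [|by rewrite (cell_vsrc H1) (cell_vtgt H2)|by left; apply: cell_htgt H2].
    rewrite (F_rwhisk T Hg); last by bnd.
    rewrite (F_lwhisk T Hf); last by bnd.
    rewrite (lwhisk_hpaste (is_cell_conv (lwhisk_cell HTf _) erefl _) (rwhisk_cell HTg _)); bnd; vnorm.
    by rewrite (lrwhisk HTg) ?(lwhisk_comp2 HTf); bnd.
  have ER : ((g ◁ fb) ⊙ (gb ▷ T $v f)) ▷ T $v a = (g ◁ (fb ▷ T $v a)) ⊙ gb ▷ (T $v f ∘ T $v a).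
    rewrite (rwhisk_hpaste H2 H1); [|by left|by bnd].
    by rewrite (rwhisk_comp2 Hg) ?(lrwhisk Hf); bnd.
  have HA : is_vcell ((g ∘ f) ◁ al_assoc A) v5 v6.
    by apply: is_cell_conv (lwhisk_cell (al_assoc_cell A) _) _ _; bnd; vnorm.
  have HR1 : is_vcell (g ◁ (fb ▷ T $v a)) v6 v7.
    by apply: is_cell_conv (lwhisk_cell (rwhisk_cell Hf _) _) _ _; bnd; vnorm.
  have HR2 : is_vcell (gb ▷ (T $v f ∘ T $v a)) v7 v8.
    by apply: is_cell_conv (rwhisk_cell Hg _) _ _; bnd; vnorm.
  have HQ1 : is_vcell ((e ∘ T $v g) ◁ T $c fb) v8 v9.
    by apply: is_cell_conv (lwhisk_cell HTf _) _ _; bnd; vnorm.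
  have HQ2 : is_vcell ((e ◁ T $c gb) ▷ T $v (T $v f)) v9 v10.
    by apply: rwhisk_cell; [apply: is_cell_conv (lwhisk_cell HTg _) _ _|]; bnd; vnorm.
  have HS1 : is_vcell (g ◁ (c ◁ T $c fb)) v7 w7.
    by apply: is_cell_conv (lwhisk_cell (lwhisk_cell HTf _) _) _ _; bnd; vnorm.
  have HS2 : is_vcell (gb ▷ T $v c ▷ T $v (T $v f)) w7 v9.
    by apply: is_cell_conv (rwhisk_cell (rwhisk_cell Hg _) _) _ _; bnd; vnorm.
  have HW1 : is_vcell ((g ◁ fb) ▷ mu (al_ob A)) v5 w1.
    rewrite /w1 -(vcompA (f := T $v (T $v f)) (g := mu (al_ob C))); [|by bnd..].
    rewrite -(mu_nat fd fc); vnorm.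
    by apply: rwhisk_cell; bnd.
  have HU2 : is_vcell (g ◁ (al_assoc C ▷ T $v (T $v f))) w1 w7.
    by apply: is_cell_conv (lwhisk_cell (al_assoc_cell2 _) _) _ _; bnd; vnorm.
  have HU1 : is_vcell (gb ▷ mu (al_ob C) ▷ T $v (T $v f)) w1 w0.
    rewrite /w0 -(vcompA (f := T $v (T $v g)) (g := mu (al_ob E))); [|by bnd..].
    rewrite -(mu_nat gd gc); vnorm.
    by apply: rwhisk_cell; [apply: rwhisk_cell Hg _|]; bnd.
  have HP : is_vcell (al_assoc E ▷ T $v (T $v g) ▷ T $v (T $v f)) w0 v10.
    by apply: rwhisk_cell; [apply: al_assoc_cell2|]; bnd.
  have X : (gb ▷ (T $v f ∘ T $v a)) ⊙ ((e ∘ T $v g) ◁ T $c fb)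
      = (g ◁ (c ◁ T $c fb)) ⊙ (gb ▷ T $v c ▷ T $v (T $v f)).
    rewrite (cell_interchange HTf Hg); last by bnd.
    by rewrite (rwhisk_comp2 Hg) ?(lwhisk_comp2 HTf); bnd.
  have Y1 : (g ◁ (al_assoc C ▷ T $v (T $v f))) ⊙ (gb ▷ T $v c ▷ T $v (T $v f)) ⊙ ((e ◁ T $c gb) ▷ T $v (T $v f))
      = (gb ▷ mu (al_ob C) ▷ T $v (T $v f)) ⊙ (al_assoc E ▷ T $v (T $v g) ▷ T $v (T $v f)).
    have G1 : is_vcell (al_assoc E ▷ T $v (T $v g)) (e ∘ T $v g ∘ mu (al_ob C)) (e ∘ T $v e ∘ T $v (T $v g)).
      rewrite -(vcompA (h := e) (f := mu (al_ob C))); [|by bnd..].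
      by rewrite (mu_nat gd gc); vnorm; apply: al_assoc_cell2; bnd.
    have G2 : is_vcell (e ◁ T $c gb) (e ∘ T $v g ∘ T $v c) (e ∘ T $v e ∘ T $v (T $v g)).
      by apply: is_cell_conv (lwhisk_cell HTg _) _ _; bnd; vnorm.
    have G3 : is_vcell (gb ▷ T $v c) (g ∘ c ∘ T $v c) (e ∘ T $v g ∘ T $v c) by apply: rwhisk_cell Hg _; bnd.
    have G4 : is_vcell (gb ▷ mu (al_ob C)) (g ∘ c ∘ mu (al_ob C)) (e ∘ T $v g ∘ mu (al_ob C)) by apply: rwhisk_cell Hg _; bnd.
    have G5 : is_vcell (g ◁ al_assoc C) (g ∘ c ∘ mu (al_ob C)) (g ∘ c ∘ T $v c).
      by apply: is_cell_conv (lwhisk_cell (al_assoc_cell C) _) _ _; bnd; vnorm.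
    rewrite (lrwhisk (al_assoc_cell C)); [|by bnd..].
    rewrite -(rwhisk_hpaste G5 G3); [|by left|by bnd].
    rewrite -(rwhisk_hpaste (vcell_hpaste G5 G3) G2); [|by left|by bnd].
    by rewrite (colax_assocE Lg) (rwhisk_hpaste G4 G1); [|by left|by bnd].
  have Y2 : ((g ∘ f) ◁ al_assoc A) ⊙ (g ◁ (fb ▷ T $v a)) ⊙ (g ◁ (c ◁ T $c fb))
      = ((g ◁ fb) ▷ mu (al_ob A)) ⊙ (g ◁ (al_assoc C ▷ T $v (T $v f))).
    have G1 : is_vcell (al_assoc C ▷ T $v (T $v f)) (c ∘ T $v f ∘ mu (al_ob A)) (c ∘ T $v c ∘ T $v (T $v f)).
      rewrite -(vcompA (h := c) (f := mu (al_ob A))); [|by bnd..].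
      by rewrite (mu_nat fd fc); vnorm; apply: al_assoc_cell2; bnd.
    have G2 : is_vcell (c ◁ T $c fb) (c ∘ T $v f ∘ T $v a) (c ∘ T $v c ∘ T $v (T $v f)).
      by apply: is_cell_conv (lwhisk_cell HTf _) _ _; bnd; vnorm.
    have G3 : is_vcell (fb ▷ T $v a) (f ∘ a ∘ T $v a) (c ∘ T $v f ∘ T $v a) by apply: rwhisk_cell Hf _; bnd.
    have G4 : is_vcell (fb ▷ mu (al_ob A)) (f ∘ a ∘ mu (al_ob A)) (c ∘ T $v f ∘ mu (al_ob A)) by apply: rwhisk_cell Hf _; bnd.
    have G5 : is_vcell (f ◁ al_assoc A) (f ∘ a ∘ mu (al_ob A)) (f ∘ a ∘ T $v a).
      by apply: is_cell_conv (lwhisk_cell (al_assoc_cell A) _) _ _; bnd; vnorm.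
    rewrite -(lwhisk_comp2 (al_assoc_cell A)); [|by bnd..].
    rewrite -(lwhisk_hpaste G5 G3); last by bnd.
    rewrite -(lwhisk_hpaste (vcell_hpaste G5 G3) G2); last by bnd.
    rewrite (colax_assocE Lf) (lwhisk_hpaste G4 G1); last by bnd.
    by rewrite (lrwhisk Hf); bnd.
  rewrite EP EQ ER -(vpasteA HA HR1 HR2) -(vpasteA (vcell_hpaste (vcell_hpaste HA HR1) HR2) HQ1 HQ2).
  rewrite (vpasteA (vcell_hpaste HA HR1) HR2 HQ1) X.
  rewrite -(vpasteA (vcell_hpaste HA HR1) HS1 HS2) Y2.
  rewrite (vpasteA (vcell_hpaste HW1 HU2) HS2 HQ2) (vpasteA HW1 HU2 (vcell_hpaste HS2 HQ2)).
  rewrite -(vpasteA HU2 HS2 HQ2) Y1 -(vpasteA HW1 HU1 HP); congr (_ ⊙ _).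
  rewrite (rwhisk_hpaste H2 H1); [|by left|by bnd]; congr (_ ⊙ _).
  rewrite !(rwhisk_comp2 Hg) -?(mu_nat fd fc) //; bnd.
- have G1 : is_vcell (gb ▷ iota (al_ob C)) (g ∘ c ∘ iota (al_ob C)) (e ∘ T $v g ∘ iota (al_ob C)).
    by apply: rwhisk_cell Hg _; bnd.
  have G2 : is_vcell (al_unit E ▷ g) (e ∘ T $v g ∘ iota (al_ob C)) g.
    rewrite -(vcompA (f := iota (al_ob C))); [|by bnd..].
    rewrite (iota_nat gd gc); vnorm.
    by apply: is_cell_conv (rwhisk_cell (al_unit_cell E) _) _ _; bnd; rewrite vcomp1E.
  have G3 : is_vcell (fb ▷ iota (al_ob A)) (f ∘ a ∘ iota (al_ob A)) (c ∘ T $v f ∘ iota (al_ob A)).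
    by apply: rwhisk_cell Hf _; bnd.
  have G4 : is_vcell (al_unit C ▷ f) (c ∘ T $v f ∘ iota (al_ob A)) f.
    rewrite -(vcompA (f := iota (al_ob A))); [|by bnd..].
    rewrite (iota_nat fd fc); vnorm.
    by apply: is_cell_conv (rwhisk_cell (al_unit_cell C) _) _ _; bnd; rewrite vcomp1E.
  set v0 := e ∘ T $v g ∘ T $v f ∘ iota (al_ob A).
  set v1 := g ∘ c ∘ T $v f ∘ iota (al_ob A).
  set v2 := g ∘ f ∘ a ∘ iota (al_ob A).
  have I1 : is_vcell (gb ▷ T $v f ▷ iota (al_ob A)) v1 v0 by apply: rwhisk_cell H1 _; bnd.
  have I2 : is_vcell ((g ◁ fb) ▷ iota (al_ob A)) v2 v1 by apply: rwhisk_cell H2 _; bnd.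
  have I3 : is_vcell (al_unit E ▷ (g ∘ f)) v0 (g ∘ f).
    rewrite -(rwhisk_comp2 (al_unit_cell E)); [|by bnd..].
    rewrite /v0 -(vcompA (f := iota (al_ob A))); [|by bnd..].
    rewrite (iota_nat fd fc); vnorm.
    by apply: rwhisk_cell G2 _; bnd.
  rewrite (rwhisk_hpaste H2 H1); [|by left|by bnd].
  rewrite (vpasteA I2 I1 I3).
  rewrite -(rwhisk_comp2 (al_unit_cell E)); [|by bnd..].
  rewrite (rwhisk_comp2 Hg); [|by bnd..].
  rewrite (iota_nat fd fc) -(rwhisk_comp2 Hg); [|by bnd..].
  rewrite -(rwhisk_hpaste G1 G2); [|by left|by bnd].
  rewrite (colax_unitE Lg) -(lrwhisk (al_unit_cell C)); [|by bnd..].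
  rewrite -(lrwhisk Hf); [|by bnd..].
  rewrite -(lwhisk_hpaste G3 G4); last by bnd.
  by rewrite (colax_unitE Lf) (lwhisk_comp2 (al_unit_cell A)); bnd.
Qed.
End Comp.

Lemma vinvertible_hpaste (phi psi : cell K) f g h : is_vcell phi f g -> is_vcell psi g h ->
  vinvertible phi -> vinvertible psi -> vinvertible (phi ⊙ psi).
Proof.
move=> H1 H2 [p' [P1 P2 P3]] [q' [Q1 Q2 Q3]].
rewrite (cell_vsrc H1) (cell_vtgt H1) in P1 P2 P3.
rewrite (cell_vsrc H2) (cell_vtgt H2) in Q1 Q2 Q3.
have H := vcell_hpaste H1 H2.
exists (q' ⊙ p'); rewrite (cell_vsrc H) (cell_vtgt H); split; first exact: vcell_hpaste Q1 P1.
- rewrite (vpasteA H1 H2 (vcell_hpaste Q1 P1)) -(vpasteA H2 Q1 P1) Q2.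
  by rewrite hpaste1E ?(cell_vsrc P1).
- rewrite (vpasteA Q1 P1 H) -(vpasteA P1 H1 H2) P3.
  by rewrite hpaste1E ?(cell_vsrc H2).
Qed.
Lemma vinvertible_lwhisk (h : vmor K) (phi : cell K) f g : is_vcell phi f g -> vcod f = vdom h ->
  vinvertible phi -> vinvertible (h ◁ phi).
Proof.
move=> H e [p [P1 P2 P3]]; rewrite (cell_vsrc H) (cell_vtgt H) in P1 P2 P3.
have e' : vcod g = vdom h by rewrite -(cell_vtgt H) (vtgt_cod_nil (cell_htgt H)) (cell_vsrc H).
have L := lwhisk_cell H e.
exists (h ◁ p); rewrite (cell_vsrc L) (cell_vtgt L); split; first exact: lwhisk_cell P1 e'.
- by rewrite -(lwhisk_hpaste H P1 e) P2 lwhisk_vidc.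
- by rewrite -(lwhisk_hpaste P1 H e') P3 lwhisk_vidc.
Qed.
Lemma vinvertible_rwhisk (k : vmor K) (phi : cell K) f g : is_vcell phi f g -> vcod k = vdom f ->
  vinvertible phi -> vinvertible (phi ▷ k).
Proof.
move=> H e [p [P1 P2 P3]]; rewrite (cell_vsrc H) (cell_vtgt H) in P1 P2 P3.
have e' : vcod k = vdom g by rewrite -(cell_vtgt H) (vtgt_dom_nil (cell_hsrc H)) (cell_vsrc H).
have L := rwhisk_cell H e.
exists (p ▷ k); rewrite (cell_vsrc L) (cell_vtgt L); split; first exact: rwhisk_cell P1 e'.
- by rewrite -(rwhisk_hpaste H P1 _ e) ?P2 ?rwhisk_vidc //; left.
- by rewrite -(rwhisk_hpaste P1 H _ e') ?P3 ?rwhisk_vidc //; left.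
Qed.

Definition comp_str (w : weakness) (f g : vmor K) (fb gb : cell K) : cell K :=
  if w is Colax then (g ◁ fb) ⊙ (gb ▷ T $v f) else (gb ▷ T $v f) ⊙ (g ◁ fb).

Lemma w_morphism_cell w (A C : colax_algebra T) (f : vmor K) fb : w_morphism w A C f fb ->
  is_vcell fb (if w is Colax then f ∘ al_str A else al_str C ∘ T $v f)
    (if w is Colax then al_str C ∘ T $v f else f ∘ al_str A :> vmor K).
Proof. by case: w => [/colax_cell|/lax_cell|[/lax_cell]]. Qed.

Lemma w_morphism_id w (A : colax_algebra T) : w_morphism w A A (vid (al_ob A)) (vidc (al_str A)).
Proof.
case: w; [exact: colax_id|exact: lax_id|split; [exact: lax_id|]].
exact: vinvertible_vidc.
Qed.

Lemma w_morphism_comp w (A C E : colax_algebra T) (f g : vmor K) fb gb :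
  vdom f = al_ob A -> vcod f = al_ob C -> vdom g = al_ob C -> vcod g = al_ob E ->
  w_morphism w A C f fb -> w_morphism w C E g gb -> w_morphism w A E (g ∘ f) (comp_str w f g fb gb).
Proof.
move=> fd fc gd gc; rewrite /comp_str; case: w => /=; [exact: (colax_comp fd fc gd gc)|exact: (lax_comp fd fc gd gc)|].
move=> [Lf If] [Lg Ig]; split; first exact: (lax_comp fd fc gd gc).
have Hf := lax_cell Lf; have Hg := lax_cell Lg.
apply: vinvertible_hpaste.
- by apply: rwhisk_cell Hg _; bnd.
- by apply: is_cell_conv (lwhisk_cell Hf _) _ _; bnd; vnorm.
- by apply: vinvertible_rwhisk Hg _ Ig; bnd.
- by apply: vinvertible_lwhisk Hf _ If; bnd.
Qed.

Lemma comp_strA w (A B C D : colax_algebra T) (f g h : vmor K) fb gb hb :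
  vdom f = al_ob A -> vcod f = al_ob B -> vdom g = al_ob B -> vcod g = al_ob C ->
  vdom h = al_ob C -> vcod h = al_ob D ->
  w_morphism w A B f fb -> w_morphism w B C g gb -> w_morphism w C D h hb ->
  comp_str w (g ∘ f) h (comp_str w f g fb gb) hb = comp_str w f (h ∘ g) fb (comp_str w g h gb hb).
Proof.
move=> fd fc gd gc hd hc /w_morphism_cell Hf /w_morphism_cell Hg /w_morphism_cell Hh.
have lax : w <> Colax -> comp_str w (g ∘ f) h (comp_str w f g fb gb) hb = comp_str w f (h ∘ g) fb (comp_str w g h gb hb).
  move=> n; have E f' g' fb' gb' : comp_str w f' g' fb' gb' = (gb' ▷ T $v f') ⊙ (g' ◁ fb') by case: w n {Hf Hg Hh}.
  have [Ff Fg Fh] : [/\ is_vcell fb (al_str B ∘ T $v f) (f ∘ al_str A),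
    is_vcell gb (al_str C ∘ T $v g) (g ∘ al_str B) & is_vcell hb (al_str D ∘ T $v h) (h ∘ al_str C)].
    by case: w n Hf Hg Hh {E}.
  rewrite !E.
  have G1 : is_vcell (gb ▷ T $v f) (al_str C ∘ T $v g ∘ T $v f) (g ∘ al_str B ∘ T $v f) by apply: rwhisk_cell Fg _; bnd.
  have G2 : is_vcell (g ◁ fb) (g ∘ al_str B ∘ T $v f) (g ∘ f ∘ al_str A).
    by apply: is_cell_conv (lwhisk_cell Ff _) _ _; bnd; vnorm.
  have G3 : is_vcell (hb ▷ T $v g) (al_str D ∘ T $v h ∘ T $v g) (h ∘ al_str C ∘ T $v g) by apply: rwhisk_cell Fh _; bnd.
  have G4 : is_vcell (h ◁ gb) (h ∘ al_str C ∘ T $v g) (h ∘ g ∘ al_str B).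
    by apply: is_cell_conv (lwhisk_cell Fg _) _ _; bnd; vnorm.
  have I1 : is_vcell (hb ▷ T $v (g ∘ f)) (al_str D ∘ T $v h ∘ T $v g ∘ T $v f) (h ∘ al_str C ∘ T $v g ∘ T $v f).
    by apply: is_cell_conv (rwhisk_cell Fh _) _ _; bnd; vnorm.
  have I2 : is_vcell (h ◁ (gb ▷ T $v f)) (h ∘ al_str C ∘ T $v g ∘ T $v f) (h ∘ g ∘ al_str B ∘ T $v f).
    by apply: is_cell_conv (lwhisk_cell G1 _) _ _; bnd; vnorm.
  have I3 : is_vcell (h ◁ (g ◁ fb)) (h ∘ g ∘ al_str B ∘ T $v f) (h ∘ g ∘ f ∘ al_str A).
    by apply: is_cell_conv (lwhisk_cell G2 _) _ _; bnd; vnorm.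
  rewrite (lwhisk_hpaste G1 G2); last by bnd.
  rewrite -(vpasteA I1 I2 I3) (rwhisk_hpaste G3 G4); [|by left|by bnd].
  rewrite (lwhisk_comp2 Ff); [|by bnd..].
  rewrite (rwhisk_comp2 Fh); [|by bnd..].
  by rewrite (lrwhisk Fg) -?F_vcomp; bnd.
case: w lax Hf Hg Hh; [move=> _ Hf Hg Hh|by move=> lax _ _ _; apply: lax|by move=> lax _ _ _; apply: lax].
rewrite /comp_str.
have G1 : is_vcell (gb ▷ T $v f) (g ∘ al_str B ∘ T $v f) (al_str C ∘ T $v g ∘ T $v f) by apply: rwhisk_cell Hg _; bnd.
have G2 : is_vcell (g ◁ fb) (g ∘ f ∘ al_str A) (g ∘ al_str B ∘ T $v f).
  by apply: is_cell_conv (lwhisk_cell Hf _) _ _; bnd; vnorm.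
have G3 : is_vcell (hb ▷ T $v g) (h ∘ al_str C ∘ T $v g) (al_str D ∘ T $v h ∘ T $v g) by apply: rwhisk_cell Hh _; bnd.
have G4 : is_vcell (h ◁ gb) (h ∘ g ∘ al_str B) (h ∘ al_str C ∘ T $v g).
  by apply: is_cell_conv (lwhisk_cell Hg _) _ _; bnd; vnorm.
have I1 : is_vcell (hb ▷ T $v (g ∘ f)) (h ∘ al_str C ∘ T $v g ∘ T $v f) (al_str D ∘ T $v h ∘ T $v g ∘ T $v f).
  by apply: is_cell_conv (rwhisk_cell Hh _) _ _; bnd; vnorm.
have I2 : is_vcell (h ◁ (gb ▷ T $v f)) (h ∘ g ∘ al_str B ∘ T $v f) (h ∘ al_str C ∘ T $v g ∘ T $v f).
  by apply: is_cell_conv (lwhisk_cell G1 _) _ _; bnd; vnorm.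
have I3 : is_vcell (h ◁ (g ◁ fb)) (h ∘ g ∘ f ∘ al_str A) (h ∘ g ∘ al_str B ∘ T $v f).
  by apply: is_cell_conv (lwhisk_cell G2 _) _ _; bnd; vnorm.
rewrite (lwhisk_hpaste G2 G1); last by bnd.
rewrite (vpasteA I3 I2 I1) (rwhisk_hpaste G4 G3); [|by left|by bnd].
rewrite (lwhisk_comp2 Hf); [|by bnd..].
rewrite (rwhisk_comp2 Hh); [|by bnd..].
by rewrite (lrwhisk Hg) -?F_vcomp; bnd.
Qed.
End TMorphisms.

Section TCells.
Variables (K : avdc) (T : monad K).

Lemma str_tgt_cell (C D : colax_algebra T) o : linked (@ht_dom K T) (@ht_cod K T) C (oseq o) D ->
  is_cell (str_tgt C o) (map (Fh T) (oseq (omap (@ht_map K T) o))) (omap (@ht_map K T) o) (al_str C) (al_str D).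
Proof.
case: o => [J|] /=; first by case=> <- <-; apply: ht_str_cell.
by move=> <-; apply: vidc_cell.
Qed.

Lemma str_path_nonnil (A : colax_algebra T) Js : str_path A Js <> [::].
Proof. by case: Js. Qed.

Lemma map_ht_chain (A B : colax_algebra T) Js : linked (@ht_dom K T) (@ht_cod K T) A Js B ->
  chain (al_str A) (map (@ht_cell K T) Js) (al_str B).
Proof.
elim: Js A => [|J Js IH] A /=; first by move=> ->.
by case=> <- /IH H; split; rewrite ?(cell_vsrc (ht_str_cell J)) ?(cell_vtgt (ht_str_cell J)).
Qed.
Lemma map_ht_htgts (Js : seq (hTmor T)) : htgts (map (@ht_cell K T) Js) = map (@ht_map K T) Js.
Proof. by elim: Js => //= J Js; rewrite /htgts /= (cell_htgt (ht_str_cell J)) /= => ->. Qed.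
Lemma map_ht_hsrcs (Js : seq (hTmor T)) : hsrcs (map (@ht_cell K T) Js) = map (Fh T) (map (@ht_map K T) Js).
Proof. by elim: Js => //= J Js; rewrite /hsrcs /= (cell_hsrc (ht_str_cell J)) /= => ->. Qed.

Lemma str_path_chain (A B : colax_algebra T) Js : linked (@ht_dom K T) (@ht_cod K T) A Js B ->
  chain (al_str A) (str_path A Js) (al_str B).
Proof. by case: Js => [/= ->|J Js /map_ht_chain] //; split; rewrite idE. Qed.
Lemma str_path_htgts (A : colax_algebra T) Js : htgts (str_path A Js) = map (@ht_map K T) Js.
Proof. by case: Js => [|J Js]; [rewrite /htgts /= idE|apply: map_ht_htgts]. Qed.
Lemma str_path_hsrcs (A : colax_algebra T) Js : hsrcs (str_path A Js) = map (Fh T) (map (@ht_map K T) Js).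
Proof. by case: Js => [|J Js]; [rewrite /hsrcs /= idE|apply: map_ht_hsrcs]. Qed.

Definition str_of (x : hTmor T + colax_algebra T) : cell K :=
  match x with inl J => ht_cell J | inr A => vidc (al_str A) end.
Definition str_left (x : hTmor T + colax_algebra T) : option (hTmor T) :=
  if x is inl J then Some J else None.

Lemma str_of_drop (psi : cell K) f g s1 xs : composable psi f (s1 ++ map str_of xs) g ->
  s1 ++ map (@ht_cell K T) (pmap str_left xs) <> [::] ->
  ccomp psi (s1 ++ map str_of xs) = ccomp psi (s1 ++ map (@ht_cell K T) (pmap str_left xs)).
Proof.
elim: xs s1 => //= -[J|A] xs IH s1 /= C n; first by rewrite -!cat_rcons in C n *; apply: IH C n.
have m : s1 ++ map str_of xs <> [::] by move: n; case: (s1) => //=; case: (xs).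
by case: (ccomp_drop C m) => C' ->; apply: IH C' n.
Qed.
Lemma str_of_drop_nil (psi : cell K) f g xs : composable psi f (map str_of xs) g ->
  pmap str_left xs = [::] -> ccomp psi (map str_of xs) = ccomp psi [:: vidc f].
Proof.
elim: xs f => [|[J|A] xs IH] f C //=; first by case: C.
case: xs IH C => [|x xs] IH C e.
  by case: C => _ /= [<- _] _ _; rewrite /= idE.
have [//|C' ->] := @ccomp_drop _ _ [::] _ _ _ _ C; exact: IH C' e.
Qed.
Lemma str_of_path (psi : cell K) g A xs Js : composable psi (al_str A) (map str_of xs) g ->
  pmap str_left xs = Js -> ccomp psi (map str_of xs) = ccomp psi (str_path A Js).
Proof.
move=> C <-; case E: (pmap str_left xs) => [|J Js']; first exact: str_of_drop_nil C E.
by rewrite -[map str_of xs]cat0s (@str_of_drop _ _ _ [::] _ C) E.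
Qed.

Section Cells.
Variable w : weakness.
Local Notation TG := (TAlg_graph T w).
Implicit Types (Phi Psi : Tcell T w).
Definition tgtS Phi := str_tgt (vt_cod (tc_vsrc Phi)) (tc_htgt Phi).
Definition srcP Phi := str_path (vt_dom (tc_vsrc Phi)) (tc_hsrc Phi).
Definition cellZ Phi := ccomp (tgtS Phi) [:: T $c (tc_cell Phi)].
Definition cellW Phi := ccomp (tc_cell Phi) (srcP Phi).

Lemma tgtS_cell Phi : is_cell (tgtS Phi) (map (Fh T) (oseq (htgt (tc_cell Phi)))) (htgt (tc_cell Phi))
  (al_str (vt_cod (tc_vsrc Phi))) (al_str (vt_cod (tc_vtgt Phi))).
Proof. rewrite (cell_htgt (tc_is_cell Phi)); exact: str_tgt_cell (tc_tgt_path Phi). Qed.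

Lemma tgtS_comp Phi : composable (tgtS Phi) (T $v (vt_map (tc_vsrc Phi))) [:: T $c (tc_cell Phi)] (T $v (vt_map (tc_vtgt Phi))).
Proof.
have H := tgtS_cell Phi; have H' := F_is_cell T (tc_is_cell Phi).
split=> //; first by split; rewrite ?(cell_vsrc H') ?(cell_vtgt H').
  by rewrite (cell_hsrc H) /htgts /= F_htgt; case: (htgt _).
by rewrite (cell_vsrc H); bnd.
Qed.
Lemma cellZ_cell Phi : is_cell (cellZ Phi) (map (Fh T) (hsrc (tc_cell Phi))) (htgt (tc_cell Phi))
  (al_str (vt_cod (tc_vsrc Phi)) ∘ T $v (vt_map (tc_vsrc Phi)))
  (al_str (vt_cod (tc_vtgt Phi)) ∘ T $v (vt_map (tc_vtgt Phi))).
Proof.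
have [e1 e2 e3 e4] := ccomp_cell (tgtS_comp Phi); have H := tgtS_cell Phi.
split; rewrite /cellZ ?e1 ?e2 ?e3 ?e4 ?(cell_htgt H) ?(cell_vsrc H) ?(cell_vtgt H) //.
by rewrite /hsrcs /= cats0 F_hsrc.
Qed.
Lemma srcP_comp Phi : composable (tc_cell Phi) (al_str (vt_dom (tc_vsrc Phi))) (srcP Phi) (al_str (vt_dom (tc_vtgt Phi))).
Proof.
have H := tc_is_cell Phi.
split; [exact: str_path_nonnil|exact: str_path_chain (tc_src_path Phi)| |].
  by rewrite (cell_hsrc H) str_path_htgts.
by rewrite (cell_vsrc H); bnd.
Qed.
Lemma cellW_cell Phi : is_cell (cellW Phi) (map (Fh T) (hsrc (tc_cell Phi))) (htgt (tc_cell Phi))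
  (vt_map (tc_vsrc Phi) ∘ al_str (vt_dom (tc_vsrc Phi)))
  (vt_map (tc_vtgt Phi) ∘ al_str (vt_dom (tc_vtgt Phi))).
Proof.
have [e1 e2 e3 e4] := ccomp_cell (srcP_comp Phi); have H := tc_is_cell Phi.
split; rewrite /cellW ?e1 ?e2 ?e3 ?e4 ?(cell_vsrc H) ?(cell_vtgt H) //.
by rewrite str_path_hsrcs (cell_hsrc H).
Qed.

Lemma tc_chain (f g : vTmor T w) s : chain (G := TG) f s g ->
  chain (G := K) (vt_map f) (map (@tc_cell K T w) s) (vt_map g).
Proof.
elim: s f => [|Phi s IH] f /=; first by move=> ->.
by case=> <- /IH H; split; rewrite ?(cell_vsrc (tc_is_cell Phi)) ?(cell_vtgt (tc_is_cell Phi)).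
Qed.
Lemma tc_htgts s : htgts (G := K) (map (@tc_cell K T w) s) = map (@ht_map K T) (htgts (G := TG) s).
Proof.
by elim: s => //= Phi s; rewrite /htgts /= (cell_htgt (tc_is_cell Phi)) => ->; case: (tc_htgt Phi).
Qed.
Lemma tc_hsrcs s : hsrcs (G := K) (map (@tc_cell K T w) s) = map (@ht_map K T) (hsrcs (G := TG) s).
Proof.
by elim: s => //= Phi s; rewrite /hsrcs /= (cell_hsrc (tc_is_cell Phi)) map_cat => ->.
Qed.
Lemma tc_composable Psi (f g : vTmor T w) s : composable (G := TG) Psi f s g ->
  composable (G := K) (tc_cell Psi) (vt_map f) (map (@tc_cell K T w) s) (vt_map g).
Proof.
case=> n c e v; have H := tc_is_cell Psi; split; [by case: (s) n|exact: tc_chain| |].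
  by rewrite tc_htgts (cell_hsrc H); congr map.
by rewrite (cell_vsrc H) vt_map_cod vt_map_dom; congr al_ob.
Qed.

Lemma TG_hsrcs_path (f g : vTmor T w) s : chain (G := TG) f s g ->
  linked (@ht_dom K T) (@ht_cod K T) (vt_dom f) (hsrcs (G := TG) s) (vt_dom g).
Proof.
elim: s f => [|Phi s IH] f /=; first by move=> ->.
by case=> <- /IH H; apply/linked_cat; exists (vt_dom (tc_vtgt Phi)) => //; apply: tc_src_path.
Qed.
Lemma TG_htgts_path (f g : vTmor T w) s : chain (G := TG) f s g ->
  linked (@ht_dom K T) (@ht_cod K T) (vt_cod f) (htgts (G := TG) s) (vt_cod g).
Proof.
elim: s f => [|Phi s IH] f /=; first by move=> ->.
case=> <- /IH; have := tc_tgt_path Phi; rewrite /htgts /=; case: (tc_htgt Phi) => [J|] /=.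
  by case=> e1 e2 H; split=> //; rewrite e2.
by move=> ->.
Qed.
Lemma TG_comp_ver_tgt Psi (f g : vTmor T w) s : composable (G := TG) Psi f s g -> vt_cod g = vt_dom (tc_vtgt Psi).
Proof.
case=> _ /TG_htgts_path H E V; have := tc_src_path Psi; rewrite -[tc_hsrc Psi]/(hsrc (a := TG) Psi) E.
by rewrite -[vt_dom (tc_vsrc Psi)]V => H'; apply: linked_uniq H H'.
Qed.

Definition tgtX Phi : hTmor T + colax_algebra T := if tc_htgt Phi is Some J then inl J else inr (vt_cod (tc_vsrc Phi)).
Definition srcX Phi : seq (hTmor T + colax_algebra T) :=
  if tc_hsrc Phi is [::] then [:: inr (vt_dom (tc_vsrc Phi))] else map inl (tc_hsrc Phi).
Lemma tgtXE s : map str_of (map tgtX s) = map tgtS s.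
Proof. by rewrite -map_comp; apply: eq_map => Phi; rewrite /= /tgtX /tgtS; case: (tc_htgt Phi). Qed.
Lemma srcXE s : map str_of (flatten (map srcX s)) = flatten (map srcP s).
Proof.
elim: s => //= Phi s <-; rewrite map_cat; congr (_ ++ _); rewrite /srcX /srcP.
by case: (tc_hsrc Phi) => //= J Js; congr (_ :: _); rewrite -map_comp.
Qed.
Lemma tgtX_left s : pmap str_left (map tgtX s) = htgts (G := TG) s.
Proof.
elim: s => //= Phi s ->; rewrite /htgts /= {1}/tgtX; by case: (tc_htgt Phi).
Qed.
Lemma srcX_left s : pmap str_left (flatten (map srcX s)) = hsrcs (G := TG) s.
Proof.
elim: s => //= Phi s IH; rewrite pmap_cat IH /hsrcs /=; congr (_ ++ _); rewrite /srcX.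
by case: (tc_hsrc Phi) => //= J Js; congr (_ :: _); elim: Js => //= J' Js ->.
Qed.

Lemma tgtS_chain (f g : vTmor T w) s : chain (G := TG) f s g ->
  chain (G := K) (al_str (vt_cod f)) (map tgtS s) (al_str (vt_cod g)).
Proof.
elim: s f => [|Phi s IH] f /=; first by move=> ->.
by case=> <- /IH H; split; rewrite ?(cell_vsrc (tgtS_cell Phi)) ?(cell_vtgt (tgtS_cell Phi)).
Qed.
Lemma tgtS_htgts s : htgts (G := K) (map tgtS s) = htgts (G := K) (map (@tc_cell K T w) s).
Proof. by elim: s => //= Phi s; rewrite /htgts /= (cell_htgt (tgtS_cell Phi)) => ->. Qed.
Lemma srcP_chain (f g : vTmor T w) s : chain (G := TG) f s g ->
  chain (G := K) (al_str (vt_dom f)) (flatten (map srcP s)) (al_str (vt_dom g)).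
Proof.
elim: s f => [|Phi s IH] f /=; first by move=> ->.
case=> <- /IH H; apply/linked_cat; exists (al_str (vt_dom (tc_vtgt Phi))) => //.
exact: str_path_chain (tc_src_path Phi).
Qed.
Lemma srcP_htgts s : htgts (G := K) (flatten (map srcP s)) = hsrcs (G := K) (map (@tc_cell K T w) s).
Proof.
elim: s => //= Phi s IH; rewrite htgts_cat IH /hsrcs /=; congr (_ ++ _).
by rewrite str_path_htgts (cell_hsrc (tc_is_cell Phi)).
Qed.

Section Closure.
Variables (Psi : Tcell T w) (f g : vTmor T w) (s : seq (Tcell T w)).
Hypothesis C : composable (G := TG) Psi f s g.
Local Notation psi := (tc_cell Psi).
Local Notation phis := (map (@tc_cell K T w) s).
Local Notation f' := (tc_vsrc Psi).
Local Notation g' := (tc_vtgt Psi).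

Let CK := tc_composable C.
Let ef : vt_cod f = vt_dom f' := comp_ver C.
Let eg : vt_cod g = vt_dom g' := TG_comp_ver_tgt C.

Lemma tgtS_composable : composable psi (al_str (vt_cod f)) (map tgtS s) (al_str (vt_cod g)).
Proof.
case: (CK) => n c e v; split; [by case: (s) n|exact: tgtS_chain (comp_chain C)| |].
  by rewrite tgtS_htgts.
by rewrite al_str_cod -v; bnd.
Qed.
Lemma W_tgtS : cellW Psi = ccomp psi (map tgtS s).
Proof.
have X := tgtS_composable; rewrite -tgtXE in X *.
rewrite (str_of_path X (tgtX_left s)) /cellW /srcP ef; congr (ccomp _ (str_path _ _)).
exact: comp_hor C.
Qed.

Lemma cellZ_list : composable psi (al_str (vt_cod f) ∘ T $v (vt_map f)) (map cellZ s) (al_str (vt_cod g) ∘ T $v (vt_map g)).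
Proof.
case: (CK) => n c e v; split; [by case: (s) n| | |].
- elim: (s) (f) (comp_chain C) => [|Phi s' IH] h /=; first by move=> ->.
  by case=> <- /IH H; split; rewrite ?(cell_vsrc (cellZ_cell Phi)) ?(cell_vtgt (cellZ_cell Phi)).
- rewrite e; elim: (s) => //= Phi s'; rewrite /htgts /= => ->.
  by rewrite (cell_htgt (cellZ_cell Phi)).
- by rewrite -v; bnd.
Qed.
Lemma cellW_list : composable psi (vt_map f ∘ al_str (vt_dom f)) (map cellW s) (vt_map g ∘ al_str (vt_dom g)).
Proof.
case: (CK) => n c e v; split; [by case: (s) n| | |].
- elim: (s) (f) (comp_chain C) => [|Phi s' IH] h /=; first by move=> ->.
  by case=> <- /IH H; split; rewrite ?(cell_vsrc (cellW_cell Phi)) ?(cell_vtgt (cellW_cell Phi)).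
- rewrite e; elim: (s) => //= Phi s'; rewrite /htgts /= => ->.
  by rewrite (cell_htgt (cellW_cell Phi)).
- by rewrite -v; bnd.
Qed.

Lemma Tphis_comp : composable (cellW Psi) (T $v (vt_map f)) (map (Fc T) phis) (T $v (vt_map g)).
Proof.
have H := cellW_cell Psi; have [n c e v] := F_composable T CK; split=> //.
  by rewrite (cell_hsrc H) -F_hsrc.
rewrite (cell_vsrc H); bnd; by rewrite ef.
Qed.
Lemma Tphis_compZ : composable (cellZ Psi) (T $v (vt_map f)) (map (Fc T) phis) (T $v (vt_map g)).
Proof.
have H := cellZ_cell Psi; have [n c e v] := F_composable T CK; split=> //.
  by rewrite (cell_hsrc H) -F_hsrc.
rewrite (cell_vsrc H); bnd; by rewrite ef.
Qed.

Lemma W_Tphis : ccomp (cellW Psi) (map (Fc T) phis) = ccomp psi (map cellZ s).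
Proof.
rewrite W_tgtS.
pose d := map (fun Phi => (tgtS Phi, [:: T $c (tc_cell Phi)])) s.
have d1 : map fst d = map tgtS s by rewrite /d -map_comp.
have d2 : flatten (map snd d) = map (Fc T) phis by rewrite /d; elim: (s) => //= Phi s' ->.
have d3 : map (fun p => ccomp p.1 p.2) d = map cellZ s by rewrite /d -map_comp.
rewrite -d1 -d2 -d3; symmetry; apply: ccompA.
- by rewrite d1; apply: tgtS_composable.
- by rewrite d2; apply: F_chain (comp_chain CK).
- rewrite /d; elim: (s) => //= Phi s' IH; constructor=> //.
  by exists (T $v (vt_map (tc_vsrc Phi))), (T $v (vt_map (tc_vtgt Phi))); apply: tgtS_comp.
Qed.

Lemma comp_path_composable : composable (ccomp psi phis) (al_str (vt_dom f)) (flatten (map srcP s)) (al_str (vt_dom g)).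
Proof.
have [e1 e2 e3 e4] := ccomp_cell CK; split.
- case: (s) (comp_nonnil C) => //= Phi s' _; rewrite /srcP; by case: (tc_hsrc Phi).
- exact: srcP_chain (comp_chain C).
- by rewrite e1 srcP_htgts.
- rewrite e3 vdom_comp; last by rewrite (comp_ver CK).
  by bnd.
Qed.
Lemma W_comp : ccomp (ccomp psi phis) (str_path (vt_dom f) (hsrcs (G := TG) s)) = ccomp psi (map cellW s).
Proof.
have X := comp_path_composable; rewrite -srcXE in X.
rewrite -(str_of_path X (srcX_left s)) srcXE.
pose d := map (fun Phi => (tc_cell Phi, srcP Phi)) s.
have d1 : map fst d = phis by rewrite /d -map_comp.
have d2 : flatten (map snd d) = flatten (map srcP s) by rewrite /d -map_comp.
have d3 : map (fun p => ccomp p.1 p.2) d = map cellW s by rewrite /d -map_comp.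
rewrite -d1 -d2 -d3; symmetry; apply: ccompA.
- by rewrite d1; apply: CK.
- by rewrite d2; apply: srcP_chain (comp_chain C).
- by rewrite /d; elim: (s) => //= Phi s' IH; constructor=> //; eexists; eexists; apply: srcP_comp.
Qed.

Lemma Z_comp : ccomp (tgtS Psi) [:: T $c (ccomp psi phis)] = ccomp (cellZ Psi) (map (Fc T) phis).
Proof. by rewrite (F_ccomp T CK) (ccomp_ccomp1 (tgtS_comp Psi) (F_composable T CK)). Qed.
End Closure.

Lemma vt_cell_cell (f : vTmor T w) : is_vcell (vt_cell f)
  (if w is Colax then vt_map f ∘ al_str (vt_dom f) else al_str (vt_cod f) ∘ T $v (vt_map f))
  (if w is Colax then al_str (vt_cod f) ∘ T $v (vt_map f) else vt_map f ∘ al_str (vt_dom f)).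
Proof. by have := w_morphism_cell (vt_ok f). Qed.
End Cells.

Lemma swap_cells (psi : cell K) h k s1 s2 (x y x' y' : cell K) Js Hs Js' Hs' o f g g' l (ox : option (hmor K)) oy ox' oy' :
  composable psi h (s1 ++ x :: y :: s2) k ->
  is_cell x Js ox f g -> is_cell y Hs oy g l -> is_cell x' Js' ox' f g' -> is_cell y' Hs' oy' g' l ->
  o1 ox oy -> o1 ox' oy' -> ocat ox oy = o -> ocat ox' oy' = o -> x ⊙ y = x' ⊙ y' ->
  composable psi h (s1 ++ x' :: y' :: s2) k /\ ccomp psi (s1 ++ x :: y :: s2) = ccomp psi (s1 ++ x' :: y' :: s2).
Proof.
move=> C Hx Hy Hx' Hy' q q' eo eo' e.
have C' : composable psi h (s1 ++ x' :: y' :: s2) k.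
  case: (C) => n c eh v; split=> //; first by case: (s1).
    case/linked_cat: c => u c1 [e1 [e2 c2]]; apply/linked_cat; exists u => //.
    split; first by rewrite -e1 (cell_vsrc Hx) (cell_vsrc Hx').
    split; first by rewrite (cell_vtgt Hx') (cell_vsrc Hy').
    by rewrite (cell_vtgt Hy') -(cell_vtgt Hy).
  rewrite eh !htgts_cat; congr (_ ++ _); rewrite /htgts /= (cell_htgt Hx) (cell_htgt Hy) (cell_htgt Hx') (cell_htgt Hy').
  move: eo'; rewrite -{}eo => {e Hx Hy Hx' Hy'}.
  case: ox oy ox' oy' q q' => [?|] [?|] [?|] [?|] //= [] // _ [] //= _ => [] [->] //.
split=> //.
have [|_ <-] := ccomp_hpaste C; first by rewrite (cell_htgt Hx) (cell_htgt Hy).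
have [|_ <-] := ccomp_hpaste C'; first by rewrite (cell_htgt Hx') (cell_htgt Hy').
by rewrite e.
Qed.
End TCells.

Section TCellComp.
Variables (K : avdc) (T : monad K) (w : weakness).
Local Notation TG := (TAlg_graph T w).

Lemma lax_vt_cell (f : vTmor T w) : w <> Colax ->
  is_vcell (vt_cell f) (al_str (vt_cod f) ∘ T $v (vt_map f)) (vt_map f ∘ al_str (vt_dom f)).
Proof. by case: w f => f n; have := vt_cell_cell f. Qed.
Lemma colax_vt_cell (f : vTmor T w) : w = Colax ->
  is_vcell (vt_cell f) (vt_map f ∘ al_str (vt_dom f)) (al_str (vt_cod f) ∘ T $v (vt_map f)).
Proof. by case: w f => f n //; have := vt_cell_cell f. Qed.
Lemma lax_tc_eq (Phi : Tcell T w) : w <> Colax ->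
  cellZ Phi ⊙ vt_cell (tc_vtgt Phi) = vt_cell (tc_vsrc Phi) ⊙ cellW Phi.
Proof. by case: w Phi => Phi n //; have := tc_eq Phi. Qed.
Lemma colax_tc_eq (Phi : Tcell T w) : w = Colax ->
  vt_cell (tc_vsrc Phi) ⊙ cellZ Phi = cellW Phi ⊙ vt_cell (tc_vtgt Phi).
Proof. by case: w Phi => Phi n //; have := tc_eq Phi. Qed.

Lemma slide_lax psi (f g : vTmor T w) s s1 h k : w <> Colax -> chain (G := TG) f s g ->
  composable (G := K) psi h (s1 ++ map (@cellZ K T w) s ++ [:: vt_cell g]) k ->
  composable psi h (s1 ++ vt_cell f :: map (@cellW K T w) s) k /\
  ccomp psi (s1 ++ map (@cellZ K T w) s ++ [:: vt_cell g]) = ccomp psi (s1 ++ vt_cell f :: map (@cellW K T w) s).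
Proof.
move=> n; elim: s f s1 => [|Phi s IH] f s1 /=; first by move=> ->.
case=> <- c; rewrite -cat_rcons => C; have [C' ->] := IH _ _ c C.
rewrite cat_rcons in C' *.
have HZ := cellZ_cell Phi; have HW := cellW_cell Phi.
apply: (swap_cells (o := htgt (tc_cell Phi)) C' HZ (lax_vt_cell _ n) (lax_vt_cell _ n) HW); [by right|by left| | |exact: lax_tc_eq].
- by case: (htgt _).
- by [].
Qed.

Lemma slide_colax psi (f g : vTmor T w) s s1 h k : w = Colax -> chain (G := TG) f s g ->
  composable (G := K) psi h (s1 ++ vt_cell f :: map (@cellZ K T w) s) k ->
  composable psi h (s1 ++ map (@cellW K T w) s ++ [:: vt_cell g]) k /\
  ccomp psi (s1 ++ vt_cell f :: map (@cellZ K T w) s) = ccomp psi (s1 ++ map (@cellW K T w) s ++ [:: vt_cell g]).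
Proof.
move=> n; elim: s f s1 => [|Phi s IH] f s1 /=; first by move=> ->.
case=> <- c C.
have HZ := cellZ_cell Phi; have HW := cellW_cell Phi.
have [||||C' ->] := swap_cells (o := htgt (tc_cell Phi)) C (colax_vt_cell _ n) HZ HW (colax_vt_cell _ n) _ _ _ _ (colax_tc_eq _ n).
- by left.
- by right.
- by [].
- by case: (htgt _).
by rewrite -cat_rcons in C' *; have [C'' ->] := IH _ _ c C'; rewrite cat_rcons in C'' *.
Qed.

Section Closure.
Variables (Psi : Tcell T w) (f g : vTmor T w) (s : seq (Tcell T w)).
Hypothesis C : composable (G := TG) Psi f s g.
Local Notation psi := (tc_cell Psi).
Local Notation phis := (map (@tc_cell K T w) s).
Local Notation f' := (tc_vsrc Psi).
Local Notation g' := (tc_vtgt Psi).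
Let CK := tc_composable C.
Let ef : vt_cod f = vt_dom f' := comp_ver C.
Let eg : vt_cod g = vt_dom g' := TG_comp_ver_tgt C.
Let Hpsi := tc_is_cell Psi.

Lemma Tcell_closed_lax : w <> Colax ->
  ccomp (tgtS Psi) [:: T $c (ccomp psi phis)] ⊙ comp_str T w (vt_map g) (vt_map g') (vt_cell g) (vt_cell g')
  = comp_str T w (vt_map f) (vt_map f') (vt_cell f) (vt_cell f')
    ⊙ ccomp (ccomp psi phis) (str_path (vt_dom f) (hsrcs (G := TG) s)).
Proof.
move=> n.
have E u v a b : comp_str T w u v a b = (b ▷ T $v u) ⊙ (v ◁ a) by rewrite /comp_str; case: (w) n.
rewrite !E (Z_comp C) (W_comp C).
have Hf := lax_vt_cell f n; have Hg := lax_vt_cell g n; have Hf' := lax_vt_cell f' n; have Hg' := lax_vt_cell g' n.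
have Hpsi' : is_cell psi (hsrc psi) (htgt psi) (vt_map f') (vt_map g').
  by rewrite (cell_hsrc Hpsi) (cell_htgt Hpsi).
have CZ := Tphis_compZ C. have CW := Tphis_comp C.
have HZ := ccomp_cell CZ. have HWT := ccomp_cell CW.
have HZl := ccomp_cell (cellZ_list C). have HWl := ccomp_cell (cellW_list C).
have cg : vcod (T $v (vt_map g)) = vdom (al_str (vt_cod g') ∘ T $v (vt_map g')) by bnd; rewrite eg.
have cf : vcod (T $v (vt_map f)) = vdom (al_str (vt_cod f') ∘ T $v (vt_map f')) by bnd; rewrite ef.
have cg2 : vcod (al_str (vt_cod g) ∘ T $v (vt_map g)) = vdom (vt_map g') by bnd; rewrite eg.
have cf2 : vcod (al_str (vt_cod f) ∘ T $v (vt_map f)) = vdom (vt_map f') by bnd; rewrite ef.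
have G1 := rwhisk_cell Hg' cg. have F1 := rwhisk_cell Hf' cf.
have G2 := lwhisk_cell Hg cg2. have F2 := lwhisk_cell Hf cf2.
have Ag : vt_map g' ∘ al_str (vt_dom g') ∘ T $v (vt_map g) = vt_map g' ∘ (al_str (vt_cod g) ∘ T $v (vt_map g)).
  by rewrite eg vcompA //; bnd; rewrite eg.
have Af : vt_map f' ∘ al_str (vt_dom f') ∘ T $v (vt_map f) = vt_map f' ∘ (al_str (vt_cod f) ∘ T $v (vt_map f)).
  by rewrite ef vcompA //; bnd; rewrite ef.
rewrite Ag in G1; rewrite Af in F1.
rewrite (cell_vtgt (cellZ_cell Psi)) in HZ.
rewrite -(hpasteA HZ G1 G2); [|by right|by right|by left].
have -> : ccomp (cellZ Psi) (map (Fc T) phis) ⊙ (vt_cell g' ▷ T $v (vt_map g))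
   = (vt_cell f' ▷ T $v (vt_map f)) ⊙ ccomp (cellW Psi) (map (Fc T) phis).
  have X1 : is_cell (cellZ Psi ⊙ vt_cell g') (map (Fh T) (hsrc psi)) (htgt psi) (al_str (vt_cod f') ∘ T $v (vt_map f')) (vt_map g' ∘ al_str (vt_dom g')).
    have := hpaste_cell (cellZ_cell Psi) Hg'; rewrite cats0 /ocat; case: (htgt psi) => [?|]; apply; by right.
  have C1 : composable (cellZ Psi ⊙ vt_cell g') (T $v (vt_map f)) (map (Fc T) phis) (T $v (vt_map g)).
    case: (F_composable T CK) => m c e v; split=> //; first by rewrite (cell_hsrc X1) -F_hsrc.
    by rewrite (cell_vsrc X1).
  rewrite (ccomp_pair CZ (rwhisk_comp Hg' cg)); first last.
  - by right; apply: cell_htgt Hg'.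
  - by rewrite (cell_vtgt (cellZ_cell Psi)) (cell_vsrc Hg').
  have [|_] := @ccomp_insert K _ (map (Fc T) phis) [::] _ _ (T $v (vt_map g)) (eq_rect_r (fun l => composable _ _ l _) C1 (cats0 _)); first exact: comp_chain C1.
  rewrite cats0 => ->.
  rewrite (ccomp_pair (rwhisk_comp Hf' cf) CW); first last.
  - by left; apply: cell_htgt Hf'.
  - by rewrite (cell_vtgt Hf') (cell_vsrc (cellW_cell Psi)).
  rewrite (lax_tc_eq Psi n) in C1 *.
  by have [|_] := @ccomp_insert K _ [::] (map (Fc T) phis) _ _ (T $v (vt_map f)) C1; first by [].
rewrite (W_Tphis C).
rewrite (cell_vsrc Hpsi) (cell_vtgt Hpsi) in HZl HWl.
rewrite (hpasteA F1 HZl G2); [|by left|by left|by right].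
rewrite (hpasteA F1 F2 HWl); [|by left|by left|by left].
congr (_ ⊙ _).
have Cg := lwhisk_comp Hg cg2. have Cf := lwhisk_comp Hf cf2.
rewrite (ccomp_pair (cellZ_list C) Cg); first last.
- by right; rewrite idE.
- by rewrite idE (cell_vtgt Hpsi).
rewrite (ccomp_pair Cf (cellW_list C)); first last.
- by left; rewrite idE.
- by rewrite idE (cell_vsrc Hpsi).
rewrite hpasteE1 ?(cell_vtgt Hpsi) // hpaste1E ?(cell_vsrc Hpsi) //.
have CC : composable psi (al_str (vt_cod f) ∘ T $v (vt_map f)) (map (@cellZ K T w) s ++ [:: vt_cell g]) (vt_map g ∘ al_str (vt_dom g)).
  case: (cellZ_list C) => m c e v; split=> //; first by case: (s).
    by apply/linked_cat; eexists; first exact: c; split; [apply: cell_vsrc Hg|apply: cell_vtgt Hg].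
  by rewrite e htgts_cat /htgts /= (cell_htgt Hg) /= cats0.
by have [_] := slide_lax (s1 := [::]) n (comp_chain C) CC.
Qed.

Lemma Tcell_closed_colax : w = Colax ->
  comp_str T w (vt_map f) (vt_map f') (vt_cell f) (vt_cell f') ⊙ ccomp (tgtS Psi) [:: T $c (ccomp psi phis)]
  = ccomp (ccomp psi phis) (str_path (vt_dom f) (hsrcs (G := TG) s))
    ⊙ comp_str T w (vt_map g) (vt_map g') (vt_cell g) (vt_cell g').
Proof.
move=> n.
have E u v a b : comp_str T w u v a b = (v ◁ a) ⊙ (b ▷ T $v u) by rewrite /comp_str; case: (w) n.
rewrite !E (Z_comp C) (W_comp C).
have Hf := colax_vt_cell f n; have Hg := colax_vt_cell g n; have Hf' := colax_vt_cell f' n; have Hg' := colax_vt_cell g' n.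
have CZ := Tphis_compZ C. have CW := Tphis_comp C.
have HZ := ccomp_cell CZ. have HWT := ccomp_cell CW.
have HZl := ccomp_cell (cellZ_list C). have HWl := ccomp_cell (cellW_list C).
have cg : vcod (T $v (vt_map g)) = vdom (vt_map g' ∘ al_str (vt_dom g')) by bnd; rewrite eg.
have cf : vcod (T $v (vt_map f)) = vdom (vt_map f' ∘ al_str (vt_dom f')) by bnd; rewrite ef.
have cg2 : vcod (vt_map g ∘ al_str (vt_dom g)) = vdom (vt_map g') by bnd; rewrite eg.
have cf2 : vcod (vt_map f ∘ al_str (vt_dom f)) = vdom (vt_map f') by bnd; rewrite ef.
have G1 := rwhisk_cell Hg' cg. have F1 := rwhisk_cell Hf' cf.
have G2 := lwhisk_cell Hg cg2. have F2 := lwhisk_cell Hf cf2.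
have Ag : vt_map g' ∘ al_str (vt_dom g') ∘ T $v (vt_map g) = vt_map g' ∘ (al_str (vt_cod g) ∘ T $v (vt_map g)).
  by rewrite eg vcompA //; bnd; rewrite eg.
have Af : vt_map f' ∘ al_str (vt_dom f') ∘ T $v (vt_map f) = vt_map f' ∘ (al_str (vt_cod f) ∘ T $v (vt_map f)).
  by rewrite ef vcompA //; bnd; rewrite ef.
rewrite Ag in G1; rewrite Af in F1.
rewrite (cell_vsrc (cellZ_cell Psi)) in HZ.
rewrite (hpasteA F2 F1 HZ); [|by left|by left|by left].
have -> : (vt_cell f' ▷ T $v (vt_map f)) ⊙ ccomp (cellZ Psi) (map (Fc T) phis)
   = ccomp (cellW Psi) (map (Fc T) phis) ⊙ (vt_cell g' ▷ T $v (vt_map g)).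
  have X1 : is_cell (vt_cell f' ⊙ cellZ Psi) (map (Fh T) (hsrc psi)) (htgt psi) (vt_map f' ∘ al_str (vt_dom f')) (al_str (vt_cod g') ∘ T $v (vt_map g')).
    by apply: (hpaste_cell Hf' (cellZ_cell Psi)); left.
  have C1 : composable (vt_cell f' ⊙ cellZ Psi) (T $v (vt_map f)) (map (Fc T) phis) (T $v (vt_map g)).
    case: (F_composable T CK) => m c e v; split=> //; first by rewrite (cell_hsrc X1) -F_hsrc.
    by rewrite (cell_vsrc X1).
  rewrite (ccomp_pair (rwhisk_comp Hf' cf) CZ); first last.
  - by left; apply: cell_htgt Hf'.
  - by rewrite (cell_vtgt Hf') (cell_vsrc (cellZ_cell Psi)).
  have [|_ ->] := @ccomp_insert K _ [::] (map (Fc T) phis) _ _ (T $v (vt_map f)) C1; first by [].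
  rewrite (ccomp_pair CW (rwhisk_comp Hg' cg)); first last.
  - by right; apply: cell_htgt Hg'.
  - by rewrite (cell_vtgt (cellW_cell Psi)) (cell_vsrc Hg').
  rewrite (colax_tc_eq Psi n) in C1 *.
  have [|_] := @ccomp_insert K _ (map (Fc T) phis) [::] _ _ (T $v (vt_map g)) (eq_rect_r (fun l => composable _ _ l _) C1 (cats0 _)); first exact: comp_chain C1.
  by rewrite cats0 => ->.
rewrite (W_Tphis C).
rewrite (cell_vsrc Hpsi) (cell_vtgt Hpsi) in HZl HWl.
rewrite -(hpasteA F2 HZl G1); [|by left|by left|by right].
rewrite -(hpasteA HWl G2 G1); [|by right|by right|by left].
congr (_ ⊙ _).
have Cg := lwhisk_comp Hg cg2. have Cf := lwhisk_comp Hf cf2.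
rewrite (ccomp_pair Cf (cellZ_list C)); first last.
- by left; rewrite idE.
- by rewrite idE (cell_vsrc Hpsi).
rewrite (ccomp_pair (cellW_list C) Cg); first last.
- by right; rewrite idE.
- by rewrite idE (cell_vtgt Hpsi).
rewrite hpasteE1 ?(cell_vtgt Hpsi) // hpaste1E ?(cell_vsrc Hpsi) //.
have CC : composable psi (vt_map f ∘ al_str (vt_dom f)) (vt_cell f :: map (@cellZ K T w) s) (al_str (vt_cod g) ∘ T $v (vt_map g)).
  case: (cellZ_list C) => m c e v; split=> //; last by rewrite (cell_vsrc Hpsi).
    by split; [apply: cell_vsrc Hf|rewrite (cell_vtgt Hf)].
  by rewrite e /htgts /= (cell_htgt Hf).
by have [_] := slide_colax (s1 := [::]) n (comp_chain C) CC.
Qed.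
End Closure.
End TCellComp.

Section TAlg.
Variables (K : avdc) (T : monad K) (w : weakness).
Local Notation TG := (TAlg_graph T w).

Definition vTid (A : colax_algebra T) : vTmor T w :=
  VTmor (vdom_id (al_ob A)) (vcod_id (al_ob A)) (w_morphism_id w A).

Section VComp.
Variables (g f : vTmor T w) (e : vt_cod f = vt_dom g).
Lemma vTcomp_cond : vcod (vt_map f) = vdom (vt_map g).
Proof. by rewrite vt_map_cod vt_map_dom e. Qed.
Lemma vTcomp_dom : vdom (vt_map g ∘ vt_map f) = al_ob (vt_dom f).
Proof. by rewrite (vdom_comp vTcomp_cond) vt_map_dom. Qed.
Lemma vTcomp_cod : vcod (vt_map g ∘ vt_map f) = al_ob (vt_cod g).
Proof. by rewrite (vcod_comp vTcomp_cond) vt_map_cod. Qed.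
Lemma vTcomp_ok : w_morphism w (vt_dom f) (vt_cod g) (vt_map g ∘ vt_map f)
  (comp_str T w (vt_map f) (vt_map g) (vt_cell f) (vt_cell g)).
Proof.
have ok := vt_ok g; rewrite -e in ok.
apply: (w_morphism_comp _ _ _ _ (vt_ok f) ok); rewrite ?vt_map_dom ?vt_map_cod //.
by rewrite e.
Qed.
Definition vTcomp_of : vTmor T w := VTmor vTcomp_dom vTcomp_cod vTcomp_ok.
End VComp.

Definition vTcomp (g f : vTmor T w) : vTmor T w :=
  if excluded_middle_informative (vt_cod f = vt_dom g) is left e then vTcomp_of e else g.

Lemma vTcompE g f (e : vt_cod f = vt_dom g) : vTcomp g f = vTcomp_of e.
Proof.
rewrite /vTcomp; case: excluded_middle_informative => // e'.
by rewrite (proof_irrelevance _ e e').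
Qed.

Definition hTidc (J : hTmor T) : Tcell T w.
Proof.
apply: (@TCell K T w [:: J] (Some J) (vTid (ht_dom J)) (vTid (ht_cod J)) (hidc (ht_map J))) => //.
- by have := hidc_cell (ht_map J); rewrite ht_map_dom ht_map_cod.
- have HJ := ht_str_cell J.
  have E1 : ccomp (ht_cell J) [:: T $c (hidc (ht_map J))] = ht_cell J.
    by rewrite F_hidc -[X in ccomp _ X]/(map hidc [:: T $h (ht_map J)]) -(cell_hsrc HJ) ccomph1 // (cell_hsrc HJ).
  have E2 : ccomp (hidc (ht_map J)) [:: ht_cell J] = ht_cell J by rewrite (ccomp1h (cell_htgt HJ)).
  rewrite /Tcell_eq /lax_Tcell_eq /colax_Tcell_eq /= E1 E2 hpasteE1 ?hpaste1E ?(cell_vsrc HJ) ?(cell_vtgt HJ) //.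
  by case: w.
Defined.

Definition vTidc (f : vTmor T w) : Tcell T w.
Proof.
apply: (@TCell K T w [::] None f f (vidc (vt_map f))) => //.
- exact: vidc_cell.
- have H := vt_cell_cell f; have e1 : vcod (T $v (vt_map f)) = vdom (al_str (vt_cod f)) by bnd.
  have e2 : vcod (al_str (vt_dom f)) = vdom (vt_map f) by bnd.
  rewrite /Tcell_eq /lax_Tcell_eq /colax_Tcell_eq /= F_vidc (ccomp_vidc e1) (ccomp_vidc e2).
  case: w f H {e1 e2} => f H; first by rewrite hpasteE1 ?hpaste1E ?(cell_vsrc H) ?(cell_vtgt H).
  + by rewrite hpasteE1 ?hpaste1E ?(cell_vsrc H) ?(cell_vtgt H).
  + by rewrite hpasteE1 ?hpaste1E ?(cell_vsrc H) ?(cell_vtgt H).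
Defined.

Section CComp.
Variables (Psi : Tcell T w) (f : vTmor T w) (s : seq (Tcell T w)) (g : vTmor T w).
Hypothesis C : composable (G := TG) Psi f s g.
Definition Tccomp_of : Tcell T w.
Proof.
apply: (@TCell K T w (hsrcs (G := TG) s) (tc_htgt Psi) (vTcomp_of (comp_ver C)) (vTcomp_of (TG_comp_ver_tgt C))
  (ccomp (tc_cell Psi) (map (@tc_cell K T w) s))).
- exact: TG_hsrcs_path (comp_chain C).
- exact: tc_tgt_path.
- have [e1 e2 e3 e4] := ccomp_cell (tc_composable C); have H := tc_is_cell Psi.
  by split; rewrite ?e1 ?e2 ?e3 ?e4 ?tc_hsrcs ?(cell_htgt H) ?(cell_vsrc H) ?(cell_vtgt H).
- rewrite /Tcell_eq; case Ew: {1}w; [apply: (Tcell_closed_colax C)|apply: (Tcell_closed_lax C)|apply: (Tcell_closed_lax C)] => //; by rewrite Ew.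
Defined.
End CComp.
End TAlg.

(* A graph G with operations typed as in an avdc, and with a map to an avdc K that
   preserves them and is injective on cells with given boundary, is itself an avdc. *)
Section Lift.
Variables (K : avdc) (G : avdc_graph).
Variables (uo : ob G -> ob K) (uv : vmor G -> vmor K) (uh : hmor G -> hmor K) (uc : cell G -> cell K).
Variables (gid : ob G -> vmor G) (gcomp : vmor G -> vmor G -> vmor G)
  (ghid : hmor G -> cell G) (gvid : vmor G -> cell G) (gcc : cell G -> seq (cell G) -> cell G).
Hypothesis gdom_id : forall A, vdom (gid A) = A.
Hypothesis gcod_id : forall A, vcod (gid A) = A.
Hypothesis gdom_comp : forall g f, vcod f = vdom g -> vdom (gcomp g f) = vdom f.
Hypothesis gcod_comp : forall g f, vcod f = vdom g -> vcod (gcomp g f) = vcod g.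
Hypothesis gcompA : forall h g f, vcod f = vdom g -> vcod g = vdom h ->
  gcomp h (gcomp g f) = gcomp (gcomp h g) f.
Hypothesis gcomp1f : forall f, gcomp (gid (vcod f)) f = f.
Hypothesis gcompf1 : forall f, gcomp f (gid (vdom f)) = f.
Hypothesis ghsrc_path : forall phi : cell G, hpath (vdom (vsrc phi)) (hsrc phi) (vdom (vtgt phi)).
Hypothesis ghtgt_path : forall phi : cell G, hpath (vcod (vsrc phi)) (oseq (htgt phi)) (vcod (vtgt phi)).
Hypothesis ghid_cell : forall J, is_cell (ghid J) [:: J] (Some J) (gid (hdom J)) (gid (hcod J)).
Hypothesis gvid_cell : forall f, is_vcell (gvid f) f f.
Hypothesis gcc_cell : forall psi f phis g, composable psi f phis g ->
  is_cell (gcc psi phis) (hsrcs phis) (htgt psi) (gcomp (vsrc psi) f) (gcomp (vtgt psi) g).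
Hypothesis u_dom : forall f, vdom (uv f) = uo (vdom f).
Hypothesis u_cod : forall f, vcod (uv f) = uo (vcod f).
Hypothesis u_comp : forall g f, vcod f = vdom g -> uv (gcomp g f) = uv g ∘ uv f.
Hypothesis u_hdom : forall J, hdom (uh J) = uo (hdom J).
Hypothesis u_hcod : forall J, hcod (uh J) = uo (hcod J).
Hypothesis u_id : forall A, uv (gid A) = vid (uo A).
Hypothesis u_cell : forall phi, is_cell (uc phi) (map uh (hsrc phi)) (omap uh (htgt phi)) (uv (vsrc phi)) (uv (vtgt phi)).
Hypothesis u_hid : forall J, uc (ghid J) = hidc (uh J).
Hypothesis u_vid : forall f, uc (gvid f) = vidc (uv f).
Hypothesis u_cc : forall psi f phis g, composable psi f phis g ->
  uc (gcc psi phis) = ccomp (uc psi) (map uc phis).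
Hypothesis u_ext : forall phi psi : cell G, hsrc phi = hsrc psi -> htgt phi = htgt psi ->
  vsrc phi = vsrc psi -> vtgt phi = vtgt psi -> uc phi = uc psi -> phi = psi.

Implicit Types (phi psi chi : cell G) (f g h k : vmor G) (s : seq (cell G)).
Lemma lift_chain f s g : chain f s g -> chain (uv f) (map uc s) (uv g).
Proof.
elim: s f => [|phi s IH] f /=; first by move=> ->.
by case=> <- /IH H; split; rewrite ?(cell_vsrc (u_cell phi)) ?(cell_vtgt (u_cell phi)).
Qed.
Lemma lift_htgts s : htgts (map uc s) = map uh (htgts s).
Proof. by elim: s => //= phi s; rewrite /htgts /= (cell_htgt (u_cell phi)) => ->; case: (htgt phi). Qed.
Lemma lift_composable psi f s g : composable psi f s g -> composable (uc psi) (uv f) (map uc s) (uv g).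
Proof.
case=> n c e v; split; [by case: (s) n|exact: lift_chain| |].
  by rewrite lift_htgts (cell_hsrc (u_cell psi)) e.
by rewrite (cell_vsrc (u_cell psi)) u_cod u_dom v.
Qed.
Lemma lift_htgts_path f s g : chain f s g -> hpath (vcod f) (htgts s) (vcod g).
Proof.
elim: s f => [|phi s IH] f /=; first by move=> ->.
case=> <- /IH; have := ghtgt_path phi; rewrite /htgts /=; case: (htgt phi) => [J|] /=.
  by case=> e1 e2 H; split=> //; rewrite e2.
by move=> ->.
Qed.
Lemma lift_ver_tgt psi f s g : composable psi f s g -> vcod g = vdom (vtgt psi).
Proof.
case=> _ /lift_htgts_path H E V; have := ghsrc_path psi; rewrite E -V => H'.
exact: linked_uniq H H'.
Qed.
Lemma lift_eq phi psi Js o f g : is_cell phi Js o f g -> is_cell psi Js o f g -> uc phi = uc psi -> phi = psi.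
Proof. by case=> <- <- <- <- [e1 e2 e3 e4]; apply: u_ext. Qed.


Lemma lift_vidc h f : vcod f = vdom h -> gcc (gvid h) [:: gvid f] = gvid (gcomp h f).
Proof.
have [a1 a2 a3 a4] := gvid_cell h; have [b1 b2 b3 b4] := gvid_cell f => e.
have C : composable (gvid h) f [:: gvid f] f.
  by split; rewrite ?a1 ?a3 // /htgts /= b2.
apply: lift_eq (gvid_cell _) _.
  by have := gcc_cell C; rewrite a2 a3 a4 /hsrcs /= b1.
by rewrite (u_cc C) !u_vid /= u_vid ccomp_vidc ?u_comp // u_cod u_dom e.
Qed.

Lemma lift_A1 chi (d : seq (cell G * seq (cell G))) h k f g :
  composable chi h (map fst d) k -> chain f (flatten (map snd d)) g ->
  List.Forall (fun p => exists f' g', composable p.1 f' p.2 g') d ->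
  composable chi (gcomp h f) (map (fun p => gcc p.1 p.2) d) (gcomp k g) /\
  composable (gcc chi (map fst d)) f (flatten (map snd d)) g.
Proof.
move=> C c F.
have [n c1 e v] := C; have Ht := lift_ver_tgt C.
have P : forall f h, vcod f = vdom h -> chain h (map fst d) k -> chain f (flatten (map snd d)) g ->
  [/\ chain (gcomp h f) (map (fun p => gcc p.1 p.2) d) (gcomp k g),
    vcod g = vdom k, htgts (map (fun p => gcc p.1 p.2) d) = htgts (map fst d) &
    hsrcs (map fst d) = htgts (flatten (map snd d)) /\
    hsrcs (map (fun p => gcc p.1 p.2) d) = hsrcs (flatten (map snd d))].
  elim: {C n c c1 e} d F => [|[p s] d IH] F f1 h1 e1 /=; first by move=> <- <-.
  move/List.Forall_cons_iff: F => [[x [y /= Cp]] Fd] [<- c2] /linked_cat [z c3 c4].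
  have [ex ey] : x = f1 /\ y = z by case: Cp => m cc _ _; apply: (linked_src m cc c3).
  rewrite {}ex {}ey in Cp.
  have [q1 q2 q3 q4] := gcc_cell Cp.
  have [I1 I2 I3 [I4 I5]] := IH Fd z (vtgt p) (lift_ver_tgt Cp) c2 c4.
  split=> //.
  - by split; rewrite ?q3 ?q4.
  - by move: I3; rewrite /htgts /= q2 => ->.
  - rewrite htgts_cat hsrcs_cat; move: I4 I5; rewrite /hsrcs /= q1 => -> ->.
    by rewrite (comp_hor Cp).
have m : flatten (map snd d) <> [::].
  case: (d) n F => [//|[p s] d' _ /List.Forall_cons_iff [[x [y /= []]]]].
  by case: (s).
have cv : vcod f = vdom h.
  case: (d) n F c1 c => [//|[p s] d' _ /List.Forall_cons_iff [[x [y /= Cp]] _]] /= [<- _] /linked_cat [z c3 _].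
  by rewrite -(comp_ver Cp); case: Cp => m' cc _ _; have [-> _] := linked_src m' cc c3.
have [I1 I2 I3 [I4 I5]] := P _ _ cv c1 c.
have [q1 q2 q3 q4] := gcc_cell C.
split; split=> //.
- by case: (d) n.
- by rewrite e I3.
- by rewrite gcod_comp.
- by rewrite q1.
- by rewrite q3 gdom_comp.
Qed.

Lemma lift_A chi (d : seq (cell G * seq (cell G))) h k f g :
  composable chi h (map fst d) k -> chain f (flatten (map snd d)) g ->
  List.Forall (fun p => exists f' g', composable p.1 f' p.2 g') d ->
  gcc chi (map (fun p => gcc p.1 p.2) d) = gcc (gcc chi (map fst d)) (flatten (map snd d)).
Proof.
move=> C c F; have [C1 C2] := lift_A1 C c F.
have [a1 a2 a3 a4] := gcc_cell C; have [b1 b2 b3 b4] := gcc_cell C1; have [c1 c2 c3 c4] := gcc_cell C2.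
have cv : vcod f = vdom h by rewrite (comp_ver C2) a3 gdom_comp // (comp_ver C).
have cvg : vcod g = vdom k by rewrite (lift_ver_tgt C2) a4 gdom_comp // (lift_ver_tgt C).
apply: u_ext.
- rewrite b1 c1; elim: {C c C1 C2 a1 a2 a3 a4 b1 b2 b3 b4 c1 c2 c3 c4} d F => [//|[p s] d IH].
  case/List.Forall_cons_iff=> [[x [y /= Cp]] /IH].
  by rewrite hsrcs_cat /hsrcs /= => ->; have [-> _ _ _] := gcc_cell Cp.
- by rewrite b2 c2 a2.
- by rewrite b3 c3 a3 gcompA // (comp_ver C).
- by rewrite b4 c4 a4 gcompA // (lift_ver_tgt C).
rewrite (u_cc C1) (u_cc C2) (u_cc C).
have CK := lift_composable C.
pose dK := map (fun p => (uc p.1, map uc p.2)) d.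
have d1 : map uc (map fst d) = map fst dK by rewrite /dK -!map_comp.
have d2 : map uc (flatten (map snd d)) = flatten (map snd dK).
  by rewrite map_flatten /dK -!map_comp.
have d3 : map uc (map (fun p => gcc p.1 p.2) d) = map (fun p => ccomp p.1 p.2) dK.
  rewrite /dK; elim: {C c C1 C2 a1 a2 a3 a4 b1 b2 b3 b4 c1 c2 c3 c4 CK dK d1 d2} d F => [//|[p s] d IH].
  by case/List.Forall_cons_iff=> [[x [y /= Cp]] /IH /= ->]; rewrite (u_cc Cp).
rewrite d1 d2 d3; rewrite d1 in CK; apply: ccompA CK _ _.
- by rewrite -d2; apply: lift_chain c.
- rewrite /dK; elim: {C c C1 C2 a1 a2 a3 a4 b1 b2 b3 b4 c1 c2 c3 c4 dK d1 d2 d3} d F => [|[p s] d IH] /=; first by constructor.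
  case/List.Forall_cons_iff=> [[x [y /= Cp]] /IH H]; constructor=> //=.
  by exists (uv x), (uv y); apply: lift_composable.
Qed.

Lemma lift_1v phi : htgt phi = None -> gcc (gvid (gid (vcod (vsrc phi)))) [:: phi] = phi.
Proof.
move=> e; set i := gvid _; have [a1 a2 a3 a4] := gvid_cell (gid (vcod (vsrc phi))).
have C : composable i (vsrc phi) [:: phi] (vtgt phi).
  by split=> //; rewrite /i ?a1 ?a3 ?gdom_id // /htgts /= e.
have ev : vcod (vtgt phi) = vcod (vsrc phi) by have := ghtgt_path phi; rewrite e.
have [b1 b2 b3 b4] := gcc_cell C.
apply: u_ext; rewrite ?b1 ?b2 ?b3 ?b4 ?a2 ?a3 ?a4 ?gcomp1f //.
- by rewrite /hsrcs /= cats0.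
- by rewrite -ev gcomp1f.
rewrite (u_cc C) /i u_vid u_id -u_cod -(cell_vsrc (u_cell phi)) ccomp1v //.
by rewrite (cell_htgt (u_cell phi)) e.
Qed.

Lemma lift_1h phi J : htgt phi = Some J -> gcc (ghid J) [:: phi] = phi.
Proof.
move=> e; have [a1 a2 a3 a4] := ghid_cell J.
have [ev1 ev2] : hdom J = vcod (vsrc phi) /\ hcod J = vcod (vtgt phi) by have := ghtgt_path phi; rewrite e.
have C : composable (ghid J) (vsrc phi) [:: phi] (vtgt phi).
  by split=> //; rewrite ?a1 ?a3 ?gdom_id // /htgts /= e.
have [b1 b2 b3 b4] := gcc_cell C.
apply: u_ext; rewrite ?b1 ?b2 ?b3 ?b4 ?a2 ?a3 ?a4 ?ev1 ?ev2 ?gcomp1f //.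
- by rewrite /hsrcs /= cats0.
by rewrite (u_cc C) u_hid /= (ccomp1h (K := uh J)) // (cell_htgt (u_cell phi)) e.
Qed.

Lemma lift_v1 phi : hsrc phi = [::] -> gcc phi [:: gvid (gid (vdom (vsrc phi)))] = phi.
Proof.
move=> e; have [a1 a2 a3 a4] := gvid_cell (gid (vdom (vsrc phi))).
have ev : vdom (vsrc phi) = vdom (vtgt phi) by have := ghsrc_path phi; rewrite e.
have C : composable phi (gid (vdom (vsrc phi))) [:: gvid (gid (vdom (vsrc phi)))] (gid (vdom (vsrc phi))).
  by split=> //; rewrite ?gcod_id // e /htgts /= a2.
have [b1 b2 b3 b4] := gcc_cell C.
apply: u_ext; rewrite ?b1 ?b2 ?b3 ?b4 ?gcompf1 //.
- by rewrite /hsrcs /= a1 e.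
- by rewrite ev gcompf1.
rewrite (u_cc C) /= u_vid u_id -u_dom -(cell_vsrc (u_cell phi)) ccompv1 //.
by rewrite (cell_hsrc (u_cell phi)) e.
Qed.

Lemma lift_h1 phi : hsrc phi <> [::] -> gcc phi (map ghid (hsrc phi)) = phi.
Proof.
move=> n.
have P : forall A Js B, hpath A Js B -> [/\ chain (gid A) (map ghid Js) (gid B),
  htgts (map ghid Js) = Js, hsrcs (map ghid Js) = Js & map uc (map ghid Js) = map hidc (map uh Js)].
  move=> A Js B; elim: Js A => [|J Js IH] A /=; first by move=> ->.
  have [a1 a2 a3 a4] := ghid_cell J.
  case=> <- /IH [I1 I2 I3 I4]; split.
  - by split; rewrite ?a3 ?a4.
  - by rewrite /htgts /= a2 /= -/(htgts _) I2.
  - by rewrite /hsrcs /= a1 /= -/(hsrcs _) I3.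
  - by rewrite I4 u_hid.
have [P1 P2 P3 P4] := P _ _ _ (ghsrc_path phi).
have C : composable phi (gid (vdom (vsrc phi))) (map ghid (hsrc phi)) (gid (vdom (vtgt phi))).
  by split=> //; rewrite ?gcod_id //; case: (hsrc phi) n.
have [b1 b2 b3 b4] := gcc_cell C.
apply: u_ext; rewrite ?b1 ?b2 ?b3 ?b4 ?gcompf1 //.
rewrite (u_cc C) P4 -(cell_hsrc (u_cell phi)) ccomph1 // (cell_hsrc (u_cell phi)).
by case: (hsrc phi) n.
Qed.

Lemma lift_ins psi s1 s2 f g h :
  composable psi f (s1 ++ s2) g -> composable psi f (s1 ++ gvid h :: s2) g ->
  gcc psi (s1 ++ gvid h :: s2) = gcc psi (s1 ++ s2).
Proof.
move=> C1 C2; have [b1 b2 b3 b4] := gcc_cell C1; have [c1 c2 c3 c4] := gcc_cell C2.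
apply: u_ext; rewrite ?b1 ?b2 ?b3 ?b4 ?c1 ?c2 ?c3 ?c4 //.
  by rewrite !hsrcs_cat {2}/hsrcs /= (cell_hsrc (gvid_cell h)).
have CK1 := lift_composable C1; have CK2 := lift_composable C2.
rewrite (u_cc C1) (u_cc C2) !map_cat /= u_vid.
rewrite !map_cat /= u_vid in CK1 CK2.
exact: ccomp_ins CK1 CK2.
Qed.

Definition lift_avdc : avdc :=
  Avdc gdom_id gcod_id gdom_comp gcod_comp gcompA gcomp1f gcompf1 ghsrc_path ghtgt_path
    ghid_cell gvid_cell gcc_cell lift_vidc lift_A lift_1v lift_1h lift_v1 lift_h1 lift_ins.

Definition lift_forget : functor lift_avdc K :=
  @Functor lift_avdc K uo uv uh uc u_dom u_cod u_hdom u_hcod u_cell u_id u_comp u_hid u_vid u_cc.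
End Lift.

Section TAlg.
Variables (K : avdc) (T : monad K) (w : weakness).
Local Notation TG := (TAlg_graph T w).

Lemma vTmor_ext (f g : vTmor T w) : vt_dom f = vt_dom g -> vt_cod f = vt_cod g ->
  vt_map f = vt_map g -> vt_cell f = vt_cell g -> f = g.
Proof.
case: f => a b u c p1 p2 p3; case: g => a' b' u' c' q1 q2 q3 /= e1 e2 e3 e4; subst.
by rewrite (proof_irrelevance _ p1 q1) (proof_irrelevance _ p2 q2) (proof_irrelevance _ p3 q3).
Qed.

Lemma Tcell_ext (x y : cell TG) : hsrc x = hsrc y -> htgt x = htgt y -> vsrc x = vsrc y ->
  vtgt x = vtgt y -> tc_cell x = tc_cell y -> x = y.
Proof.
case: x => a b u v c p1 p2 p3 p4; case: y => a' b' u' v' c' q1 q2 q3 q4 /= e1 e2 e3 e4 e5; subst.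
by rewrite (proof_irrelevance _ p1 q1) (proof_irrelevance _ p2 q2) (proof_irrelevance _ p3 q3) (proof_irrelevance _ p4 q4).
Qed.

Definition Tccomp (Psi : Tcell T w) (s : seq (Tcell T w)) : Tcell T w :=
  if excluded_middle_informative
    (composable (G := TG) Psi (tc_vsrc (head Psi s)) s (tc_vtgt (last Psi s))) is left C
  then Tccomp_of C else Psi.

Lemma TccompE Psi (f g : vTmor T w) s (C : composable (G := TG) Psi f s g) : Tccomp Psi s = Tccomp_of C.
Proof.
have [ef eg] : f = tc_vsrc (head Psi s) /\ g = tc_vtgt (last Psi s).
  case: C => n c _ _; case: s n c => // Phi s _ [<- c]; split=> //=.
  by elim: s Phi c => [|Phi' s IH] Phi /=; [move=> ->|case=> _ /IH].
rewrite /Tccomp; case: excluded_middle_informative => [C'|[]]; last by rewrite -ef -eg.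
by subst; rewrite (proof_irrelevance _ C C').
Qed.

Lemma TAlg_vdom_comp (g f : vmor TG) : vcod f = vdom g -> vdom (vTcomp g f : vmor TG) = vdom f.
Proof. by move=> e; rewrite (vTcompE e). Qed.
Lemma TAlg_vcod_comp (g f : vmor TG) : vcod f = vdom g -> vcod (vTcomp g f : vmor TG) = vcod g.
Proof. by move=> e; rewrite (vTcompE e). Qed.
Lemma TAlg_map_comp (g f : vmor TG) : vcod f = vdom g -> vt_map (vTcomp g f) = vt_map g ∘ vt_map f.
Proof. by move=> e; rewrite (vTcompE e). Qed.
Lemma TAlg_vcompA (h g f : vmor TG) : vcod f = vdom g -> vcod g = vdom h ->
  vTcomp h (vTcomp g f) = vTcomp (vTcomp h g) f.
Proof.
move=> e1 e2.
have e3 : vt_cod (vTcomp g f) = vt_dom h by exact: (etrans (TAlg_vcod_comp e1) e2).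
have e4 : vt_cod f = vt_dom (vTcomp h g) by exact: (etrans e1 (esym (TAlg_vdom_comp e2))).
apply: vTmor_ext; rewrite ?(vTcompE e3) ?(vTcompE e4) /= ?(vTcompE e1) ?(vTcompE e2) //=.
  by rewrite vcompA // vt_map_cod vt_map_dom; congr al_ob.
have okg := vt_ok g; have okh := vt_ok h; rewrite -[vt_dom g]e1 in okg; rewrite -[vt_dom h]e2 in okh.
apply: (comp_strA _ _ _ _ _ _ (vt_ok f) okg okh); rewrite ?vt_map_cod ?vt_map_dom //; by congr al_ob.
Qed.
Lemma TAlg_vcomp1f (f : vmor TG) : vTcomp (vTid w (vcod f)) f = f.
Proof.
have e : vt_cod f = vt_dom (vTid w (vcod f : colax_algebra T)) by [].
rewrite (vTcompE e); apply: vTmor_ext => //=; first by rewrite vcomp1E // vt_map_cod.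
have H := vt_cell_cell f; rewrite /comp_str rwhisk_vidc; last by bnd.
case: w f H {e} => f H; rewrite (lwhisk_vid H) ?hpasteE1 ?hpaste1E ?(cell_vsrc H) ?(cell_vtgt H) //; bnd.
Qed.
Lemma TAlg_vcompf1 (f : vmor TG) : vTcomp f (vTid w (vdom f)) = f.
Proof.
have e : vt_cod (vTid w (vdom f : colax_algebra T)) = vt_dom f by [].
rewrite (vTcompE e); apply: vTmor_ext => //=; first by rewrite vcompE1 // vt_map_dom.
have H := vt_cell_cell f; rewrite /comp_str lwhisk_vidc; last by bnd.
case: w f H {e} => f H; rewrite (rwhisk_vid H) ?F_vid ?hpasteE1 ?hpaste1E ?(cell_vsrc H) ?(cell_vtgt H) //; bnd.
Qed.
Lemma TAlg_ccomp_cell (Psi : cell TG) f s g : composable Psi f s g ->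
  is_cell (Tccomp Psi s : cell TG) (hsrcs s) (htgt Psi) (vTcomp (vsrc Psi) f) (vTcomp (vtgt Psi) g).
Proof.
by move=> C; rewrite (TccompE C); split=> //=; rewrite (vTcompE (comp_ver C), vTcompE (TG_comp_ver_tgt C)).
Qed.
Lemma TAlg_cell_comp (Psi : cell TG) f s g : composable Psi f s g ->
  tc_cell (Tccomp Psi s) = ccomp (tc_cell Psi) (map (@tc_cell K T w) s).
Proof. by move=> C; rewrite (TccompE C). Qed.
Lemma TAlg_hidc_cell (J : hmor TG) : is_cell (hTidc w J : cell TG) [:: J] (Some J) (vTid w (hdom J)) (vTid w (hcod J)).
Proof. by []. Qed.
Lemma TAlg_vidc_cell (f : vmor TG) : is_vcell (vTidc f : cell TG) f f.
Proof. by []. Qed.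


Definition TAlg : avdc :=
  @lift_avdc K TG (@al_ob K T) (@vt_map K T w) (@ht_map K T) (@tc_cell K T w)
    (@vTid K T w) (@vTcomp K T w) (@hTidc K T w) (@vTidc K T w) Tccomp
    (fun _ => erefl) (fun _ => erefl) TAlg_vdom_comp TAlg_vcod_comp
    TAlg_vcompA TAlg_vcomp1f TAlg_vcompf1 (@tc_src_path K T w) (@tc_tgt_path K T w)
    TAlg_hidc_cell TAlg_vidc_cell TAlg_ccomp_cell
    (@vt_map_dom K T w) (@vt_map_cod K T w) TAlg_map_comp (fun _ => erefl)
    (@tc_is_cell K T w) (fun _ => erefl) (fun _ => erefl) TAlg_cell_comp Tcell_ext.

Definition TAlg_forget : functor TAlg K :=
  @lift_forget K TG (@al_ob K T) (@vt_map K T w) (@ht_map K T) (@tc_cell K T w)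
    (@vTid K T w) (@vTcomp K T w) (@hTidc K T w) (@vTidc K T w) Tccomp
    (fun _ => erefl) (fun _ => erefl) TAlg_vdom_comp TAlg_vcod_comp
    TAlg_vcompA TAlg_vcomp1f TAlg_vcompf1 (@tc_src_path K T w) (@tc_tgt_path K T w)
    TAlg_hidc_cell TAlg_vidc_cell TAlg_ccomp_cell
    (@vt_map_dom K T w) (@vt_map_cod K T w) TAlg_map_comp
    (@ht_map_dom K T) (@ht_map_cod K T) (fun _ => erefl)
    (@tc_is_cell K T w) (fun _ => erefl) (fun _ => erefl) TAlg_cell_comp Tcell_ext.
End TAlg.

(* The restriction of K to the horizontal morphisms satisfying P, with all cells
   between them. *)
Section FullSub.
Variables (K : avdc) (P : hmor K -> Prop).

Definition sub_hmor := {J : hmor K | P J}.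
Record sub_cell := SubCell {
  sc_hsrc : seq sub_hmor; sc_htgt : option sub_hmor;
  sc_cell : cell K;
  sc_hsrcE : hsrc sc_cell = map sval sc_hsrc;
  sc_htgtE : htgt sc_cell = omap sval sc_htgt }.

Definition sub_graph : avdc_graph := {|
  ob := ob K; vmor := vmor K; hmor := sub_hmor; cell := sub_cell;
  vdom := @vdom K; vcod := @vcod K; hdom := fun J => hdom (sval J); hcod := fun J => hcod (sval J);
  hsrc := sc_hsrc; htgt := sc_htgt; vsrc := fun x => vsrc (sc_cell x); vtgt := fun x => vtgt (sc_cell x) |}.
Local Notation SG := sub_graph.

Lemma sub_hpath A (Js : seq (hmor SG)) B : hpath (G := K) A (map sval Js) B -> hpath (G := SG) A Js B.
Proof. by elim: Js A => //= J Js IH A [e /IH H]; split. Qed.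
Lemma sub_hsrc_path (x : cell SG) : hpath (vdom (vsrc x)) (hsrc x) (vdom (vtgt x)).
Proof. by apply: sub_hpath; rewrite -sc_hsrcE; apply: hsrc_path. Qed.
Lemma sub_htgt_path (x : cell SG) : hpath (vcod (vsrc x)) (oseq (htgt x)) (vcod (vtgt x)).
Proof. by apply: sub_hpath; have := htgt_path (sc_cell x); rewrite sc_htgtE /=; case: (sc_htgt x). Qed.

Lemma sub_ext (x y : cell SG) : hsrc x = hsrc y -> htgt x = htgt y -> vsrc x = vsrc y ->
  vtgt x = vtgt y -> sc_cell x = sc_cell y -> x = y.
Proof.
case: x => s t c p q; case: y => s' t' c' p' q' /= e1 e2 _ _ e3; subst.
by rewrite (proof_irrelevance _ p p') (proof_irrelevance _ q q').
Qed.

Definition sub_hidc (J : sub_hmor) : sub_cell :=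
  @SubCell [:: J] (Some J) (hidc (sval J)) (hsrc_hidc _) (htgt_hidc _).
Definition sub_vidc (f : vmor K) : sub_cell :=
  @SubCell [::] None (vidc f) (hsrc_vidc _) (htgt_vidc _).

Lemma sub_composable (x : cell SG) f s g : composable x f s g -> composable (sc_cell x) f (map sc_cell s) g.
Proof.
case=> n c e v; split=> //; first by case: (s) n.
  by elim: (s) (f) c => //= y s' IH h [<- /IH H]; split.
rewrite sc_hsrcE [sc_hsrc x]e; elim: (s) => //= y s'; rewrite /htgts /= sc_htgtE => <-.
by case: (sc_htgt y).
Qed.
Lemma sub_hsrcs (s : seq (cell SG)) : hsrcs (map sc_cell s) = map sval (hsrcs s).
Proof. by elim: s => //= y s; rewrite /hsrcs /= map_cat sc_hsrcE => ->. Qed.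

Section Comp.
Variables (x : cell SG) (f : vmor K) (s : seq (cell SG)) (g : vmor K) (C : composable x f s g).
Lemma sub_ccomp_hsrc : hsrc (ccomp (sc_cell x) (map sc_cell s)) = map sval (hsrcs s).
Proof. by rewrite (hsrc_ccomp (sub_composable C)) sub_hsrcs. Qed.
Lemma sub_ccomp_htgt : htgt (ccomp (sc_cell x) (map sc_cell s)) = omap sval (htgt x).
Proof. by rewrite (htgt_ccomp (sub_composable C)) sc_htgtE. Qed.
Definition sub_ccomp_of : sub_cell := SubCell sub_ccomp_hsrc sub_ccomp_htgt.
End Comp.

Definition sub_ccomp (x : sub_cell) (s : seq sub_cell) : sub_cell :=
  if excluded_middle_informative
    (composable (G := SG) x (vsrc (sc_cell (head x s))) s (vtgt (sc_cell (last x s)))) is left C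
  then sub_ccomp_of C else x.

Lemma sub_ccompE (x : cell SG) (f g : vmor SG) s (C : composable x f s g) : sub_ccomp x s = sub_ccomp_of C.
Proof.
have [ef eg] : f = vsrc (sc_cell (head x s)) /\ g = vtgt (sc_cell (last x s)).
  case: C => n c _ _; case: s n c => // y s _ [<- c]; split=> //=.
  by elim: s y c => [|y' s IH] y /=; [move=> ->|case=> _ /IH].
rewrite /sub_ccomp; case: excluded_middle_informative => [C'|[]]; last by rewrite -ef -eg.
by subst; rewrite (proof_irrelevance _ C C').
Qed.

Lemma sub_hidc_cell (J : hmor SG) : is_cell (sub_hidc J : cell SG) [:: J] (Some J) (vid (hdom J)) (vid (hcod J)).
Proof. by split=> //=; rewrite idE. Qed.
Lemma sub_vidc_cell (f : vmor SG) : is_vcell (sub_vidc f : cell SG) f f.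
Proof. by split=> //=; rewrite idE. Qed.
Lemma sub_ccomp_cell (x : cell SG) f s g : composable x f s g ->
  is_cell (sub_ccomp x s : cell SG) (hsrcs s) (htgt x) (vsrc x ∘ f) (vtgt x ∘ g).
Proof.
move=> C; have [_ _ e3 e4] := ccomp_cell (sub_composable C).
by rewrite (sub_ccompE C); split.
Qed.
Lemma sub_is_cell (x : cell SG) :
  is_cell (sc_cell x) (map sval (hsrc x)) (omap sval (htgt x)) (vsrc x) (vtgt x).
Proof. by split; rewrite ?sc_hsrcE ?sc_htgtE. Qed.
Lemma sub_cell_comp (x : cell SG) f s g : composable x f s g ->
  sc_cell (sub_ccomp x s) = ccomp (sc_cell x) (map sc_cell s).
Proof. by move=> C; rewrite (sub_ccompE C). Qed.

Definition full_sub : avdc :=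
  @lift_avdc K SG id id sval sc_cell (@vid K) (@vcomp K) sub_hidc sub_vidc sub_ccomp
    (@vdom_id K) (@vcod_id K) (@vdom_comp K) (@vcod_comp K) (@vcompA K) (@vcomp1f K) (@vcompf1 K)
    sub_hsrc_path sub_htgt_path sub_hidc_cell sub_vidc_cell sub_ccomp_cell
    (fun _ => erefl) (fun _ => erefl) (fun _ _ _ => erefl) (fun _ => erefl) sub_is_cell
    (fun _ => erefl) (fun _ => erefl) sub_cell_comp sub_ext.

Definition full_sub_incl : functor full_sub K :=
  @lift_forget K SG id id sval sc_cell (@vid K) (@vcomp K) sub_hidc sub_vidc sub_ccomp
    (@vdom_id K) (@vcod_id K) (@vdom_comp K) (@vcod_comp K) (@vcompA K) (@vcomp1f K) (@vcompf1 K)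
    sub_hsrc_path sub_htgt_path sub_hidc_cell sub_vidc_cell sub_ccomp_cell
    (fun _ => erefl) (fun _ => erefl) (fun _ _ _ => erefl) (fun _ => erefl) (fun _ => erefl) (fun _ => erefl) sub_is_cell
    (fun _ => erefl) (fun _ => erefl) sub_cell_comp sub_ext.
End FullSub.

Section Cocartesian.
Variable K : avdc.
Implicit Types (phi psi chi c : cell K) (phis : seq (cell K)) (f g h k d l : vmor K).

Definition cartesian psi : Prop :=
  size (hsrc psi) <= 1 /\
  forall chi h k, htgt chi = htgt psi ->
    vcod h = vdom (vsrc psi) -> vcod k = vdom (vtgt psi) ->
    vsrc chi = vsrc psi ∘ h -> vtgt chi = vtgt psi ∘ k ->
    exists! phi, is_cell phi (hsrc chi) (ohead (hsrc psi)) h k /\ ccomp psi [:: phi] = chi.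

(* [restriction c J o f g]: c exhibits J as the restriction o(f, g). *)
Definition restriction c (J : hmor K) (o : option (hmor K)) f g : Prop :=
  is_cell c [:: J] o f g /\ cartesian c.
(* J' = J(id, f) and J' = J(f, id) *)
Definition restriction_r c (J' J : hmor K) f : Prop := restriction c J' (Some J) (vid (hdom J)) f.
Definition restriction_l c (J' J : hmor K) f : Prop := restriction c J' (Some J) f (vid (hcod J)).
Definition has_restriction_r (J : hmor K) f : Prop := exists c J', restriction_r c J' J f.
Definition has_restriction_l (J : hmor K) f : Prop := exists c J', restriction_l c J' J f.

(* A nonempty path of unary cells, with first vertical source f0 and last
   vertical target fn. *)
Definition unary_path f0 phis fn : Prop :=
  [/\ phis <> [::], chain f0 phis fn & all (fun phi => isSome (htgt phi)) phis].

Definition weakly_cocartesian f0 phis fn : Prop :=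
  unary_path f0 phis fn /\
  forall psi h k, vcod f0 = vdom h -> vcod fn = vdom k ->
    hsrc psi = hsrcs phis -> vsrc psi = h ∘ f0 -> vtgt psi = k ∘ fn ->
    exists! psi', is_cell psi' (htgts phis) (htgt psi) h k /\ ccomp psi' phis = psi.

(* The lists (id, ..., id, cart), possibly empty, that may precede a path with
   first vertical source f; e is the first vertical source of the extension. *)
Definition left_extension f (s : seq (cell K)) e : Prop :=
  (s = [::] /\ e = f) \/
  exists A Js J J' c, [/\ hpath A Js (hdom J), hcod J = vcod f, restriction_r c J' J f,
    s = rcons (map hidc Js) c & e = vid A].
Definition right_extension f (s : seq (cell K)) e : Prop :=
  (s = [::] /\ e = f) \/
  exists A J J' Js c, [/\ hpath (hcod J) Js A, hdom J = vcod f, restriction_l c J' J f,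
    s = c :: map hidc Js & e = vid A].

Definition cocartesian f0 phis fn : Prop :=
  [/\ weakly_cocartesian f0 phis fn,
    forall J, hcod J = vcod f0 -> has_restriction_r J f0,
    forall J, hdom J = vcod fn -> has_restriction_l J fn &
    forall s e s' e', left_extension f0 s e -> right_extension fn s' e' ->
      weakly_cocartesian e (s ++ phis ++ s') e'].

(* The path is rcons phis phi; the last cell is phi : rcons Hs H => L. *)
Definition right_pointwise_cocartesian f0 phis0 : Prop :=
  exists phis phi Hs H L,
    [/\ phis0 = rcons phis phi,
      unary_path f0 phis0 (vid (hcod H)),
      is_cell phi (rcons Hs H) (Some L) (vsrc phi) (vid (hcod H)) &
      forall f, vcod f = hcod H ->
        (has_restriction_r H f <-> has_restriction_r L f) /\
        forall c c' H' L' phi',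
          restriction_r c H' H f -> restriction_r c' L' L f ->
          is_cell phi' (rcons Hs H') (Some L') (vsrc phi) (vid (vdom f)) ->
          ccomp phi (rcons (map hidc Hs) c) = ccomp c' [:: phi'] ->
          cocartesian f0 (rcons phis phi') (vid (vdom f))].
End Cocartesian.

Section Kan.
Variable K : avdc.
Implicit Types (phi psi eta c : cell K) (phis : seq (cell K)) (f g h k d l : vmor K) (Js Hs : seq (hmor K)).

(* [wk] selects the weak variant and [pw] the pointwise one; d is the vertical
   source of eta and l its vertical target. *)
Definition lan (wk : bool) eta d Js l : Prop :=
  is_cell eta Js None d l /\
  forall Hs k phi, (wk -> Hs = [::]) -> is_cell phi (Js ++ Hs) None d k ->
    exists! phi', is_cell phi' Hs None l k /\ eta ⊙ phi' = phi.

Definition pointwise_lan (wk : bool) eta d Js0 l : Prop :=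
  exists Js J, [/\ Js0 = rcons Js J, is_cell eta Js0 None d l &
    forall f c J', vcod f = hcod J -> restriction_r c J' J f ->
      lan wk (ccomp eta (rcons (map hidc Js) c)) d (rcons Js J') (l ∘ f)].

Definition defines_lan (pw wk : bool) : cell K -> vmor K -> seq (hmor K) -> vmor K -> Prop :=
  if pw then pointwise_lan wk else lan wk.

Definition left_exact (pw wk : bool) d phis : Prop :=
  exists f0 fn, [/\ unary_path f0 phis fn, vcod f0 = vdom d &
    forall eta l, defines_lan pw wk eta d (htgts phis) l ->
      defines_lan pw wk (ccomp eta phis) (d ∘ f0) (hsrcs phis) (l ∘ fn)].
End Kan.

Definition creates_lan (K L : avdc) (U : functor K L) (pw wk : bool) (d : vmor K) (Js : seq (hmor K)) : Prop :=
  forall psi l, defines_lan pw wk psi (Fv U d) (map (Fh U) Js) l ->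
    exists phi, unique (fun phi => [/\ hsrc phi = Js, vsrc phi = d & Fc U phi = psi]) phi /\
      defines_lan pw wk phi d Js (vtgt phi).

Section Conditions.
Variables (K : avdc) (T : monad K).

Definition preserves_restriction_r (J : hmor K) (f : vmor K) : Prop :=
  forall c J', restriction_r c J' J f -> cartesian (T $c c).

Definition preserves_lan (pw wk : bool) (M : colax_algebra T) (d : vmor K) (Js : seq (hmor K)) : Prop :=
  forall eta l, defines_lan pw wk eta d Js l ->
    defines_lan pw wk (al_str M ◁ T $c eta) (al_str M ∘ T $v d) (map (Fh T) Js) (al_str M ∘ T $v l).

(* Restrictions and factorisations through them are unique up to invertible cells,
   so the choice of c and phi is immaterial. *)
Definition left_Beck_Chevalley (J : hTmor T) : Prop :=
  exists c J' phi,
    [/\ restriction_r c J' (ht_map J) (al_str (ht_cod J)),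
      is_cell phi [:: T $h (ht_map J)] (Some J') (al_str (ht_dom J)) (vid (T $o (al_ob (ht_cod J)))),
      ccomp c [:: phi] = ht_cell J &
      right_pointwise_cocartesian (al_str (ht_dom J)) [:: phi]].

Definition TAlg_lbc : avdc := @full_sub (TAlg T Pseudo) left_Beck_Chevalley.
Definition TAlg_lbc_incl : functor TAlg_lbc (TAlg T Pseudo) := @full_sub_incl (TAlg T Pseudo) left_Beck_Chevalley.
Definition TAlg_lbc_forget : functor TAlg_lbc K := fcomp (TAlg_forget T Pseudo) TAlg_lbc_incl.

Variables (w : weakness) (pw wk : bool) (d : vmor (TAlg T w)) (Js : seq (hmor (TAlg T w))).
Local Notation U := (TAlg_forget T w).
Local Notation a0 := (al_str (vdom d : colax_algebra T)).
Local Notation m := (al_str (vcod d : colax_algebra T)).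
Local Notation mu_Js := (map (fun J => xh (mmu T) (Fh U J)) Js).
Local Notation iota_Js := (map (fun J => xh (miota T) (Fh U J)) Js).

Definition condition_p : Prop :=
  [/\ preserves_lan pw wk (vcod d) (Fv U d) (map (Fh U) Js),
    left_exact pw wk (m ∘ T $v (Fv U d)) mu_Js &
    left_exact pw wk (m ∘ T $v (Fv U d)) iota_Js].

Definition condition_e : Prop :=
  [/\ left_exact pw wk (Fv U d) (map (@ht_cell K T) Js),
    left_exact pw wk (Fv U d ∘ a0) mu_Js &
    left_exact pw wk (Fv U d ∘ a0) iota_Js].

Definition condition_l : Prop := creates_lan U pw wk d Js.
End Conditions.

(* Main.v *)
Require Import Defs.
Set Warnings "-notation-overridden".
From mathcomp Require Import ssreflect ssrfun ssrbool eqtype ssrnat seq.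
Set Implicit Arguments. Unset Strict Implicit. Unset Printing Implicit Defensive.

(* A cell η defining the Kan extension l of d in K is compared, along the structure
   cell of d, with the two cells m ∘ Tη and η ∘ (J̄_1, ..., J̄_n) from (TJ_1, ..., TJ_n)
   to M.  If m ∘ Tη (lax case) or η ∘ (J̄_1, ..., J̄_n) (colax case) defines a Kan
   extension, the T-cell equation has a unique solution l̄.  The axioms for l̄ are
   equations of vertical cells out of a Kan extension, by exactness of the paths
   of μ's and ι's, and so can be checked after pasting with its defining cell; the
   same argument lifts factorisations through η to T-cells.  In the pseudo case m ∘ Tη
   and η ∘ (J̄_1, ..., J̄_n) differ by invertible cells, so that one of them
   defines a Kan extension if and only if the other one does.

   In the pointwise case the restriction J' of a horizontal T-morphism J along a lax
   T-morphism f has the structure cell J̄' with cart ∘ J̄' = (J̄ ∘ T cart) ⊙ f̄, and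
   it is the restriction in T-Alg; hence restrictions in T-Alg are restrictions in K.
   Under the left Beck-Chevalley condition J̄_i = cart ∘ J̄'_i with J̄'_i cocartesian,
   so that η ∘ (J̄_1, ..., J̄_n) is a path of weakly cocartesian cells followed by
   a restriction of η, and therefore a Kan extension; this makes l̄ invertible. *)

(** * Pasting of cells *)

(** The weak, ordinary and pointwise variants share one construction of l̄, because it and the check
    of its axioms involve vertical cells only: factorisations with no extra horizontal path are
    available for weak Kan extensions too, and a pointwise Kan extension is an ordinary one by
    restriction along an identity. The full universal property returns only when factorisations
    through the lifted T-cell are needed. Two Kan extensions in [K] then work together: η provides
    the factor, and m ∘ Tη (lax) or η ∘ (J̄_1, ..., J̄_n) (colax), with a universal property of the
    same strength, provides its T-cell equation. For pointwise Kan extensions both have to be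
    restricted along a cartesian cell, the second along its image under [T], which is why [T] must
    preserve restrictions. In the Beck-Chevalley case there is a further obstacle: pointwise Kan
    extensions in the subcategory are tested against restrictions formed there, so the restriction
    J' has to satisfy the left Beck-Chevalley condition again. Invertibility of f̄ gives this. *)

Section Pasting.
Variable K : avdc.
Implicit Types (phi psi chi eta al be : cell K) (f g h k d l u v : vmor K) (s : seq (cell K)).

Lemma cell_vdom phi o f g : is_cell phi [::] o f g -> vdom g = vdom f.
Proof. by case=> e _ <- <-; apply: vtgt_dom_nil. Qed.
Lemma cell_vcod phi Js f g : is_cell phi Js None f g -> vcod g = vcod f.
Proof. by case=> _ e <- <-; apply: vtgt_cod_nil. Qed.
Lemma cell_hpath phi Js o f g : is_cell phi Js o f g -> hpath (vdom f) Js (vdom g).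
Proof. by case=> <- _ <- <-; apply: hsrc_path. Qed.

Lemma composableI psi f s g Js o u v : is_cell psi Js o u v -> s <> [::] -> chain f s g ->
  Js = htgts s -> vcod f = vdom u -> composable psi f s g.
Proof. by case=> <- _ <- _; split. Qed.

Lemma comp1I psi phi Js Hs o o' f g u v : is_cell psi Js o u v -> is_cell phi Hs o' f g ->
  Js = oseq o' -> vcod f = vdom u -> composable psi f [:: phi] g.
Proof.
move=> H1 H2 e e'; apply: composableI H1 _ _ _ e' => //; first by split; rewrite ?(cell_vsrc H2) ?(cell_vtgt H2).
by rewrite e /htgts /= (cell_htgt H2); case: (o').
Qed.
Lemma comp1_cell psi phi Js Hs o o' f g u v : is_cell psi Js o u v -> is_cell phi Hs o' f g ->
  Js = oseq o' -> vcod f = vdom u -> is_cell (ccomp psi [:: phi]) Hs o (u ∘ f) (v ∘ g).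
Proof.
move=> H1 H2 e e'; have := ccomp_cell (comp1I H1 H2 e e').
by rewrite (cell_htgt H1) (cell_vsrc H1) (cell_vtgt H1) /hsrcs /= cats0 (cell_hsrc H2).
Qed.

(** The variants [n] (nullary cells), [r] and [l] (a vertical cell to the right or left of a cell
    with any target) and [lr] (one on each side) fix shapes for which the side condition [o1], at
    most one nonempty target, always holds. *)
Lemma npaste_cell phi psi Js Hs f g h : is_cell phi Js None f g -> is_cell psi Hs None g h ->
  is_cell (phi ⊙ psi) (Js ++ Hs) None f h.
Proof. by move=> H1 H2; apply: (hpaste_cell H1 H2); left. Qed.
Lemma npasteA phi psi chi Js Hs Is f g h k : is_cell phi Js None f g -> is_cell psi Hs None g h ->
  is_cell chi Is None h k -> phi ⊙ psi ⊙ chi = phi ⊙ (psi ⊙ chi).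
Proof. by move=> H1 H2 H3; apply: (hpasteA H1 H2 H3); left. Qed.
Lemma rpaste_cell phi al Js o f g h : is_cell phi Js o f g -> is_vcell al g h -> is_cell (phi ⊙ al) Js o f h.
Proof.
move=> H1 H2; have := hpaste_cell H1 H2 (or_intror erefl).
by rewrite cats0; case: (o).
Qed.
Lemma lpaste_cell phi al Js o f g h : is_vcell al f g -> is_cell phi Js o g h -> is_cell (al ⊙ phi) Js o f h.
Proof. by move=> H1 H2; apply: (hpaste_cell H1 H2 (or_introl erefl)). Qed.
Lemma rpasteA phi al be Js o f g h k : is_cell phi Js o f g -> is_vcell al g h -> is_vcell be h k ->
  phi ⊙ al ⊙ be = phi ⊙ (al ⊙ be).
Proof. by move=> H1 H2 H3; apply: (hpasteA H1 H2 H3); [right|right|left]. Qed.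
Lemma lpasteA phi al be Js o f g h k : is_vcell al f g -> is_vcell be g h -> is_cell phi Js o h k ->
  al ⊙ be ⊙ phi = al ⊙ (be ⊙ phi).
Proof. by move=> H1 H2 H3; apply: (hpasteA H1 H2 H3); left. Qed.
Lemma lrpasteA phi al be Js o f g h k : is_vcell al f g -> is_cell phi Js o g h -> is_vcell be h k ->
  al ⊙ phi ⊙ be = al ⊙ (phi ⊙ be).
Proof. by move=> H1 H2 H3; apply: (hpasteA H1 H2 H3); [left|left|right]. Qed.

(** By [ccomp_pair] the right-hand side is the composite of [al ⊙ phi] with [vidc f :: s], from
    which the vertical identity may be dropped. *)
Lemma ccomp_lpaste al phi s Js o u v w f g : is_vcell al u v -> is_cell phi Js o v w ->
  composable phi f s g -> ccomp (al ⊙ phi) s = (al ▷ f) ⊙ ccomp phi s.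
Proof.
move=> H1 H2 C; have e := comp_ver C; rewrite (cell_vsrc H2) in e.
have e' : vcod f = vdom u by rewrite -(cell_vdom H1).
rewrite (ccomp_pair (rwhisk_comp H1 e') C); first last.
- by left; apply: cell_htgt H1.
- by rewrite (cell_vtgt H1) (cell_vsrc H2).
have C' : composable (al ⊙ phi) f s g.
  case: C => n c eh ev; apply: (composableI (lpaste_cell H1 H2)) => //.
  by rewrite -eh (cell_hsrc H2).
by have [|_ ->] := @ccomp_insert K _ [::] s f g f C'.
Qed.

Lemma ccomp_rpaste al phi s Js o u v w f g : is_cell phi Js o u v -> is_vcell al v w ->
  composable phi f s g -> ccomp (phi ⊙ al) s = ccomp phi s ⊙ (al ▷ g).
Proof.
move=> H1 H2 C; have e := comp_ver_tgt C; rewrite (cell_vtgt H1) in e.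
rewrite (ccomp_pair C (rwhisk_comp H2 e)); first last.
- by right; apply: cell_htgt H2.
- by rewrite (cell_vtgt H1) (cell_vsrc H2).
have C' : composable (phi ⊙ al) f s g.
  case: C => n c eh ev; apply: (composableI (rpaste_cell H1 H2)) => //.
    by rewrite -eh (cell_hsrc H1).
  by rewrite ev (cell_vsrc H1).
have C0 : composable (phi ⊙ al) f (s ++ [::]) g by rewrite cats0.
by have [_ ->] := ccomp_insert C0 (comp_chain C'); rewrite cats0.
Qed.

Lemma composable_cons al psi s f f' g : is_vcell al f' f -> composable psi f s g -> composable psi f' (al :: s) g.
Proof.
move=> H [n c e ev]; split=> //; first by split; rewrite ?(cell_vsrc H) ?(cell_vtgt H).
  by rewrite e /htgts /= (cell_htgt H).
by rewrite -ev (cell_vcod H).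
Qed.
Lemma composable_rcons al psi s f g g' : is_vcell al g g' -> composable psi f s g -> composable psi f (s ++ [:: al]) g'.
Proof.
move=> H [n c e ev]; split=> //; first by case: (s).
  by apply/linked_cat; exists g => //; split; rewrite ?(cell_vsrc H) ?(cell_vtgt H).
by rewrite e htgts_cat /htgts /= (cell_htgt H) /= cats0.
Qed.

Lemma ccomp_cons al psi s f f' g : is_vcell al f' f -> composable psi f s g ->
  ccomp psi (al :: s) = (vsrc psi ◁ al) ⊙ ccomp psi s.
Proof.
move=> H C; have e : vcod f' = vdom (vsrc psi) by rewrite -(comp_ver C) (cell_vcod H).
rewrite (ccomp_pair (lwhisk_comp H e) C) ?idE ?hpaste1E //.
by left.
Qed.
Lemma ccomp_rcons al psi s f g g' : is_vcell al g g' -> composable psi f s g ->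
  ccomp psi (s ++ [:: al]) = ccomp psi s ⊙ (vtgt psi ◁ al).
Proof.
move=> H C; have e := comp_ver_tgt C.
rewrite (ccomp_pair C (lwhisk_comp H e)) ?idE ?hpaste1 //.
by right.
Qed.

Lemma ccomp_lwhisk al psi phi Js o f f' g : is_vcell al f' f -> is_cell phi Js o f g -> composable psi f [:: phi] g ->
  ccomp psi [:: al ⊙ phi] = (vsrc psi ◁ al) ⊙ ccomp psi [:: phi].
Proof.
move=> H H' C; rewrite -(ccomp_cons H C); have C' := composable_cons H C.
by have [|_ <-] := @ccomp_hpaste K psi al phi [::] [::] f' g C'; first by left; apply: cell_htgt H.
Qed.
Lemma ccomp_rwhisk al psi phi Js o f g g' : is_cell phi Js o f g -> is_vcell al g g' -> composable psi f [:: phi] g ->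
  ccomp psi [:: phi ⊙ al] = ccomp psi [:: phi] ⊙ (vtgt psi ◁ al).
Proof.
move=> H' H C; rewrite -(ccomp_rcons H C); have C' := composable_rcons H C.
by have [|_ <-] := @ccomp_hpaste K psi phi al [::] [::] f g' C'; first by right; apply: cell_htgt H.
Qed.

(** The instance of [ccompA] in which every inner path has length one; [s] lists the pairs of an
    outer and an inner cell. *)
Lemma ccomp_zip psi (s : seq (cell K * cell K)) h k f g : composable psi h (map fst s) k ->
  chain f (map snd s) g -> List.Forall (fun p => exists f' g', composable p.1 f' [:: p.2] g') s ->
  ccomp (ccomp psi (map fst s)) (map snd s) = ccomp psi (map (fun p => ccomp p.1 [:: p.2]) s).
Proof.
move=> C c F; have := @ccompA K psi (map (fun p => (p.1, [:: p.2])) s) h k f g.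
have -> : flatten (map snd [seq (p.1, [:: p.2]) | p <- s]) = map snd s.
  by rewrite -map_comp; elim: (s) => //= p s' ->.
rewrite -!map_comp => -> //.
by elim: F => [|p s' Hp _ IH] /=; constructor.
Qed.

Lemma ccomp_map chi (E : Type) (X Y : E -> cell K) (Js : seq E) h k f g :
  composable chi h (map X Js) k -> chain f (map Y Js) g ->
  (forall J, exists f' g', composable (X J) f' [:: Y J] g') ->
  ccomp (ccomp chi (map X Js)) (map Y Js) = ccomp chi (map (fun J => ccomp (X J) [:: Y J]) Js).
Proof.
move=> C c H; have := @ccomp_zip chi (map (fun J => (X J, Y J)) Js) h k f g.
rewrite -!map_comp; apply=> //.
by elim: (Js) => [|J Js' IH] /=; constructor=> //; apply: H.
Qed.

Lemma map_hidc_path A Js B : hpath A Js B -> [/\ chain (vid A) (map (@hidc K) Js) (vid B),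
  htgts (map (@hidc K) Js) = Js & hsrcs (map (@hidc K) Js) = Js].
Proof.
elim: Js A => [|J Js IH] A /=; first by move=> ->.
case=> <- /IH [I1 I2 I3]; rewrite /htgts /hsrcs /= !idE /= -/(htgts _) -/(hsrcs _) I2 I3.
by split=> //; split; rewrite ?idE.
Qed.

(** * Families of cells indexed by the edges of a path *)

Section MapCells.
Variables (V E : Type) (r t : E -> V) (u : V -> vmor K) (X : E -> cell K) (P Q : E -> hmor K).
Hypothesis Xc : forall J, is_cell (X J) [:: P J] (Some (Q J)) (u (r J)) (u (t J)).
Lemma map_cell_chain A Js B : linked r t A Js B -> chain (u A) (map X Js) (u B).
Proof.
elim: Js A => [|J Js IH] A /=; first by move=> ->.
by case=> <- /IH; split; rewrite ?(cell_vsrc (Xc J)) ?(cell_vtgt (Xc J)).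
Qed.
Lemma map_cell_htgts Js : htgts (map X Js) = map Q Js.
Proof. by elim: Js => //= J Js; rewrite /htgts /= (cell_htgt (Xc J)) /= => ->. Qed.
Lemma map_cell_hsrcs Js : hsrcs (map X Js) = map P Js.
Proof. by elim: Js => //= J Js; rewrite /hsrcs /= (cell_hsrc (Xc J)) /= => ->. Qed.
Lemma map_cell_comp psi A Js B o d l : linked r t A Js B -> Js <> [::] ->
  is_cell psi (map Q Js) o d l -> vcod (u A) = vdom d -> composable psi (u A) (map X Js) (u B).
Proof.
move=> L n H e; apply: composableI H _ (map_cell_chain L) (esym (map_cell_htgts _)) e.
by case: (Js) n.
Qed.
Lemma map_cell_cell psi A Js B o d l : linked r t A Js B -> Js <> [::] ->
  is_cell psi (map Q Js) o d l -> vcod (u A) = vdom d ->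
  is_cell (ccomp psi (map X Js)) (map P Js) o (d ∘ u A) (l ∘ u B).
Proof.
move=> L n H e; have := ccomp_cell (map_cell_comp L n H e).
by rewrite map_cell_hsrcs (cell_htgt H) (cell_vsrc H) (cell_vtgt H).
Qed.
End MapCells.
End Pasting.

(** * Moving a vertical cell through a path of cells *)

Section Slide.
Variables (K : avdc) (V E : Type) (s t : E -> V) (u v : V -> vmor K) (al : V -> cell K) (X Y : E -> cell K)
  (P Q : E -> hmor K).
Hypothesis alc : forall A, is_vcell (al A) (u A) (v A).
Hypothesis Xc : forall J, is_cell (X J) [:: P J] (Some (Q J)) (u (s J)) (u (t J)).
Hypothesis Yc : forall J, is_cell (Y J) [:: P J] (Some (Q J)) (v (s J)) (v (t J)).
Hypothesis XY : forall J, X J ⊙ al (t J) = al (s J) ⊙ Y J.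

(** [al] travels from the end of the path to its start and turns each [X J] that it passes into
    [Y J]; [s1] holds the cells that it has not reached yet. *)
Lemma slide_aux psi A Js B s1 f g : linked s t A Js B -> composable psi f (s1 ++ map X Js ++ [:: al B]) g ->
  ccomp psi (s1 ++ map X Js ++ [:: al B]) = ccomp psi (s1 ++ al A :: map Y Js) /\
  composable psi f (s1 ++ al A :: map Y Js) g.
Proof.
elim: Js A s1 => [|J Js IH] A s1 /=; first by move=> ->.
case=> <- L; rewrite -cat_rcons => C; have [-> C'] := IH _ _ L C.
rewrite cat_rcons in C' *.
have [] := swap_cells (o := Some (Q J)) C' (Xc J) (alc _) (alc _) (Yc J) _ _ _ _ (XY J) => //.
- by right.
- by left.
Qed.

Lemma slide psi A Js B f : linked s t A Js B -> composable psi f (map X Js) (u B) ->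
  ccomp psi (map X Js) ⊙ (vtgt psi ◁ al B) = (vsrc psi ◁ al A) ⊙ ccomp psi (map Y Js).
Proof.
move=> L C; have [E1 C1] := slide_aux (s1 := [::]) L (composable_rcons (alc B) C).
rewrite -(ccomp_rcons (alc B) C) E1 /=.
have c := map_cell_chain Yc L.
case: C1 => _ [es _] e ev.
apply: (ccomp_cons (alc A) (g := v B)); split=> //.
- by case: (Js) (comp_nonnil C).
- by rewrite e /htgts /= (cell_htgt (alc A)).
- by rewrite (cell_vcod (alc A)) -ev -es (cell_vsrc (alc A)).
Qed.
End Slide.

(** * Left Kan extensions *)

Section KanLemmas.
Variable K : avdc.
Implicit Types (wk : bool) (phi psi chi eta al be : cell K) (f g h k d l u v : vmor K) (s : seq (cell K)) (Js Hs : seq (hmor K)).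

Lemma lan_inj wk eta d Js l Hs k x y : lan wk eta d Js l -> (wk -> Hs = [::]) ->
  is_cell x Hs None l k -> is_cell y Hs None l k -> eta ⊙ x = eta ⊙ y -> x = y.
Proof.
case=> H U w Hx Hy e; have [z [_ Uz]] := U Hs k _ w (npaste_cell H Hx).
by rewrite -(Uz x) // -(Uz y).
Qed.
Lemma lan_injv wk eta d Js l k x y : lan wk eta d Js l ->
  is_vcell x l k -> is_vcell y l k -> eta ⊙ x = eta ⊙ y -> x = y.
Proof. by move=> L; apply: (lan_inj L). Qed.
Lemma lan_factv wk eta d Js l k phi : lan wk eta d Js l -> is_cell phi Js None d k ->
  exists2 x, is_vcell x l k & eta ⊙ x = phi.
Proof.
case=> H U Hp; have [//||z [[H1 H2] _]] := U [::] k phi; first by rewrite cats0.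
by exists z.
Qed.
Lemma lanI wk eta d Js l : is_cell eta Js None d l ->
  (forall Hs k phi, (wk -> Hs = [::]) -> is_cell phi (Js ++ Hs) None d k ->
     exists2 x, is_cell x Hs None l k & eta ⊙ x = phi) ->
  (forall Hs k x y, (wk -> Hs = [::]) -> is_cell x Hs None l k -> is_cell y Hs None l k ->
     eta ⊙ x = eta ⊙ y -> x = y) -> lan wk eta d Js l.
Proof.
move=> H E I; split=> // Hs k phi w Hp; have [x Hx ex] := E Hs k phi w Hp.
by exists x; split=> // y [Hy ey]; apply: I w Hx Hy _; rewrite ey.
Qed.

Lemma lan_isol wk eta d d' Js l al be : is_vcell al d' d -> is_vcell be d d' ->
  al ⊙ be = vidc d' -> be ⊙ al = vidc d -> lan wk eta d Js l -> lan wk (al ⊙ eta) d' Js l.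
Proof.
move=> Ha Hb ab ba [He U]; apply: lanI; first exact: lpaste_cell Ha He.
  move=> Hs k phi w Hp; have [x [[Hx ex] _]] := U Hs k _ w (lpaste_cell Hb Hp).
  exists x => //; rewrite (npasteA Ha He Hx) ex -(npasteA Ha Hb Hp) ab hpaste1E //.
  exact: cell_vsrc Hp.
move=> Hs k x y w Hx Hy; rewrite (npasteA Ha He Hx) (npasteA Ha He Hy).
move/(congr1 (hpaste be)).
rewrite -(npasteA Hb Ha (npaste_cell He Hx)) -(npasteA Hb Ha (npaste_cell He Hy)) ba.
rewrite !hpaste1E ?(cell_vsrc (npaste_cell He Hx)) ?(cell_vsrc (npaste_cell He Hy)) //.
exact: lan_inj (conj He U) w Hx Hy.
Qed.

Lemma lan_isor wk eta d Js l l' al be : is_vcell al l l' -> is_vcell be l' l ->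
  al ⊙ be = vidc l -> be ⊙ al = vidc l' -> lan wk eta d Js l -> lan wk (eta ⊙ al) d Js l'.
Proof.
move=> Ha Hb ab ba [He U]; apply: lanI; first exact: rpaste_cell He Ha.
  move=> Hs k phi w Hp; have [x [[Hx ex] _]] := U Hs k _ w Hp.
  exists (be ⊙ x); first exact: lpaste_cell Hb Hx.
  rewrite (npasteA He Ha (lpaste_cell Hb Hx)) -(npasteA Ha Hb Hx) ab hpaste1E ?ex //.
  exact: cell_vsrc Hx.
move=> Hs k x y w Hx Hy; rewrite (npasteA He Ha Hx) (npasteA He Ha Hy).
move/(lan_inj (conj He U) w (lpaste_cell Ha Hx) (lpaste_cell Ha Hy)) /(congr1 (hpaste be)).
by rewrite -(npasteA Hb Ha Hx) -(npasteA Hb Ha Hy) ba !hpaste1E ?(cell_vsrc Hx) ?(cell_vsrc Hy).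
Qed.

(** Pasting with [al] turns a Kan extension of [d'] into one of [d], to which exactness applies.
    Since this pasting commutes with composition along [phis], pasting with [be ▷ f0] afterwards
    removes it again. *)
Lemma left_exact_iso wk d d' phis al be : is_vcell al d d' -> is_vcell be d' d ->
  al ⊙ be = vidc d -> be ⊙ al = vidc d' -> left_exact false wk d phis -> left_exact false wk d' phis.
Proof.
move=> Ha Hb ab ba [f0 [fn [Up ev X]]]; exists f0, fn; split=> //; first by rewrite (cell_vdom Ha).
move=> eta l /= Le; have [He _] := Le.
have := X _ _ (lan_isol Ha Hb ab ba Le); rewrite /=.
have C : composable eta f0 phis fn.
  case: Up => n c _; apply: composableI He n c erefl _; by rewrite (cell_vdom Ha).
have HC : is_cell (ccomp eta phis) (hsrcs phis) None (d' ∘ f0) (l ∘ fn).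
  by have := ccomp_cell C; rewrite (cell_htgt He) (cell_vsrc He) (cell_vtgt He).
have ev' : vcod f0 = vdom d' by rewrite (cell_vdom Ha).
have Ha' := rwhisk_cell Ha ev; have Hb' := rwhisk_cell Hb ev'.
have ab' : (al ▷ f0) ⊙ (be ▷ f0) = vidc (d ∘ f0) by rewrite -(rwhisk_hpaste Ha Hb) ?ab ?rwhisk_vidc //; left.
have ba' : (be ▷ f0) ⊙ (al ▷ f0) = vidc (d' ∘ f0) by rewrite -(rwhisk_hpaste Hb Ha) ?ba ?rwhisk_vidc //; left.
rewrite (ccomp_lpaste Ha He C) => /(lan_isol Hb' Ha' ba' ab').
by rewrite -(npasteA Hb' Ha' HC) ba' hpaste1E // (cell_vsrc HC).
Qed.
End KanLemmas.

(** * The structure cell induced on a left Kan extension *)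

Section Structure.
Variables (K : avdc) (T : monad K).
Local Notation mu := (xv (mmu T)).
Local Notation iota := (xv (miota T)).
Local Notation mu_h := (xh (mmu T)).
Local Notation iota_h := (xh (miota T)).
Local Notation apath := (linked (@ht_dom K T) (@ht_cod K T)).

Lemma mu_cell (J : hTmor T) : is_cell (mu_h (ht_map J)) [:: T $h (T $h (ht_map J))] (Some (T $h (ht_map J)))
  (mu (al_ob (ht_dom J))) (mu (al_ob (ht_cod J))).
Proof. by rewrite -!ht_map_dom -!ht_map_cod; apply: (xh_cell (mmu T)). Qed.
Lemma iota_cell (J : hTmor T) : is_cell (iota_h (ht_map J)) [:: ht_map J] (Some (T $h (ht_map J)))
  (iota (al_ob (ht_dom J))) (iota (al_ob (ht_cod J))).
Proof. by rewrite -!ht_map_dom -!ht_map_cod; apply: (xh_cell (miota T)). Qed.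
Lemma Tstr_cell (J : hTmor T) : is_cell (T $c (ht_cell J)) [:: T $h (T $h (ht_map J))] (Some (T $h (ht_map J)))
  (T $v (al_str (ht_dom J))) (T $v (al_str (ht_cod J))).
Proof. exact: F_is_cell (ht_str_cell J). Qed.

(** Naturality of μ at a nullary cell: the target being empty, [trans_tgt] is a vertical identity
    and one side is a whiskering. For an empty [Js], [trans_path] would be a vertical identity
    instead of the list of the μ's. *)
Lemma mu_nat_cell (eta : cell K) Js d l : is_cell eta Js None d l -> Js <> [::] ->
  ccomp (T $c eta) (map mu_h Js) = mu (vcod d) ◁ T $c (T $c eta).
Proof.
case=> <- e2 <- _ n; have := xh_nat (mmu T) eta; rewrite e2 /= /trans_path.
by case: (hsrc eta) n.
Qed.
Lemma iota_nat_cell (eta : cell K) Js d l : is_cell eta Js None d l -> Js <> [::] ->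
  ccomp (T $c eta) (map iota_h Js) = iota (vcod d) ◁ eta.
Proof.
case=> <- e2 <- _ n; have := xh_nat (miota T) eta; rewrite e2 /= /trans_path.
by case: (hsrc eta) n.
Qed.

Lemma ht_map_hpath A Js B : apath A Js B -> hpath (al_ob A) (map (@ht_map K T) Js) (al_ob B).
Proof.
elim: Js A => [|J Js IH] A /=; first by move=> ->.
by case=> <- /IH H; split; rewrite ?ht_map_dom ?ht_map_cod.
Qed.

Variables (A0 An M : colax_algebra T) (Js : seq (hTmor T)) (eta : cell K) (d l : vmor K).
Hypotheses (PJ : apath A0 Js An) (nJ : Js <> [::]) (He : is_cell eta (map (@ht_map K T) Js) None d l)
  (dM : vcod d = al_ob M).
Local Notation m := (al_str M).
Local Notation a0 := (al_str A0).
Local Notation an := (al_str An).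
Local Notation UJ := (map (@ht_map K T) Js).
Local Notation TJ := (map (Fh T) UJ).
Local Notation mus := (map (fun J => mu_h (ht_map J)) Js).
Local Notation iotas := (map (fun J => iota_h (ht_map J)) Js).
Local Notation strs := (map (@ht_cell K T) Js).
Local Notation Tstrs := (map (fun J => T $c (ht_cell J)) Js).

Lemma nullary_src_dom : vdom d = al_ob A0.
Proof.
have := cell_hpath He; case: (Js) PJ nJ => //= J Js' [<- _] _ [<- _]; exact: ht_map_dom.
Qed.
Lemma nullary_tgt_dom : vdom l = al_ob An.
Proof.
have := cell_hpath He; rewrite nullary_src_dom => H; exact: linked_uniq H (ht_map_hpath PJ).
Qed.
Lemma nullary_tgt_cod : vcod l = al_ob M. Proof. by rewrite (cell_vcod He). Qed.
(** Put into the context, where the tactic [bnd] finds these boundaries. *)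
Let dd_ := nullary_src_dom. Let ld_ := nullary_tgt_dom. Let lM_ := nullary_tgt_cod.

Lemma Teta_cell : is_cell (m ◁ T $c eta) TJ None (m ∘ T $v d) (m ∘ T $v l).
Proof. by apply: lwhisk_cell (F_is_cell T He) _; bnd. Qed.
Lemma eta_str_comp : composable eta a0 strs an.
Proof. by apply: (map_cell_comp (@ht_str_cell K T) PJ nJ He); bnd. Qed.
Lemma eta_str_cell : is_cell (ccomp eta strs) TJ None (d ∘ a0) (l ∘ an).
Proof.
by rewrite -map_comp; apply: (map_cell_cell (@ht_str_cell K T) PJ nJ He); bnd.
Qed.

Lemma over_mu (x : cell K) o u v : is_cell x TJ o u v -> vdom u = T $o (al_ob A0) ->
  composable x (mu (al_ob A0)) mus (mu (al_ob An)) /\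
  is_cell (ccomp x mus) (map (Fh T) TJ) o (u ∘ mu (al_ob A0)) (v ∘ mu (al_ob An)).
Proof.
rewrite -map_comp => H e; split.
  by apply: (map_cell_comp (u := fun A => mu (al_ob A)) mu_cell PJ nJ H); bnd.
by rewrite -map_comp; apply: (map_cell_cell (u := fun A => mu (al_ob A)) mu_cell PJ nJ H); bnd.
Qed.
Lemma over_iota (x : cell K) o u v : is_cell x TJ o u v -> vdom u = T $o (al_ob A0) ->
  composable x (iota (al_ob A0)) iotas (iota (al_ob An)) /\
  is_cell (ccomp x iotas) UJ o (u ∘ iota (al_ob A0)) (v ∘ iota (al_ob An)).
Proof.
rewrite -map_comp => H e; split.
  by apply: (map_cell_comp (u := fun A => iota (al_ob A)) iota_cell PJ nJ H); bnd.
by apply: (map_cell_cell (u := fun A => iota (al_ob A)) iota_cell PJ nJ H); bnd.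
Qed.
Lemma over_Tstr (x : cell K) o u v : is_cell x TJ o u v -> vdom u = T $o (al_ob A0) ->
  composable x (T $v a0) Tstrs (T $v an) /\
  is_cell (ccomp x Tstrs) (map (Fh T) TJ) o (u ∘ T $v a0) (v ∘ T $v an).
Proof.
rewrite -map_comp => H e; split.
  by apply: (map_cell_comp (u := fun A => T $v (al_str A)) Tstr_cell PJ nJ H); bnd.
by rewrite -map_comp; apply: (map_cell_cell (u := fun A => T $v (al_str A)) Tstr_cell PJ nJ H); bnd.
Qed.

Let vE := cell_vsrc He. Let vE' := cell_vtgt He.

(** The composite of η with the J̄_i and the μ's is η applied to the cells J̄_i ∘ μ. The
    associativity axiom of each J_i then lets the cell ā move past it, from the end of the path to
    its start. *)
Lemma str_assoc_slide : ccomp (ccomp eta strs) mus ⊙ (l ◁ al_assoc An)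
  = (d ◁ al_assoc A0) ⊙ ccomp (ccomp eta strs) Tstrs.
Proof.
have eC : vdom (d ∘ a0) = T $o (al_ob A0) by bnd.
have [[_ c1 _ _] _] := over_mu eta_str_cell eC; have [[_ c2 _ _] _] := over_Tstr eta_str_cell eC.
pose X (J : hTmor T) := ccomp (ht_cell J) [:: mu_h (ht_map J)].
pose Y (J : hTmor T) := ccomp (ht_cell J) [:: T $c (ht_cell J)].
have Xc (J : hTmor T) : is_cell (X J) [:: T $h (T $h (ht_map J))] (Some (ht_map J))
    (al_str (ht_dom J) ∘ mu (al_ob (ht_dom J))) (al_str (ht_cod J) ∘ mu (al_ob (ht_cod J))).
  by apply: comp1_cell (ht_str_cell J) (mu_cell J) _ _; bnd.
have Yc (J : hTmor T) : is_cell (Y J) [:: T $h (T $h (ht_map J))] (Some (ht_map J))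
    (al_str (ht_dom J) ∘ T $v (al_str (ht_dom J))) (al_str (ht_cod J) ∘ T $v (al_str (ht_cod J))).
  by apply: comp1_cell (ht_str_cell J) (Tstr_cell J) _ _; bnd.
rewrite (ccomp_map eta_str_comp c1); last first.
  by move=> J; do 2 eexists; apply: comp1I (ht_str_cell J) (mu_cell J) _ _; bnd.
rewrite (ccomp_map eta_str_comp c2); last first.
  by move=> J; do 2 eexists; apply: comp1I (ht_str_cell J) (Tstr_cell J) _ _; bnd.
have := slide (u := fun A => al_str A ∘ mu (al_ob A)) (v := fun A => al_str A ∘ T $v (al_str A))
  (@al_assoc_cell K T) Xc Yc (@ht_assocE K T) PJ (psi := eta).
rewrite vE vE'; apply.
by apply: (map_cell_comp (u := fun A => al_str A ∘ mu (al_ob A)) Xc PJ nJ He); bnd.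
Qed.

(** The same with the unit axioms; the cells left behind are identities, so that η itself
    remains. *)
Lemma str_unit_slide : ccomp (ccomp eta strs) iotas ⊙ (l ◁ al_unit An) = (d ◁ al_unit A0) ⊙ eta.
Proof.
have eC : vdom (d ∘ a0) = T $o (al_ob A0) by bnd.
have [[_ c1 _ _] _] := over_iota eta_str_cell eC.
pose X (J : hTmor T) := ccomp (ht_cell J) [:: iota_h (ht_map J)].
pose Y (J : hTmor T) := hidc (ht_map J) : cell K.
have Xc (J : hTmor T) : is_cell (X J) [:: ht_map J] (Some (ht_map J))
    (al_str (ht_dom J) ∘ iota (al_ob (ht_dom J))) (al_str (ht_cod J) ∘ iota (al_ob (ht_cod J))).
  by apply: comp1_cell (ht_str_cell J) (iota_cell J) _ _; bnd.
have Yc (J : hTmor T) : is_cell (Y J) [:: ht_map J] (Some (ht_map J))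
    (vid (al_ob (ht_dom J))) (vid (al_ob (ht_cod J))).
  by rewrite -ht_map_dom -ht_map_cod; apply: hidc_cell.
rewrite (ccomp_map eta_str_comp c1); last first.
  by move=> J; do 2 eexists; apply: comp1I (ht_str_cell J) (iota_cell J) _ _; bnd.
have := slide (u := fun A => al_str A ∘ iota (al_ob A)) (v := fun A => vid (al_ob A))
  (@al_unit_cell K T) Xc Yc (@ht_unitE K T) PJ (psi := eta).
have -> : map Y Js = map hidc (hsrc eta) by rewrite (cell_hsrc He) -map_comp.
rewrite ccomph1; last by rewrite (cell_hsrc He); case: (Js) nJ.
rewrite vE vE'; apply.
by apply: (map_cell_comp (u := fun A => al_str A ∘ iota (al_ob A)) Xc PJ nJ He); bnd.
Qed.

Let T1 := F_is_cell T He.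
Let T2 := F_is_cell T T1.

Lemma Teta_mu : ccomp (m ◁ T $c eta) mus = (m ∘ mu (al_ob M)) ◁ T $c (T $c eta).
Proof.
have eC : vdom (T $v d) = T $o (al_ob A0) by bnd.
have [C _] := over_mu T1 eC.
rewrite -(lwhisk_ccomp _ C); [|exact: cell_htgt T1|by rewrite (cell_vsrc T1); bnd].
rewrite (map_comp mu_h (@ht_map K T)) (mu_nat_cell He); last by case: (Js) nJ.
by rewrite dM (lwhisk_comp2 T2) //; bnd.
Qed.
Lemma Teta_iota : ccomp (m ◁ T $c eta) iotas = (m ∘ iota (al_ob M)) ◁ eta.
Proof.
have eC : vdom (T $v d) = T $o (al_ob A0) by bnd.
have [C _] := over_iota T1 eC.
rewrite -(lwhisk_ccomp _ C); [|exact: cell_htgt T1|by rewrite (cell_vsrc T1); bnd].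
rewrite (map_comp iota_h (@ht_map K T)) (iota_nat_cell He); last by case: (Js) nJ.
by rewrite dM (lwhisk_comp2 He) //; bnd.
Qed.

(** By [Teta_mu] the two sides are the two orders in which [al_assoc M] can be pasted with the image
    of η under [T] twice, hence equal by interchange. *)
Lemma Teta_assoc : ccomp (m ◁ T $c eta) mus ⊙ (al_assoc M ▷ T $v (T $v l))
  = (al_assoc M ▷ T $v (T $v d)) ⊙ (m ◁ T $c (m ◁ T $c eta)).
Proof.
rewrite Teta_mu -(cell_interchange T2 (al_assoc_cell M)); last by bnd.
congr (_ ⊙ _); rewrite (F_lwhisk T T1); last by bnd.
by rewrite (lwhisk_comp2 T2) //; bnd.
Qed.
Lemma Teta_unit : ccomp (m ◁ T $c eta) iotas ⊙ (al_unit M ▷ l) = (al_unit M ▷ d) ⊙ eta.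
Proof.
rewrite Teta_iota -(cell_interchange He (al_unit_cell M)); last by bnd.
by rewrite (lwhisk_vid He) // dM.
Qed.
Lemma Tstr_eta : m ◁ T $c (ccomp eta strs) = ccomp (m ◁ T $c eta) Tstrs.
Proof.
have eC : vdom (T $v d) = T $o (al_ob A0) by bnd.
have [C _] := over_Tstr T1 eC.
rewrite (F_ccomp T eta_str_comp) -map_comp (lwhisk_ccomp _ C) //; first exact: cell_htgt T1.
by rewrite (cell_vsrc T1); bnd.
Qed.

Lemma lwhiskT_paste (x y : cell K) Hs Is f g h : is_cell x Hs None f g -> is_cell y Is None g h ->
  vcod f = al_ob M -> m ◁ T $c (x ⊙ y) = (m ◁ T $c x) ⊙ (m ◁ T $c y).
Proof.
move=> Hx Hy e; rewrite F_hpaste; [|by rewrite (cell_vtgt Hx) (cell_vsrc Hy)|by left; apply: cell_htgt Hx].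
by rewrite (lwhisk_hpaste (F_is_cell T Hx) (F_is_cell T Hy)) //; bnd.
Qed.
Lemma lwhiskT_cell (x : cell K) Hs f g : is_cell x Hs None f g -> vcod f = al_ob M ->
  is_cell (m ◁ T $c x) (map (Fh T) Hs) None (m ∘ T $v f) (m ∘ T $v g).
Proof. by move=> Hx e; apply: lwhisk_cell (F_is_cell T Hx) _; bnd. Qed.

Let mu_l : m ∘ mu (al_ob M) ∘ T $v (T $v l) = m ∘ T $v l ∘ mu (al_ob An).
Proof. by rewrite -vcompA; [|bnd..]; rewrite -(mu_nat T nullary_tgt_dom nullary_tgt_cod); vnorm. Qed.
Let mu_d : m ∘ mu (al_ob M) ∘ T $v (T $v d) = m ∘ T $v d ∘ mu (al_ob A0).
Proof. by rewrite -vcompA; [|bnd..]; rewrite -(mu_nat T nullary_src_dom dM); vnorm. Qed.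
Let iota_l : m ∘ iota (al_ob M) ∘ l = m ∘ T $v l ∘ iota (al_ob An).
Proof. by rewrite -vcompA; [|bnd..]; rewrite -(iota_nat T nullary_tgt_dom nullary_tgt_cod); vnorm. Qed.
Let iota_d : m ∘ iota (al_ob M) ∘ d = m ∘ T $v d ∘ iota (al_ob A0).
Proof. by rewrite -vcompA; [|bnd..]; rewrite -(iota_nat T nullary_src_dom dM); vnorm. Qed.
Let Pl : is_vcell (al_assoc M ▷ T $v (T $v l)) (m ∘ T $v l ∘ mu (al_ob An)) (m ∘ T $v m ∘ T $v (T $v l)).
Proof. by rewrite -mu_l; apply: rwhisk_cell (al_assoc_cell M) _; bnd. Qed.
Let Pd : is_vcell (al_assoc M ▷ T $v (T $v d)) (m ∘ T $v d ∘ mu (al_ob A0)) (m ∘ T $v m ∘ T $v (T $v d)).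
Proof. by rewrite -mu_d; apply: rwhisk_cell (al_assoc_cell M) _; bnd. Qed.
Let Al : is_vcell (l ◁ al_assoc An) (l ∘ an ∘ mu (al_ob An)) (l ∘ an ∘ T $v an).
Proof. by apply: is_cell_conv (lwhisk_cell (al_assoc_cell An) _) _ _; bnd; vnorm. Qed.
Let Ad : is_vcell (d ◁ al_assoc A0) (d ∘ a0 ∘ mu (al_ob A0)) (d ∘ a0 ∘ T $v a0).
Proof. by apply: is_cell_conv (lwhisk_cell (al_assoc_cell A0) _) _ _; bnd; vnorm. Qed.
Let Ul : is_vcell (l ◁ al_unit An) (l ∘ an ∘ iota (al_ob An)) l.
Proof. by apply: is_cell_conv (lwhisk_cell (al_unit_cell An) _) _ _; bnd; rewrite ?vcompE1 //; vnorm. Qed.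
Let Ud : is_vcell (d ◁ al_unit A0) (d ∘ a0 ∘ iota (al_ob A0)) d.
Proof. by apply: is_cell_conv (lwhisk_cell (al_unit_cell A0) _) _ _; bnd; rewrite ?vcompE1 //; vnorm. Qed.
Let Vl : is_vcell (al_unit M ▷ l) (m ∘ T $v l ∘ iota (al_ob An)) l.
Proof. by rewrite -iota_l; apply: is_cell_conv (rwhisk_cell (al_unit_cell M) _) _ _; bnd; rewrite ?vcomp1E. Qed.
Let Vd : is_vcell (al_unit M ▷ d) (m ∘ T $v d ∘ iota (al_ob A0)) d.
Proof. by rewrite -iota_d; apply: is_cell_conv (rwhisk_cell (al_unit_cell M) _) _ _; bnd; rewrite ?vcomp1E. Qed.
Let etas : cell K := ccomp eta strs.
Let Teta : cell K := m ◁ T $c eta.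
Let edT : vdom (m ∘ T $v d) = T $o (al_ob A0). Proof. bnd. Qed.
Let eda : vdom (d ∘ a0) = T $o (al_ob A0). Proof. bnd. Qed.
Let NN : is_cell (m ◁ T $c Teta) (map (Fh T) TJ) None (m ∘ T $v m ∘ T $v (T $v d)) (m ∘ T $v m ∘ T $v (T $v l)).
Proof. by apply: is_cell_conv (lwhiskT_cell Teta_cell _) _ _; bnd; vnorm. Qed.
Let NV : is_cell (m ◁ T $c etas) (map (Fh T) TJ) None (m ∘ T $v d ∘ T $v a0) (m ∘ T $v l ∘ T $v an).
Proof. by apply: is_cell_conv (lwhiskT_cell eta_str_cell _) _ _; bnd; vnorm. Qed.

Variables (db lb : cell K) (wk : bool).
Section Lax.
Hypotheses (Hd : lax_morphism A0 M d db) (Hl : is_vcell lb (m ∘ T $v l) (l ∘ an))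
  (E : Teta ⊙ lb = db ⊙ etas).
Let Hdc := lax_cell Hd.
Let Q : is_vcell (m ◁ T $c lb) (m ∘ T $v m ∘ T $v (T $v l)) (m ∘ T $v l ∘ T $v an).
Proof. by apply: is_cell_conv (lwhiskT_cell Hl _) _ _; bnd; vnorm. Qed.
Let Q' : is_vcell (m ◁ T $c db) (m ∘ T $v m ∘ T $v (T $v d)) (m ∘ T $v d ∘ T $v a0).
Proof. by apply: is_cell_conv (lwhiskT_cell Hdc _) _ _; bnd; vnorm. Qed.
Let R : is_vcell (lb ▷ T $v an) (m ∘ T $v l ∘ T $v an) (l ∘ an ∘ T $v an).
Proof. by apply: rwhisk_cell Hl _; bnd. Qed.
Let R' : is_vcell (db ▷ T $v a0) (m ∘ T $v d ∘ T $v a0) (d ∘ a0 ∘ T $v a0).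
Proof. by apply: rwhisk_cell Hdc _; bnd. Qed.
Let S : is_vcell (lb ▷ mu (al_ob An)) (m ∘ T $v l ∘ mu (al_ob An)) (l ∘ an ∘ mu (al_ob An)).
Proof. by apply: rwhisk_cell Hl _; bnd. Qed.
Let S' : is_vcell (db ▷ mu (al_ob A0)) (m ∘ T $v d ∘ mu (al_ob A0)) (d ∘ a0 ∘ mu (al_ob A0)).
Proof. by apply: rwhisk_cell Hdc _; bnd. Qed.
Let I : is_vcell (lb ▷ iota (al_ob An)) (m ∘ T $v l ∘ iota (al_ob An)) (l ∘ an ∘ iota (al_ob An)).
Proof. by apply: rwhisk_cell Hl _; bnd. Qed.
Let I' : is_vcell (db ▷ iota (al_ob A0)) (m ∘ T $v d ∘ iota (al_ob A0)) (d ∘ a0 ∘ iota (al_ob A0)).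
Proof. by apply: rwhisk_cell Hdc _; bnd. Qed.

(* Both sides of each axiom for l are compared after pasting with the Kan
   extension (m ∘ Tη) ∘ μ, respectively (m ∘ Tη) ∘ ι. *)
Lemma lax_structure :
  lan wk (ccomp Teta mus) (m ∘ T $v d ∘ mu (al_ob A0)) (map (Fh T) TJ) (m ∘ T $v l ∘ mu (al_ob An)) ->
  lan wk (ccomp Teta iotas) (m ∘ T $v d ∘ iota (al_ob A0)) UJ (m ∘ T $v l ∘ iota (al_ob An)) ->
  lax_morphism An M l lb.
Proof.
move=> Lm Li.
have [C1 D1] := over_mu Teta_cell edT; have [C2 D2] := over_mu eta_str_cell eda.
have [C3 D3] := over_iota Teta_cell edT; have [C4 D4] := over_iota eta_str_cell eda.
have [C5 D5] := over_Tstr Teta_cell edT; have [C6 D6] := over_Tstr eta_str_cell eda.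
split=> //.
- apply: (lan_injv Lm); first exact: vcell_hpaste (vcell_hpaste Pl Q) R.
    exact: vcell_hpaste S Al.
  (* The equation [E] enters three times: under [T], composed with the cells [Tstrs], and finally
     backwards, composed with the μ's. The associativity axiom of [db] is used between the last
     two. *)
  rewrite -(npasteA D1 (vcell_hpaste Pl Q) R) -(npasteA D1 Pl Q) Teta_assoc -/Teta.
  rewrite (lrpasteA Pd NN Q) -(lwhiskT_paste Teta_cell Hl); last by bnd.
  rewrite E (lwhiskT_paste Hdc eta_str_cell); last by bnd.
  rewrite -(lpasteA Pd Q' NV) (lrpasteA (vcell_hpaste Pd Q') NV R) Tstr_eta -/Teta.
  rewrite -(ccomp_rpaste Teta_cell Hl C5) E (ccomp_lpaste Hdc eta_str_cell C6).
  rewrite -(lpasteA (vcell_hpaste Pd Q') R' D6) (lax_assocE Hd) (lpasteA S' Ad D6).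
  rewrite -str_assoc_slide -(lrpasteA S' D2 Al) -(ccomp_lpaste Hdc eta_str_cell C2) -E.
  by rewrite (ccomp_rpaste Teta_cell Hl C1) (npasteA D1 S Al).
- apply: (lan_injv Li); [exact: vcell_hpaste I Ul|exact: Vl|].
  rewrite -(npasteA D3 I Ul) -(ccomp_rpaste Teta_cell Hl C3) E (ccomp_lpaste Hdc eta_str_cell C4).
  rewrite (lrpasteA I' D4 Ul) str_unit_slide -(lpasteA I' Ud He) (lax_unitE Hd).
  by rewrite Teta_unit.
Qed.
End Lax.

Section Colax.
Hypotheses (Hd : colax_morphism A0 M d db) (Hl : is_vcell lb (l ∘ an) (m ∘ T $v l))
  (E : etas ⊙ lb = db ⊙ Teta).
Let Hdc := colax_cell Hd.
Let Q : is_vcell (m ◁ T $c lb) (m ∘ T $v l ∘ T $v an) (m ∘ T $v m ∘ T $v (T $v l)).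
Proof. by apply: is_cell_conv (lwhiskT_cell Hl _) _ _; bnd; vnorm. Qed.
Let Q' : is_vcell (m ◁ T $c db) (m ∘ T $v d ∘ T $v a0) (m ∘ T $v m ∘ T $v (T $v d)).
Proof. by apply: is_cell_conv (lwhiskT_cell Hdc _) _ _; bnd; vnorm. Qed.
Let R : is_vcell (lb ▷ T $v an) (l ∘ an ∘ T $v an) (m ∘ T $v l ∘ T $v an).
Proof. by apply: rwhisk_cell Hl _; bnd. Qed.
Let R' : is_vcell (db ▷ T $v a0) (d ∘ a0 ∘ T $v a0) (m ∘ T $v d ∘ T $v a0).
Proof. by apply: rwhisk_cell Hdc _; bnd. Qed.
Let S : is_vcell (lb ▷ mu (al_ob An)) (l ∘ an ∘ mu (al_ob An)) (m ∘ T $v l ∘ mu (al_ob An)).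
Proof. by apply: rwhisk_cell Hl _; bnd. Qed.
Let S' : is_vcell (db ▷ mu (al_ob A0)) (d ∘ a0 ∘ mu (al_ob A0)) (m ∘ T $v d ∘ mu (al_ob A0)).
Proof. by apply: rwhisk_cell Hdc _; bnd. Qed.
Let I : is_vcell (lb ▷ iota (al_ob An)) (l ∘ an ∘ iota (al_ob An)) (m ∘ T $v l ∘ iota (al_ob An)).
Proof. by apply: rwhisk_cell Hl _; bnd. Qed.
Let I' : is_vcell (db ▷ iota (al_ob A0)) (d ∘ a0 ∘ iota (al_ob A0)) (m ∘ T $v d ∘ iota (al_ob A0)).
Proof. by apply: rwhisk_cell Hdc _; bnd. Qed.

(** The dual argument, with the vertical cells reversed: the test is made on η ∘ (J̄_1, ..., J̄_n)
    composed with the μ's and the ι's, since l̄ now starts at [l ∘ an]. *)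
Lemma colax_structure :
  lan wk (ccomp etas mus) (d ∘ a0 ∘ mu (al_ob A0)) (map (Fh T) TJ) (l ∘ an ∘ mu (al_ob An)) ->
  lan wk (ccomp etas iotas) (d ∘ a0 ∘ iota (al_ob A0)) UJ (l ∘ an ∘ iota (al_ob An)) ->
  colax_morphism An M l lb.
Proof.
move=> Lm Li.
have [C1 D1] := over_mu Teta_cell edT; have [C2 D2] := over_mu eta_str_cell eda.
have [C3 D3] := over_iota Teta_cell edT; have [C4 D4] := over_iota eta_str_cell eda.
have [C5 D5] := over_Tstr Teta_cell edT; have [C6 D6] := over_Tstr eta_str_cell eda.
split=> //.
- apply: (lan_injv Lm); first exact: vcell_hpaste (vcell_hpaste Al R) Q.
    exact: vcell_hpaste S Pl.
  rewrite -(npasteA D2 (vcell_hpaste Al R) Q) -(npasteA D2 Al R) str_assoc_slide -/etas.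
  rewrite (lrpasteA Ad D6 R) -(ccomp_rpaste eta_str_cell Hl C6) E (ccomp_lpaste Hdc Teta_cell C5).
  rewrite -Tstr_eta -/etas -(lpasteA Ad R' NV) (lrpasteA (vcell_hpaste Ad R') NV Q).
  rewrite -(lwhiskT_paste eta_str_cell Hl); last by bnd.
  rewrite E (lwhiskT_paste Hdc Teta_cell); last by bnd.
  rewrite -(lpasteA (vcell_hpaste Ad R') Q' NN) (colax_assocE Hd) (lpasteA S' Pd NN) -Teta_assoc -/Teta.
  rewrite -(lrpasteA S' D1 Pl) -(ccomp_lpaste Hdc Teta_cell C1) -E.
  by rewrite (ccomp_rpaste eta_str_cell Hl C2) (npasteA D2 S Pl).
- apply: (lan_injv Li); [exact: vcell_hpaste I Vl|exact: Ul|].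
  rewrite -(npasteA D4 I Vl) -(ccomp_rpaste eta_str_cell Hl C4) E (ccomp_lpaste Hdc Teta_cell C3).
  rewrite (lrpasteA I' D3 Vl) Teta_unit -(lpasteA I' Vd He) (colax_unitE Hd).
  by rewrite str_unit_slide.
Qed.
End Colax.
End Structure.

(** * T-cell equations for factors through a Kan extension *)

Section Factor.
Variables (K : avdc) (T : monad K).
Local Notation apath := (linked (@ht_dom K T) (@ht_cod K T)).

Lemma str_path_cell (A B : colax_algebra T) (Hs : seq (hTmor T)) (x : cell K) l k : apath A Hs B ->
  is_cell x (map (@ht_map K T) Hs) None l k -> vdom l = al_ob A ->
  composable x (al_str A) (str_path A Hs) (al_str B) /\
  is_cell (ccomp x (str_path A Hs)) (map (Fh T) (map (@ht_map K T) Hs)) None (l ∘ al_str A) (k ∘ al_str B).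
Proof.
move=> P H e; have C : composable x (al_str A) (str_path A Hs) (al_str B).
  apply: composableI H (@str_path_nonnil _ _ _ _) (str_path_chain P) (esym (str_path_htgts _ _)) _; bnd.
by split=> //; have := ccomp_cell C; rewrite str_path_hsrcs (cell_htgt H) (cell_vsrc H) (cell_vtgt H).
Qed.

Variables (A0 An B M : colax_algebra T) (Js Hs : seq (hTmor T)) (eta x : cell K) (d l k : vmor K).
Hypotheses (PJ : apath A0 Js An) (PH : apath An Hs B) (nJ : Js <> [::])
  (He : is_cell eta (map (@ht_map K T) Js) None d l) (Hx : is_cell x (map (@ht_map K T) Hs) None l k)
  (dM : vcod d = al_ob M).
Local Notation m := (al_str M).
Local Notation TJ := (map (Fh T) (map (@ht_map K T) Js)).
Local Notation strs := (map (@ht_cell K T) Js).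

Let lM_ : vcod l = al_ob M := nullary_tgt_cod He dM.
Let ldom : vdom l = al_ob An := nullary_tgt_dom PJ nJ He.

Lemma ccomp_str_paste : ccomp (eta ⊙ x) (str_path A0 (Js ++ Hs)) = ccomp eta strs ⊙ ccomp x (str_path An Hs).
Proof.
have C1 := eta_str_comp PJ nJ He; have [C2 _] := str_path_cell PH Hx ldom.
have C : composable (eta ⊙ x) (al_str A0) (strs ++ str_path An Hs) (al_str B).
  apply: composableI (npaste_cell He Hx) _ _ _ _; first by case: (Js) nJ.
  - by apply/linked_cat; exists (al_str An); [apply: comp_chain C1|apply: comp_chain C2].
  - by rewrite htgts_cat map_ht_htgts str_path_htgts.
  - by rewrite (comp_ver C1) (cell_vsrc He).
rewrite (ccomp_pair C1 C2); last 2 first.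
- by rewrite (cell_vtgt He) (cell_vsrc Hx).
- by left; apply: cell_htgt He.
(* For empty [Hs] the list [str_path An Hs] is not empty but a vertical identity, which has to be
   dropped from the composite; otherwise the two lists of structure cells simply concatenate. *)
case: (Hs) C => [|H Hs'] C; last first.
  have -> : str_path A0 (Js ++ H :: Hs') = map (@ht_cell K T) (Js ++ H :: Hs') by case: (Js) nJ.
  by rewrite map_cat.
rewrite cats0 in C *; have -> : str_path A0 Js = strs by case: (Js) nJ.
have [|_ ->] := ccomp_drop C; first by rewrite cats0; case: (Js) nJ.
by rewrite cats0.
Qed.

Variables (db lb kb : cell K) (wk : bool).
Hypothesis w0 : wk -> Hs = [::].
Let w1 : wk -> map (Fh T) (map (@ht_map K T) Hs) = [::]. Proof. by move/w0 => ->. Qed.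
Let Hy := str_path_cell PH Hx ldom.
Let Hz : is_cell (m ◁ T $c x) (map (Fh T) (map (@ht_map K T) Hs)) None (m ∘ T $v l) (m ∘ T $v k) :=
  lwhiskT_cell Hx lM_.

(** Pasted with m ∘ Tη, the equation for [x] becomes the one for [eta ⊙ x], once the equation for
    [eta] has moved [lb] across. Since m ∘ Tη is a Kan extension, the pasting can be cancelled. *)
Lemma lax_factor : is_vcell db (m ∘ T $v d) (d ∘ al_str A0) -> is_vcell lb (m ∘ T $v l) (l ∘ al_str An) ->
  is_vcell kb (m ∘ T $v k) (k ∘ al_str B) ->
  (m ◁ T $c eta) ⊙ lb = db ⊙ ccomp eta strs ->
  (m ◁ T $c (eta ⊙ x)) ⊙ kb = db ⊙ ccomp (eta ⊙ x) (str_path A0 (Js ++ Hs)) ->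
  lan wk (m ◁ T $c eta) (m ∘ T $v d) TJ (m ∘ T $v l) ->
  (m ◁ T $c x) ⊙ kb = lb ⊙ ccomp x (str_path An Hs).
Proof.
case: Hy => _ Hy' Hd Hl Hk E Ex L.
have HE := Teta_cell He dM.
apply: (lan_inj L w1 (rpaste_cell Hz Hk) (lpaste_cell Hl Hy')).
rewrite -(npasteA HE Hz Hk) -(lwhiskT_paste He Hx) // Ex ccomp_str_paste.
by rewrite -(npasteA Hd (eta_str_cell PJ nJ He) Hy') -E (npasteA HE Hl Hy').
Qed.

Lemma colax_factor : is_vcell db (d ∘ al_str A0) (m ∘ T $v d) -> is_vcell lb (l ∘ al_str An) (m ∘ T $v l) ->
  is_vcell kb (k ∘ al_str B) (m ∘ T $v k) ->
  db ⊙ (m ◁ T $c eta) = ccomp eta strs ⊙ lb ->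
  db ⊙ (m ◁ T $c (eta ⊙ x)) = ccomp (eta ⊙ x) (str_path A0 (Js ++ Hs)) ⊙ kb ->
  lan wk (ccomp eta strs) (d ∘ al_str A0) TJ (l ∘ al_str An) ->
  lb ⊙ (m ◁ T $c x) = ccomp x (str_path An Hs) ⊙ kb.
Proof.
case: Hy => _ Hy' Hd Hl Hk E Ex L.
have HE := Teta_cell He dM; have HS := eta_str_cell PJ nJ He.
apply: (lan_inj L w1 (lpaste_cell Hl Hz) (rpaste_cell Hy' Hk)).
rewrite -(npasteA HS Hl Hz) -E (npasteA Hd HE Hz) -(lwhiskT_paste He Hx) // Ex ccomp_str_paste.
by rewrite (npasteA HS Hy' Hk).
Qed.
End Factor.

Lemma Tcell_eq_lax (K : avdc) (T : monad K) w Js o (f g : vTmor T w) x : w <> Colax ->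
  lax_Tcell_eq Js o f g x -> Tcell_eq Js o f g x.
Proof. by case: w f g. Qed.
Lemma Tcell_eq_colax (K : avdc) (T : monad K) w Js o (f g : vTmor T w) x : w = Colax ->
  colax_Tcell_eq Js o f g x -> Tcell_eq Js o f g x.
Proof. by case: w f g. Qed.

(** * Left Kan extensions of T-algebras *)

Section Creation.
Variables (K : avdc) (T : monad K) (w : weakness).
Local Notation TA := (TAlg T w).
Local Notation U := (TAlg_forget T w).
Implicit Types (Phi Chi : cell TA) (d l k : vmor TA) (Js Hs : seq (hmor TA)) (wk : bool).

Lemma TAlg_cell_eq Phi Chi Js o d l : is_cell Phi Js o d l -> is_cell Chi Js o d l ->
  tc_cell Phi = tc_cell Chi -> Phi = Chi.
Proof. by case=> <- <- <- <- [e1 e2 e3 e4]; apply: Tcell_ext. Qed.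

Section Nullary.
Variables (Phi : cell TA) (Js : seq (hmor TA)) (d l : vmor TA).
Hypotheses (nJ : Js <> [::]) (HPhi : is_cell Phi Js None d l).
Local Notation m := (al_str (vt_cod d)).

Lemma ncell_path : linked (@ht_dom K T) (@ht_cod K T) (vt_dom d) Js (vt_dom l).
Proof. exact: cell_hpath HPhi. Qed.
Lemma ncell_cod : vt_cod l = vt_cod d. Proof. exact: cell_vcod HPhi. Qed.
Lemma ncell_cell : is_cell (tc_cell Phi) (map (@ht_map K T) Js) None (vt_map d) (vt_map l).
Proof. exact (F_is_cell U HPhi). Qed.
Lemma ncell_lax : w <> Colax -> (m ◁ T $c (tc_cell Phi)) ⊙ vt_cell l
  = vt_cell d ⊙ ccomp (tc_cell Phi) (str_path (vt_dom d) Js).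
Proof.
move=> n; have := lax_tc_eq Phi n; rewrite /cellZ /cellW /tgtS /srcP.
by case: HPhi => /= -> -> -> ->.
Qed.
Lemma ncell_colax : w = Colax -> vt_cell d ⊙ (m ◁ T $c (tc_cell Phi))
  = ccomp (tc_cell Phi) (str_path (vt_dom d) Js) ⊙ vt_cell l.
Proof.
move=> n; have := colax_tc_eq Phi n; rewrite /cellZ /cellW /tgtS /srcP.
by case: HPhi => /= -> -> -> ->.
Qed.
End Nullary.

(** A T-cell is determined by its boundary and its underlying cell, so uniqueness of factors is
    inherited from [K]; for existence, only the T-cell equation of the factor found in [K] has to be
    supplied. *)
Lemma TAlg_lanI wk Phi Js d l : Js <> [::] -> is_cell Phi Js None d l ->
  lan wk (tc_cell Phi) (vt_map d) (map (@ht_map K T) Js) (vt_map l) ->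
  (forall Hs k Chi x, (wk -> Hs = [::]) -> is_cell Chi (Js ++ Hs) None d k ->
     linked (@ht_dom K T) (@ht_cod K T) (vt_dom l) Hs (vt_dom k) -> vt_cod k = vt_cod d ->
     is_cell x (map (@ht_map K T) Hs) None (vt_map l) (vt_map k) -> tc_cell Phi ⊙ x = tc_cell Chi ->
     Tcell_eq Hs None l k x) ->
  lan wk Phi d Js l.
Proof.
move=> nJ H [HU L] eq.
have UP (X : cell TA) Hs k : is_cell X Hs None l k -> tc_cell (Phi ⊙ X) = tc_cell Phi ⊙ tc_cell X.
  move=> HX; apply: (F_hpaste U); first by rewrite (cell_vtgt H) (cell_vsrc HX).
  by left; apply: cell_htgt H.
apply: lanI => //.
  move=> Hs k Chi w0 HC.
  have [||x [[Hx ex] _]] := L (map (@ht_map K T) Hs) (vt_map k) (tc_cell Chi).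
  - by move/w0 => ->.
  - by rewrite -map_cat; apply: ncell_cell HC.
  have PH : linked (@ht_dom K T) (@ht_cod K T) (vt_dom l) Hs (vt_dom k).
    have /linked_cat [y p1 p2] := ncell_path HC.
    by rewrite (linked_uniq (ncell_path H) p1).
  have ck : vt_cod k = vt_cod d := ncell_cod HC.
  have PT : linked (@ht_dom K T) (@ht_cod K T) (vt_cod l) (oseq None) (vt_cod k).
    by rewrite /= ck (ncell_cod H).
  pose X : cell TA := TCell PH PT Hx (eq Hs k Chi x w0 HC PH ck Hx ex).
  have HX : is_cell X Hs None l k by [].
  exists X => //; apply: (TAlg_cell_eq (npaste_cell H HX) HC).
  by rewrite (UP _ _ _ HX).
move=> Hs k X Y w0 HX HY /(congr1 (@tc_cell K T w)); rewrite (UP _ _ _ HX) (UP _ _ _ HY) => e.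
apply: (TAlg_cell_eq HX HY).
apply: (lan_inj (conj HU L) (Hs := map (@ht_map K T) Hs)) e; first by move/w0 => ->.
  exact: ncell_cell HX.
exact: ncell_cell HY.
Qed.

(** The first Kan extension yields the factors in [K], the second their T-cell equations, through
    [lax_factor]. *)
Lemma TAlg_lan_lax wk Phi Js d l : w <> Colax -> Js <> [::] -> is_cell Phi Js None d l ->
  lan wk (tc_cell Phi) (vt_map d) (map (@ht_map K T) Js) (vt_map l) ->
  lan wk (al_str (vt_cod d) ◁ T $c (tc_cell Phi)) (al_str (vt_cod d) ∘ T $v (vt_map d))
    (map (Fh T) (map (@ht_map K T) Js)) (al_str (vt_cod d) ∘ T $v (vt_map l)) ->
  lan wk Phi d Js l.
Proof.
move=> n nJ H L LT; apply: TAlg_lanI => // Hs k Chi x w0 HC PH ck Hx ex.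
have HU := ncell_cell H.
have cl : vt_cod l = vt_cod d := ncell_cod H.
apply: Tcell_eq_lax => //.
rewrite /lax_Tcell_eq /= cl.
have strE : map (@ht_cell K T) Js = str_path (vt_dom d) Js by case: (Js) nJ.
apply: (lax_factor (ncell_path H) PH nJ HU Hx (vt_map_cod d) w0 _ _ _ _ _ LT).
- exact: lax_vt_cell.
- by have := lax_vt_cell l n; rewrite cl.
- by have := lax_vt_cell k n; rewrite ck.
- by rewrite strE; apply: ncell_lax.
- by rewrite ex; apply: ncell_lax.
Qed.

Lemma TAlg_lan_colax wk Phi Js d l : w = Colax -> Js <> [::] -> is_cell Phi Js None d l ->
  lan wk (tc_cell Phi) (vt_map d) (map (@ht_map K T) Js) (vt_map l) ->
  lan wk (ccomp (tc_cell Phi) (map (@ht_cell K T) Js)) (vt_map d ∘ al_str (vt_dom d))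
    (map (Fh T) (map (@ht_map K T) Js)) (vt_map l ∘ al_str (vt_dom l)) ->
  lan wk Phi d Js l.
Proof.
move=> n nJ H L LT; apply: TAlg_lanI => // Hs k Chi x w0 HC PH ck Hx ex.
have HU := ncell_cell H.
have cl : vt_cod l = vt_cod d := ncell_cod H.
apply: Tcell_eq_colax => //.
rewrite /colax_Tcell_eq /= cl.
have strE : map (@ht_cell K T) Js = str_path (vt_dom d) Js by case: (Js) nJ.
apply: (colax_factor (ncell_path H) PH nJ HU Hx (vt_map_cod d) w0 _ _ _ _ _ LT).
- exact: colax_vt_cell.
- by have := colax_vt_cell l n; rewrite cl.
- by have := colax_vt_cell k n; rewrite ck.
- by rewrite strE; apply: ncell_colax.
- by rewrite ex; apply: ncell_colax.
Qed.
End Creation.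

(** * Comparison of Kan extensions, and pointwise ones as ordinary ones *)

Section KanMore.
Variable K : avdc.
Implicit Types (wk pw : bool) (phi psi chi eta al be : cell K) (f g h k d l u v : vmor K) (s : seq (cell K)) (Js Hs : seq (hmor K)).

(** Factoring [be ⊙ e1] through [e2] gives a cell in the opposite direction, and both composites
    with [lb] are identities by uniqueness. It is applied with m ∘ Tη and η ∘ (J̄_1, ..., J̄_n) for
    [e1] and [e2]. *)
Lemma lan_compare wk e1 e2 d1 d2 l1 l2 Js lb db be : lan wk e1 d1 Js l1 -> lan wk e2 d2 Js l2 ->
  is_vcell lb l1 l2 -> is_vcell db d1 d2 -> is_vcell be d2 d1 ->
  db ⊙ be = vidc d1 -> be ⊙ db = vidc d2 -> e1 ⊙ lb = db ⊙ e2 -> vinvertible lb.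
Proof.
move=> L1 L2 Hl Hd Hb E1 E2 E; have [H1 _] := L1; have [H2 _] := L2.
have [x Hx ex] := lan_factv L2 (lpaste_cell Hb H1).
exists x; rewrite (cell_vsrc Hl) (cell_vtgt Hl); split=> //.
  apply: (lan_injv L1 (vcell_hpaste Hl Hx) (vidc_cell _)).
  rewrite -(npasteA H1 Hl Hx) E (npasteA Hd H2 Hx) ex -(npasteA Hd Hb H1) E1.
  by rewrite hpasteE1 ?hpaste1E ?(cell_vtgt H1) ?(cell_vsrc H1).
apply: (lan_injv L2 (vcell_hpaste Hx Hl) (vidc_cell _)).
rewrite -(npasteA H2 Hx Hl) ex (npasteA Hb H1 Hl) E -(npasteA Hb Hd H2) E2.
by rewrite hpasteE1 ?hpaste1E ?(cell_vtgt H2) ?(cell_vsrc H2).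
Qed.

(** [left_exact] hides the vertical boundary of the path behind existential quantifiers; a nonempty
    path has only one. *)
Lemma left_exactE pw wk d phis f g eta l : left_exact pw wk d phis -> chain f phis g ->
  defines_lan pw wk eta d (htgts phis) l -> defines_lan pw wk (ccomp eta phis) (d ∘ f) (hsrcs phis) (l ∘ g).
Proof.
case=> f0 [fn [[n c _] _ X]] c'; have [<- <-] := linked_src n c c'; exact: X.
Qed.

Lemma hidc_cartesian J : cartesian (hidc J : cell K).
Proof.
split; first by rewrite idE.
move=> chi h k; rewrite !idE => ec eh ek e1 e2.
have sc : vcomp (vid (hdom J)) h = h by rewrite vcomp1E.
have tc : vcomp (vid (hcod J)) k = k by rewrite vcomp1E.
exists chi; split; first by split; [split; rewrite ?ec ?e1 ?e2|rewrite ccomp1h].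
by move=> x [[_ e3 _ _] <-]; rewrite ccomp1h.
Qed.
Lemma hidc_restriction_r J : restriction_r (hidc J : cell K) J J (vid (hcod J)).
Proof. by split; [exact: hidc_cell|exact: hidc_cartesian]. Qed.
Lemma hidc_restriction_l J : restriction_l (hidc J : cell K) J J (vid (hdom J)).
Proof. by split; [exact: hidc_cell|exact: hidc_cartesian]. Qed.

(** Restrict along the identity of the endpoint, for which the identity cell of the last horizontal
    morphism is cartesian. *)
Lemma pointwise_lan_lan wk eta d Js l : pointwise_lan wk eta d Js l -> lan wk eta d Js l.
Proof.
case=> Js' [J [-> H P]].
have := P _ _ _ (vcod_id _) (hidc_restriction_r J).
have -> : rcons (map hidc Js') (hidc J) = map hidc (hsrc eta) by rewrite (cell_hsrc H) map_rcons.
rewrite ccomph1; last by rewrite (cell_hsrc H); case: (Js').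
rewrite vcompE1 //; have /linked_cat [y _ [_ <-]] : hpath (vdom d) (Js' ++ [:: J]) (vdom l).
  by rewrite cats1; apply: cell_hpath H.
by [].
Qed.
Lemma defines_lan_lan pw wk eta d Js l : defines_lan pw wk eta d Js l -> lan wk eta d Js l.
Proof. by case: pw => //; apply: pointwise_lan_lan. Qed.
End KanMore.

Lemma weakness_dec w : w = Colax \/ w <> Colax.
Proof. by case: w; [left|right|right]. Qed.

Lemma w_morphism_lax (K : avdc) (T : monad K) w (A C : colax_algebra T) f fb : w <> Colax ->
  w_morphism w A C f fb -> lax_morphism A C f fb.
Proof. by case: w => // _ []. Qed.
Lemma lax_w_morphism (K : avdc) (T : monad K) w (A C : colax_algebra T) f fb : w <> Colax ->
  lax_morphism A C f fb -> (w = Pseudo -> vinvertible fb) -> w_morphism w A C f fb.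
Proof. by case: w => // _ L I; split=> //; apply: I. Qed.

Lemma w_morphism_colax (K : avdc) (T : monad K) w (A C : colax_algebra T) f fb : w = Colax ->
  w_morphism w A C f fb <-> colax_morphism A C f fb.
Proof. by move=> ->. Qed.

(** * Lifting a Kan extension to a T-cell *)

Section Lift.
Variables (K : avdc) (T : monad K) (w : weakness).
Local Notation TA := (TAlg T w).
Local Notation U := (TAlg_forget T w).
Local Notation mu := (xv (mmu T)).
Local Notation iota := (xv (miota T)).
Local Notation apath := (linked (@ht_dom K T) (@ht_cod K T)).
Variables (d : vmor TA) (Js : seq (hmor TA)) (An : ob TA).
Hypotheses (nJ : Js <> [::]) (PJ : hpath (vdom d) Js An).
Local Notation UJ := (map (@ht_map K T) Js).
Local Notation TJ := (map (Fh T) UJ).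
Local Notation strs := (map (@ht_cell K T) Js).
Local Notation mus := (map (fun J => xh (mmu T) (ht_map J)) Js).
Local Notation iotas := (map (fun J => xh (miota T) (ht_map J)) Js).
Local Notation m := (al_str (vcod d : colax_algebra T)).
Local Notation a0 := (al_str (vdom d : colax_algebra T)).
Local Notation an := (al_str (An : colax_algebra T)).

Variables (eta : cell K) (l : vmor K) (wk : bool).
Hypothesis He : is_cell eta UJ None (vt_map d) l.
Let dM : vcod (vt_map d) = al_ob (vcod d) := vt_map_cod d.
Let ldom : vdom l = al_ob An := nullary_tgt_dom PJ nJ He.
Let lcod : vcod l = al_ob (vcod d) := nullary_tgt_cod He dM.

(** The predicate whose unique solution creation requires. The vertical target is left open, so
    uniqueness also concerns its structure cell. *)
Definition is_lift (Phi : cell TA) := [/\ hsrc Phi = Js, vsrc Phi = d & tc_cell Phi = eta].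

Lemma is_lift_cell (Phi : cell TA) : is_lift Phi -> [/\ is_cell Phi Js None d (vtgt Phi),
  vt_dom (vtgt Phi) = An, vt_cod (vtgt Phi) = vcod d & vt_map (vtgt Phi) = l].
Proof.
case=> e1 e2 e3; have H := tc_is_cell Phi; rewrite e3 in H.
have en : tc_htgt Phi = None by move: (cell_htgt H); rewrite (cell_htgt He); case: (tc_htgt Phi).
have HP : is_cell Phi Js None d (vtgt Phi) by [].
split=> //; last by rewrite -(cell_vtgt H) (cell_vtgt He).
  by have := cell_hpath HP => P; apply: linked_uniq P PJ.
exact: cell_vcod HP.
Qed.

(* The structure cell of a lift is determined by the T-cell equation. *)
Lemma lift_unique_lax (Phi Chi : cell TA) : w <> Colax ->
  lan wk (m ◁ T $c eta) (m ∘ T $v (vt_map d)) TJ (m ∘ T $v l) -> is_lift Phi -> is_lift Chi -> Phi = Chi.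
Proof.
move=> n L HP HC; have [P1 P2 P3 P4] := is_lift_cell HP; have [C1 C2 C3 C4] := is_lift_cell HC.
have [_ _ P5] := HP; have [_ _ C5] := HC.
suff e : vtgt Phi = vtgt Chi by rewrite e in P1; apply: (TAlg_cell_eq P1 C1); rewrite P5 C5.
apply: vTmor_ext; rewrite ?P2 ?P3 ?P4 ?C2 ?C3 ?C4 //.
have vP := lax_vt_cell (vtgt Phi : vTmor T w) n; rewrite P2 P3 P4 in vP.
have vC := lax_vt_cell (vtgt Chi : vTmor T w) n; rewrite C2 C3 C4 in vC.
have := ncell_lax P1 n; have := ncell_lax C1 n; rewrite P5 C5 => <-.
exact: (lan_injv L vP vC).
Qed.
Lemma lift_unique_colax (Phi Chi : cell TA) : w = Colax ->
  lan wk (ccomp eta strs) (vt_map d ∘ a0) TJ (l ∘ an) -> is_lift Phi -> is_lift Chi -> Phi = Chi.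
Proof.
move=> n L HP HC; have [P1 P2 P3 P4] := is_lift_cell HP; have [C1 C2 C3 C4] := is_lift_cell HC.
have [_ _ P5] := HP; have [_ _ C5] := HC.
suff e : vtgt Phi = vtgt Chi by rewrite e in P1; apply: (TAlg_cell_eq P1 C1); rewrite P5 C5.
apply: vTmor_ext; rewrite ?P2 ?P3 ?P4 ?C2 ?C3 ?C4 //.
have strE : strs = str_path (vt_dom d) Js by case: (Js) nJ.
have vP := colax_vt_cell (vtgt Phi : vTmor T w) n; rewrite P2 P3 P4 in vP.
have vC := colax_vt_cell (vtgt Chi : vTmor T w) n; rewrite C2 C3 C4 in vC.
have := ncell_colax P1 n; have := ncell_colax C1 n; rewrite P5 C5 -strE => ->.
by move/esym/(lan_injv L vP vC).
Qed.

Lemma lift_exists (lb : cell K) : w_morphism w An (vcod d) l lb ->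
  (w <> Colax -> (m ◁ T $c eta) ⊙ lb = vt_cell d ⊙ ccomp eta strs) ->
  (w = Colax -> vt_cell d ⊙ (m ◁ T $c eta) = ccomp eta strs ⊙ lb) ->
  exists Phi, is_lift Phi.
Proof.
move=> ok E1 E2; pose L := VTmor ldom lcod ok.
have strE : strs = str_path (vt_dom d) Js by case: (Js) nJ.
have eq : Tcell_eq Js None d L eta.
  case: (weakness_dec w) => n; [apply: Tcell_eq_colax|apply: Tcell_eq_lax] => //.
    by rewrite /colax_Tcell_eq -strE; apply: E2.
  by rewrite /lax_Tcell_eq -strE; apply: E1.
have PT : linked (@ht_dom K T) (@ht_cod K T) (vt_cod (d : vTmor T w)) (oseq None) (vt_cod L) by [].
by exists (TCell (PJ : apath (vt_dom d) Js (vt_dom L)) PT He eq).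
Qed.

Let Hmu : htgts mus = TJ. Proof. by rewrite (map_cell_htgts (@mu_cell K T)) -map_comp. Qed.
Let Hmu' : hsrcs mus = map (Fh T) TJ. Proof. by rewrite (map_cell_hsrcs (@mu_cell K T)) -!map_comp. Qed.
Let Hiota : htgts iotas = TJ. Proof. by rewrite (map_cell_htgts (@iota_cell K T)) -map_comp. Qed.
Let Hiota' : hsrcs iotas = UJ. Proof. exact: (map_cell_hsrcs (@iota_cell K T)). Qed.
Let cmu : chain (mu (al_ob (vdom d))) mus (mu (al_ob An)).
Proof. exact: (map_cell_chain (u := fun A => mu (al_ob A)) (@mu_cell K T) PJ). Qed.
Let ciota : chain (iota (al_ob (vdom d))) iotas (iota (al_ob An)).
Proof. exact: (map_cell_chain (u := fun A => iota (al_ob A)) (@iota_cell K T) PJ). Qed.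
Let cstr : chain a0 strs an.
Proof. exact: (map_cell_chain (@ht_str_cell K T) PJ). Qed.

Variable pw : bool.
Hypothesis Le : defines_lan pw wk eta (vt_map d) UJ l.

Lemma condition_p_lan : condition_p pw wk d Js -> defines_lan pw wk (m ◁ T $c eta) (m ∘ T $v (vt_map d)) TJ (m ∘ T $v l).
Proof. by case=> + _ _; apply. Qed.

Lemma condition_e_lan : condition_e pw wk d Js -> defines_lan pw wk (ccomp eta strs) (vt_map d ∘ a0) TJ (l ∘ an).
Proof.
case=> X _ _; have := left_exactE X cstr; rewrite map_ht_htgts map_ht_hsrcs; exact.
Qed.

(** Exactness makes the composites of m ∘ Tη with the μ's and with the ι's Kan extensions, as
    [lax_structure] requires. Invertibility of l̄ in the pseudo case is a premise, since it has two
    sources: condition (e), or the left Beck-Chevalley condition. *)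
Lemma lift_lax : w <> Colax -> condition_p pw wk d Js ->
  (forall lb, is_vcell lb (m ∘ T $v l) (l ∘ an) -> (m ◁ T $c eta) ⊙ lb = vt_cell d ⊙ ccomp eta strs ->
     w = Pseudo -> vinvertible lb) ->
  exists Phi, unique is_lift Phi.
Proof.
move=> n Cp inv; have Lt := condition_p_lan Cp; have Lt' := defines_lan_lan Lt.
case: Cp => _ /left_exactE /(_ cmu) Xm /left_exactE /(_ ciota) Xi.
rewrite Hmu Hmu' in Xm; rewrite Hiota Hiota' in Xi.
have /defines_lan_lan Lm := Xm _ _ Lt; have /defines_lan_lan Li := Xi _ _ Lt.
have Hd := lax_vt_cell d n.
have [lb Hl E] := lan_factv Lt' (lpaste_cell Hd (eta_str_cell PJ nJ He)).
have Ld : lax_morphism (vdom d) (vcod d) (vt_map d) (vt_cell d) := w_morphism_lax n (vt_ok d).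
have Ll := lax_structure PJ nJ He dM Ld Hl E Lm Li.
have ok := lax_w_morphism n Ll (inv lb Hl E).
have [//|//|Phi HPhi] := lift_exists ok.
by exists Phi; split=> // Chi; apply: lift_unique_lax n Lt' HPhi.
Qed.

Lemma lift_colax : w = Colax -> condition_e pw wk d Js -> exists Phi, unique is_lift Phi.
Proof.
move=> n Ce; have Lt := condition_e_lan Ce; have Lt' := defines_lan_lan Lt.
case: Ce => _ /left_exactE /(_ cmu) Xm /left_exactE /(_ ciota) Xi.
rewrite Hmu Hmu' in Xm; rewrite Hiota Hiota' in Xi.
have /defines_lan_lan Lm := Xm _ _ Lt; have /defines_lan_lan Li := Xi _ _ Lt.
have Hd := colax_vt_cell d n.
have [lb Hl E] := lan_factv Lt' (lpaste_cell Hd (Teta_cell He dM)).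
have Ld : colax_morphism (vdom d) (vcod d) (vt_map d) (vt_cell d).
  exact: (proj1 (w_morphism_colax _ _ _ _ n) (vt_ok d)).
have Ll := colax_structure PJ nJ He dM Ld Hl E Lm Li.
have ok := proj2 (w_morphism_colax _ _ _ _ n) Ll.
have [//|//|Phi HPhi] := lift_exists ok.
by exists Phi; split=> // Chi; apply: lift_unique_colax n Lt' HPhi.
Qed.
End Lift.

(** * The implications between (p), (e) and (l) *)

Section Ordinary.
Variables (K : avdc) (T : monad K).

(** Treats two cases at once: for lax morphisms the premise on (e) is vacuous, and for pseudo
    morphisms it supplies the second Kan extension from which [lan_compare] derives that l̄ is
    invertible. *)
Lemma condition_p_creates w wk (d : vmor (TAlg T w)) (Js : seq (hmor (TAlg T w))) An :
  w <> Colax -> Js <> [::] -> hpath (vdom d) Js An -> (w = Pseudo -> condition_e false wk d Js) ->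
  condition_p false wk d Js -> condition_l false wk d Js.
Proof.
move=> n nJ PJ Ce Cp eta l Le; have He := proj1 Le.
have Lt := condition_p_lan Le Cp.
have [|Phi HPhi] := lift_lax nJ PJ He Le n Cp.
  move=> lb Hl E ew; have Ls := condition_e_lan PJ Le (Ce ew).
  have [be] : vinvertible (vt_cell d) by have := vt_ok d; move: (d) {Le Lt Cp Ce E Ls PJ He Hl}; rewrite ew => d' [].
  have Hd := lax_vt_cell d n; rewrite (cell_vsrc Hd) (cell_vtgt Hd) => -[Hb E1 E2].
  exact: lan_compare Lt Ls Hl Hd Hb E1 E2 E.
exists Phi; split=> //.
have [H _ ec em] := is_lift_cell PJ He (proj1 HPhi).
have eP : tc_cell Phi = eta by case: HPhi => -[].
by apply: TAlg_lan_lax => //; rewrite eP em.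
Qed.

Lemma condition_e_creates w wk (d : vmor (TAlg T w)) (Js : seq (hmor (TAlg T w))) An :
  w = Colax -> Js <> [::] -> hpath (vdom d) Js An ->
  condition_e false wk d Js -> condition_l false wk d Js.
Proof.
move=> n nJ PJ Ce eta l Le; have He := proj1 Le.
have Lt := condition_e_lan PJ Le Ce.
have [Phi HPhi] := lift_colax nJ PJ He Le n Ce.
exists Phi; split=> //.
have [H ed ec em] := is_lift_cell PJ He (proj1 HPhi).
have eP : tc_cell Phi = eta by case: HPhi => -[].
by apply: TAlg_lan_colax => //; rewrite eP em // ed.
Qed.

Section Pseudo.
Variables (wk : bool) (d : vmor (TAlg T Pseudo)) (Js : seq (hmor (TAlg T Pseudo))) (An : ob (TAlg T Pseudo)).
Hypotheses (nJ : Js <> [::]) (PJ : hpath (vdom d) Js An).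
Local Notation UJ := (map (@ht_map K T) Js).
Local Notation TJ := (map (Fh T) UJ).
Local Notation strs := (map (@ht_cell K T) Js).
Local Notation m := (al_str (vcod d : colax_algebra T)).
Local Notation a0 := (al_str (vdom d : colax_algebra T)).
Local Notation an := (al_str (An : colax_algebra T)).

Lemma pseudo_inverse (f : vTmor T Pseudo) : exists be, [/\
  is_vcell (vt_cell f) (al_str (vt_cod f) ∘ T $v (vt_map f)) (vt_map f ∘ al_str (vt_dom f)),
  is_vcell be (vt_map f ∘ al_str (vt_dom f)) (al_str (vt_cod f) ∘ T $v (vt_map f)),
  vt_cell f ⊙ be = vidc (al_str (vt_cod f) ∘ T $v (vt_map f)) &
  be ⊙ vt_cell f = vidc (vt_map f ∘ al_str (vt_dom f))].
Proof.
have H : is_vcell _ _ _ := vt_cell_cell f.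
by case: (vt_ok f) => _ [be]; rewrite (cell_vsrc H) (cell_vtgt H) => -[Hb E1 E2]; exists be.
Qed.

(* Along the invertible structure cells of d and of the created lift, the cells
   m ∘ Tη and η ∘ (J̄_1, ..., J̄_n) are isomorphic. *)
Lemma lan_transfer eta l : condition_l false wk d Js -> lan wk eta (vt_map d) UJ l ->
  lan wk (m ◁ T $c eta) (m ∘ T $v (vt_map d)) TJ (m ∘ T $v l) <->
  lan wk (ccomp eta strs) (vt_map d ∘ a0) TJ (l ∘ an).
Proof.
move=> Cl Le; have He := proj1 Le.
have [Phi [[HPhi _] _]] := Cl eta l Le.
have [H ed ec em] := is_lift_cell PJ He HPhi.
have eP : tc_cell Phi = eta by case: HPhi.
have E := ncell_lax H (fun e : Pseudo = Colax => match e with end).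
have -> : strs = str_path (vt_dom d) Js by case: (Js) nJ.
have [b [Hb Hb' b1 b2]] := pseudo_inverse d.
have [c []] := pseudo_inverse (vtgt Phi); rewrite ed ec em => Hc Hc' c1 c2.
rewrite eP in E.
have [T1 T2] : is_cell (m ◁ T $c eta) TJ None (m ∘ T $v (vt_map d)) (m ∘ T $v l) /\
  is_cell (ccomp eta (str_path (vt_dom d) Js)) TJ None (vt_map d ∘ a0) (l ∘ an).
  split; first exact: Teta_cell He (vt_map_cod d).
  exact: (proj2 (str_path_cell PJ He (vt_map_dom d))).
split=> L.
  have := lan_isol Hb' Hb b2 b1 (lan_isor Hc Hc' c1 c2 L).
  by rewrite E -(npasteA Hb' Hb T2) b2 hpaste1E // (cell_vsrc T2).
have := lan_isor Hc' Hc c2 c1 (lan_isol Hb Hb' b1 b2 L).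
by rewrite -E (npasteA T1 Hc Hc') c1 hpasteE1 // (cell_vtgt T1).
Qed.

(** The exactness of the μ's and ι's passes from m ∘ Td to d ∘ a_0 along the invertible structure
    cell of [d]; exactness of the structure cells is [lan_transfer] combined with preservation. *)
Lemma condition_pl_e : condition_p false wk d Js -> condition_l false wk d Js -> condition_e false wk d Js.
Proof.
move=> Cp Cl; have [b [Hb Hb' b1 b2]] := pseudo_inverse d.
split; last 2 first.
- by apply: left_exact_iso Hb Hb' b1 b2 _; case: Cp.
- by apply: left_exact_iso Hb Hb' b1 b2 _; case: Cp.
exists a0, an; split.
- split; [by case: (Js) nJ|exact: map_ht_chain PJ|].
  by elim: (Js) => //= J Js' ->; rewrite (cell_htgt (ht_str_cell J)).
- by bnd.
move=> eta l; rewrite map_ht_htgts map_ht_hsrcs => Le.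
by apply/(lan_transfer Cl Le); apply: (condition_p_lan (pw := false) Le Cp).
Qed.

Lemma condition_el_p : condition_e false wk d Js -> condition_l false wk d Js -> condition_p false wk d Js.
Proof.
move=> Ce Cl; have [b [Hb Hb' b1 b2]] := pseudo_inverse d.
split; last 2 first.
- by apply: left_exact_iso Hb' Hb b2 b1 _; case: Ce.
- by apply: left_exact_iso Hb' Hb b2 b1 _; case: Ce.
move=> eta l Le; apply/(lan_transfer Cl Le); exact: (condition_e_lan (pw := false) PJ Le Ce).
Qed.
End Pseudo.
End Ordinary.

(** * Restrictions *)

Section Cartesian.
Variable K : avdc.
Implicit Types (phi psi chi c x y al be : cell K) (f g h k u v : vmor K) (J : hmor K) (Hs : seq (hmor K)) (o : option (hmor K)).

Lemma unary_cod phi Hs J h k : is_cell phi Hs (Some J) h k -> vcod h = hdom J /\ vcod k = hcod J.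
Proof. by case=> _ e <- <-; apply: htgt_path1. Qed.
Lemma unary_dom phi J o h k : is_cell phi [:: J] o h k -> vdom h = hdom J /\ vdom k = hcod J.
Proof. by case=> e _ <- <-; apply: hsrc_path1. Qed.

Lemma ccomp1_on c J o f g x Hs h k : is_cell c [:: J] o f g -> is_cell x Hs (Some J) h k ->
  composable c h [:: x] k /\ is_cell (ccomp c [:: x]) Hs o (f ∘ h) (g ∘ k).
Proof.
move=> Hc Hx; have e : vcod h = vdom f by rewrite (unary_dom Hc).1 (unary_cod Hx).1.
by split; [apply: comp1I Hc Hx _ e|apply: comp1_cell Hc Hx _ e].
Qed.

Lemma restriction_fact c J o f g chi Hs h k : restriction c J o f g -> vcod h = hdom J -> vcod k = hcod J ->
  is_cell chi Hs o (f ∘ h) (g ∘ k) -> exists2 x, is_cell x Hs (Some J) h k & ccomp c [:: x] = chi.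
Proof.
case=> Hc [_ C] eh ek Hx; have [e1 e2] := unary_dom Hc.
have [] := C chi h k; rewrite ?(cell_htgt Hc) ?(cell_htgt Hx) ?(cell_vsrc Hc) ?(cell_vsrc Hx) ?(cell_vtgt Hc) ?(cell_vtgt Hx) ?(cell_hsrc Hc) ?(cell_hsrc Hx) ?e1 ?e2 //.
by move=> x [[Hx' ex] _]; exists x.
Qed.
Lemma restriction_inj c J o f g x y Hs h k : restriction c J o f g ->
  is_cell x Hs (Some J) h k -> is_cell y Hs (Some J) h k -> ccomp c [:: x] = ccomp c [:: y] -> x = y.
Proof.
case=> Hc [_ C] Hx Hy e; have [e1 e2] := unary_dom Hc; have [e3 e4] := unary_cod Hx.
have [_ Hcx] := ccomp1_on Hc Hx.
have [] := C (ccomp c [:: x]) h k;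
  rewrite ?(cell_htgt Hc) ?(cell_htgt Hcx) ?(cell_vsrc Hc) ?(cell_vsrc Hcx) ?(cell_vtgt Hc) ?(cell_vtgt Hcx) ?(cell_hsrc Hc) ?(cell_hsrc Hcx) ?e1 ?e2 //.
by move=> z [_ Uz]; rewrite -(Uz x) // -(Uz y).
Qed.
Lemma restrictionI c J o f g : is_cell c [:: J] o f g ->
  (forall chi Hs h k, vcod h = hdom J -> vcod k = hcod J -> is_cell chi Hs o (f ∘ h) (g ∘ k) ->
     exists2 x, is_cell x Hs (Some J) h k & ccomp c [:: x] = chi) ->
  (forall x y Hs h k, is_cell x Hs (Some J) h k -> is_cell y Hs (Some J) h k ->
     ccomp c [:: x] = ccomp c [:: y] -> x = y) ->
  restriction c J o f g.
Proof.
move=> Hc E I; split=> //; split; first by rewrite (cell_hsrc Hc).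
have [e1 e2] := unary_dom Hc.
move=> chi h k; rewrite (cell_htgt Hc) (cell_hsrc Hc) (cell_vsrc Hc) (cell_vtgt Hc) e1 e2 => eo eh ek es et.
have [|x Hx ex] := E chi (hsrc chi) h k eh ek; first by split.
by exists x; split=> // y [Hy ey]; apply: I Hx Hy _; rewrite ex ey.
Qed.

Lemma restriction_comp c c1 J' J1 o f g f1 g1 : restriction c J' o f g -> restriction c1 J1 (Some J') f1 g1 ->
  restriction (ccomp c [:: c1]) J1 o (f ∘ f1) (g ∘ g1).
Proof.
move=> R R1; have [Hc _] := R; have [Hc1 _] := R1; have [C0 C] := ccomp1_on Hc Hc1.
have [a1 a2] := unary_dom Hc; have [b1 b2] := unary_cod Hc1; have [d1 d2] := unary_dom Hc1.
have A (x : cell K) Hs h k : is_cell x Hs (Some J1) h k -> ccomp c [:: ccomp c1 [:: x]] = ccomp (ccomp c [:: c1]) [:: x].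
  by move=> Hx; have [C1 _] := ccomp1_on Hc1 Hx; apply: ccomp_ccomp1 C0 C1.
apply: restrictionI => //.
  move=> chi Hs h k eh ek Hchi.
  have H3 : is_cell chi Hs o (f ∘ (f1 ∘ h)) (g ∘ (g1 ∘ k)).
    by apply: is_cell_conv Hchi _ _; rewrite vcompA ?a1 ?a2 ?b1 ?b2 ?d1 ?d2.
  have [||y Hy ey] := restriction_fact R _ _ H3; rewrite ?vcod_comp ?d1 ?d2 //.
  have [//|//|x Hx ex] := restriction_fact R1 _ _ Hy.
  by exists x => //; rewrite -(A _ _ _ _ Hx) ex.
move=> x y Hs h k Hx Hy; rewrite -(A _ _ _ _ Hx) -(A _ _ _ _ Hy).
have [_ Hx1] := ccomp1_on Hc1 Hx; have [_ Hy1] := ccomp1_on Hc1 Hy.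
by move/(restriction_inj R Hx1 Hy1); apply: restriction_inj R1 Hx Hy.
Qed.

Lemma restriction_cancel c c1 J' J1 o f g f1 g1 : restriction c J' o f g -> is_cell c1 [:: J1] (Some J') f1 g1 ->
  restriction (ccomp c [:: c1]) J1 o (f ∘ f1) (g ∘ g1) -> restriction c1 J1 (Some J') f1 g1.
Proof.
move=> R Hc1 R1; have [Hc _] := R; have [C0 C] := ccomp1_on Hc Hc1.
have [a1 a2] := unary_dom Hc; have [b1 b2] := unary_cod Hc1; have [d1 d2] := unary_dom Hc1.
have A (x : cell K) Hs h k : is_cell x Hs (Some J1) h k -> ccomp c [:: ccomp c1 [:: x]] = ccomp (ccomp c [:: c1]) [:: x].
  by move=> Hx; have [C1 _] := ccomp1_on Hc1 Hx; apply: ccomp_ccomp1 C0 C1.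
apply: restrictionI => //.
  move=> chi Hs h k eh ek Hchi; have [_ H2] := ccomp1_on Hc Hchi.
  have H3 : is_cell (ccomp c [:: chi]) Hs o (f ∘ f1 ∘ h) (g ∘ g1 ∘ k).
    by apply: is_cell_conv H2 _ _; rewrite vcompA ?a1 ?a2 ?b1 ?b2 ?d1 ?d2.
  have [//|//|x Hx ex] := restriction_fact R1 _ _ H3.
  exists x => //; have [_ Hx1] := ccomp1_on Hc1 Hx.
  by apply: (restriction_inj R Hx1 Hchi); rewrite (A _ _ _ _ Hx).
move=> x y Hs h k Hx Hy e; apply: (restriction_inj R1 Hx Hy).
by rewrite -(A _ _ _ _ Hx) -(A _ _ _ _ Hy) e.
Qed.

(** Factorisations of a cell through [c ⊙ al] are those through [c] of the cell pasted with
    [be ▷ k]. Thus one may restrict along an isomorphic morphism. *)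
Lemma restriction_rpaste c J o f g g' al be : restriction c J o f g -> is_vcell al g g' -> is_vcell be g' g ->
  al ⊙ be = vidc g -> be ⊙ al = vidc g' -> restriction (c ⊙ al) J o f g'.
Proof.
move=> R Ha Hb ab ba; have [Hc _] := R; have [a1 a2] := unary_dom Hc.
have a3 : vdom g' = hcod J by rewrite (cell_vdom Ha).
have A (x : cell K) Hs h k : is_cell x Hs (Some J) h k -> ccomp (c ⊙ al) [:: x] = ccomp c [:: x] ⊙ (al ▷ k).
  by move=> Hx; have [C1 _] := ccomp1_on Hc Hx; apply: ccomp_rpaste Hc Ha C1.
have W k : vcod k = hcod J -> [/\ is_vcell (al ▷ k) (g ∘ k) (g' ∘ k), is_vcell (be ▷ k) (g' ∘ k) (g ∘ k),
    (al ▷ k) ⊙ (be ▷ k) = vidc (g ∘ k) & (be ▷ k) ⊙ (al ▷ k) = vidc (g' ∘ k)].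
  move=> ek; have e1 : vcod k = vdom g by rewrite a2.
  have e2 : vcod k = vdom g' by rewrite a3.
  split; [exact: rwhisk_cell Ha e1|exact: rwhisk_cell Hb e2| |].
    by rewrite -(rwhisk_hpaste Ha Hb) ?ab ?rwhisk_vidc //; left.
  by rewrite -(rwhisk_hpaste Hb Ha) ?ba ?rwhisk_vidc //; left.
apply: restrictionI; first exact: rpaste_cell Hc Ha.
  move=> chi Hs h k eh ek Hchi; have [Hak Hbk _ bak] := W k ek.
  have [//|//|x Hx ex] := restriction_fact R _ _ (rpaste_cell Hchi Hbk).
  by exists x => //; rewrite (A _ _ _ _ Hx) ex (rpasteA Hchi Hbk Hak) bak hpasteE1 // (cell_vtgt Hchi).
move=> x y Hs h k Hx Hy; rewrite (A _ _ _ _ Hx) (A _ _ _ _ Hy).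
have [Hak Hbk abk _] := W k (unary_cod Hx).2.
have [_ Hcx] := ccomp1_on Hc Hx; have [_ Hcy] := ccomp1_on Hc Hy.
move/(congr1 (fun z => z ⊙ (be ▷ k))); rewrite (rpasteA Hcx Hak Hbk) (rpasteA Hcy Hak Hbk) abk.
rewrite !hpasteE1 ?(cell_vtgt Hcx) ?(cell_vtgt Hcy) //; exact: restriction_inj R Hx Hy.
Qed.

Lemma restriction_r_dom c J' J f : restriction_r c J' J f -> hdom J' = hdom J /\ hcod J' = vdom f.
Proof. by case=> /unary_dom [<- <-] _; rewrite vdom_id. Qed.
Lemma restriction_r_cod c J' J f : restriction_r c J' J f -> vcod f = hcod J.
Proof. by case=> /unary_cod []. Qed.

Lemma restriction_r_comp c c1 J J' J1 f g : restriction_r c J' J f -> restriction_r c1 J1 J' g ->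
  restriction_r (ccomp c [:: c1]) J1 J (f ∘ g).
Proof.
move=> R R1; have := restriction_comp R R1.
by rewrite (restriction_r_dom R).1 vcomp1E ?vcod_id.
Qed.
Lemma restriction_r_cancel c c1 J J' J1 f g : restriction_r c J' J f -> is_cell c1 [:: J1] (Some J') (vid (hdom J')) g ->
  restriction_r (ccomp c [:: c1]) J1 J (f ∘ g) -> restriction_r c1 J1 J' g.
Proof.
move=> R H R1; apply: (restriction_cancel R H).
by rewrite (restriction_r_dom R).1 vcomp1E ?vcod_id.
Qed.
Lemma restriction_r_fact c c1 J J' J1 f g : restriction_r c J' J f -> restriction_r c1 J1 J (f ∘ g) -> vcod g = vdom f ->
  exists2 x, restriction_r x J1 J' g & ccomp c [:: x] = c1.
Proof.
move=> R R1 e; have [H1 _] := R1; have [e1 e2] := restriction_r_dom R.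
have [|||x Hx ex] := restriction_fact (h := vid (hdom J)) (k := g) (chi := c1) (Hs := [:: J1]) R.
- by rewrite vcod_id e1.
- by rewrite e2.
- by rewrite vcomp1E ?vcod_id.
exists x => //; apply: (restriction_r_cancel R); rewrite ?e1 ?ex //.
Qed.
End Cartesian.

(* Two restrictions of J along f factor through each other, so any of them is
   sent to a cartesian cell as soon as one is. *)
Lemma functor_restriction (L K : avdc) (F : functor L K) c c' J' J'' J f :
  restriction_r c J' J f -> restriction_r c' J'' J f ->
  restriction_r (Fc F c) (Fh F J') (Fh F J) (Fv F f) -> restriction_r (Fc F c') (Fh F J'') (Fh F J) (Fv F f).
Proof.
move=> R R' RF; have [H _] := R; have [H' _] := R'.
have [e1 e2] := restriction_r_dom R; have [e1' e2'] := restriction_r_dom R'.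
have X (x y : cell L) Jx Jy : hcod Jx = vdom f -> restriction_r x Jx J f -> restriction_r y Jy J f ->
    exists2 z, is_cell z [:: Jy] (Some Jx) (vid (hdom J)) (vid (vdom f)) & ccomp x [:: z] = y.
  move=> ex Rx Ry; apply: (restriction_fact (h := vid (hdom J)) (k := vid (vdom f)) Rx).
  - by rewrite vcod_id (restriction_r_dom Rx).1.
  - by rewrite vcod_id.
  - by rewrite vcomp1E ?vcod_id // vcompE1 //; case: Ry.
have [s Hs es] := X c' c J'' J' e2' R' R; have [t Ht et] := X c c' J' J'' e2 R R'.
have [C1 _] := ccomp1_on H' Hs; have [C2 _] := ccomp1_on H Ht; have [C3 Hst] := ccomp1_on Hs Ht.
have st : ccomp s [:: t] = hidc J''.
  apply: (restriction_inj R' Hst).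
    by rewrite !vcompE1 ?vdom_id // -e1' -e2'; apply: hidc_cell.
  rewrite (ccomp_ccomp1 C1 C3) es et -[RHS]/(ccomp c' (map hidc [:: J''])) -(cell_hsrc H') ccomph1 //.
  by rewrite (cell_hsrc H').
have HF' := F_is_cell F H'; rewrite F_vid -F_hdom /= in HF'.
have FHs := F_is_cell F Hs; have FHt := F_is_cell F Ht; rewrite /= in FHs FHt.
have [HF _] := RF.
have Es : ccomp (Fc F c') [:: Fc F s] = Fc F c by rewrite -[RHS](congr1 (Fc F) es) (F_ccomp F C1).
have Et : ccomp (Fc F c) [:: Fc F t] = Fc F c' by rewrite -[RHS](congr1 (Fc F) et) (F_ccomp F C2).
have Est : ccomp (Fc F s) [:: Fc F t] = hidc (Fh F J'') by rewrite -F_hidc -[in RHS]st (F_ccomp F C3).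
have eJ : hdom (Fh F J') = hdom (Fh F J) by rewrite !F_hdom e1.
have fJ : hcod (Fh F J') = Fo F (vdom f) by rewrite F_hcod e2.
have eJ' : hdom (Fh F J'') = hdom (Fh F J) by rewrite !F_hdom e1'.
have fJ' : hcod (Fh F J'') = Fo F (vdom f) by rewrite F_hcod e2'.
rewrite !F_vid -F_hdom in FHs FHt.
apply: restrictionI => //.
  move=> chi Hs0 h k eh ek Hchi.
  have [||x Hx ex] := restriction_fact RF _ _ Hchi; rewrite ?eh ?ek ?eJ ?eJ' ?fJ ?fJ' //.
  have [C4 H4] := ccomp1_on FHs Hx; exists (ccomp (Fc F s) [:: x]).
    by apply: is_cell_conv H4 _ _; rewrite vcomp1E // ?eh ?ek.
  by rewrite (ccomp_ccomp1 (proj1 (ccomp1_on HF' FHs)) C4) Es.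
have idl (x : cell K) Hs0 h k : is_cell x Hs0 (Some (Fh F J'')) h k ->
    ccomp (Fc F s) [:: ccomp (Fc F t) [:: x]] = x.
  move=> Hx; have [C4 _] := ccomp1_on FHt Hx.
  by rewrite (ccomp_ccomp1 (proj1 (ccomp1_on FHs FHt)) C4) Est (ccomp1h (cell_htgt Hx)).
move=> x y Hs0 h k Hx Hy; have [C4 H4] := ccomp1_on FHt Hx; have [C5 H5] := ccomp1_on FHt Hy.
have [C6 _] := ccomp1_on HF FHt.
rewrite -Et -(ccomp_ccomp1 C6 C4) -(ccomp_ccomp1 C6 C5) => /(restriction_inj RF H4 H5) E.
by rewrite -(idl _ _ _ _ Hx) -(idl _ _ _ _ Hy) E.
Qed.

(** * Restrictions of horizontal T-morphisms *)

Section RestrictionStructure.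
Variables (K : avdc) (T : monad K).
Local Notation mu := (xv (mmu T)).
Local Notation iota := (xv (miota T)).
Local Notation mu_h := (xh (mmu T)).
Local Notation iota_h := (xh (miota T)).

Lemma mu_cell_nat (c : cell K) J' J f g : is_cell c [:: J'] (Some J) f g ->
  ccomp (T $c c) [:: mu_h J'] = ccomp (mu_h J) [:: T $c (T $c c)].
Proof. by case=> e1 e2 _ _; have := xh_nat (mmu T) c; rewrite e1 e2. Qed.
Lemma iota_cell_nat (c : cell K) J' J f g : is_cell c [:: J'] (Some J) f g ->
  ccomp (T $c c) [:: iota_h J'] = ccomp (iota_h J) [:: c].
Proof. by case=> e1 e2 _ _; have := xh_nat (miota T) c; rewrite e1 e2. Qed.

Variables (J : hTmor T) (B : colax_algebra T) (f : vmor K) (fb c : cell K) (J' : hmor K).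
Local Notation A := (ht_dom J). Local Notation C := (ht_cod J).
Local Notation a := (al_str A). Local Notation an := (al_str C). Local Notation b := (al_str B).
Local Notation Jb := (ht_cell J).
Hypotheses (fB : vdom f = al_ob B) (Hf : lax_morphism B C f fb) (R : restriction_r c J' (ht_map J) f).

Let fC : vcod f = al_ob C. Proof. by rewrite (restriction_r_cod R) ht_map_cod. Qed.
Let HJd : hdom J' = al_ob A. Proof. by rewrite (restriction_r_dom R).1 ht_map_dom. Qed.
Let HJc : hcod J' = al_ob B. Proof. by rewrite (restriction_r_dom R).2. Qed.
Let Hc : is_cell c [:: J'] (Some (ht_map J)) (vid (al_ob A)) f.
Proof. by case: R => H _; rewrite ht_map_dom in H. Qed.
Let HTc : is_cell (T $c c) [:: T $h J'] (Some (T $h (ht_map J))) (vid (T $o (al_ob A))) (T $v f).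
Proof. by have := F_is_cell T Hc; rewrite F_vid. Qed.
Let Hfb := lax_cell Hf.
Let HJ := ht_str_cell J.
Let HJTc : is_cell (ccomp Jb [:: T $c c]) [:: T $h J'] (Some (ht_map J)) a (an ∘ T $v f).
Proof. by apply: is_cell_conv (ccomp1_on HJ HTc).2 _ _; rewrite ?vcompE1 //; bnd. Qed.

(** To factor through [c], a cell must have a vertical target of the form [f ∘ b]. The lax direction
    of [fb] is what leads from [an ∘ T $v f] to it. *)
Definition restr_cell : cell K := ccomp Jb [:: T $c c] ⊙ fb.

Lemma restr_cell_cell : is_cell restr_cell [:: T $h J'] (Some (ht_map J)) a (f ∘ b).
Proof. exact: rpaste_cell HJTc Hfb. Qed.

Lemma restr_str_exists : exists2 Jb', is_cell Jb' [:: T $h J'] (Some J') a b & ccomp c [:: Jb'] = restr_cell.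
Proof.
apply: (restriction_fact R); rewrite ?HJd ?HJc ?al_str_cod //.
by apply: is_cell_conv restr_cell_cell _ _; rewrite // ht_map_dom vcomp1E // al_str_cod.
Qed.

Variable Jb' : cell K.
Hypotheses (HJb' : is_cell Jb' [:: T $h J'] (Some J') a b) (E : ccomp c [:: Jb'] = restr_cell).

Let vc := cell_vsrc Hc. Let vc' := cell_vtgt Hc.

Lemma restr_whisk (x : cell K) Hs h k : is_cell x Hs (Some (T $h J')) h k ->
  ccomp c [:: ccomp Jb' [:: x]] = ccomp (ccomp Jb [:: T $c c]) [:: x] ⊙ (fb ▷ k).
Proof.
move=> Hx; have [C1 _] := ccomp1_on HJb' Hx; have [C0 _] := ccomp1_on Hc HJb'.
rewrite (ccomp_ccomp1 C0 C1) E; have [C2 _] := ccomp1_on HJTc Hx.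
exact: ccomp_rpaste HJTc Hfb C2.
Qed.

Let Hmu : is_cell (mu_h J') [:: T $h (T $h J')] (Some (T $h J')) (mu (al_ob A)) (mu (al_ob B)).
Proof. by rewrite -HJd -HJc; apply: (xh_cell (mmu T)). Qed.
Let Hiota : is_cell (iota_h J') [:: J'] (Some (T $h J')) (iota (al_ob A)) (iota (al_ob B)).
Proof. by rewrite -HJd -HJc; apply: (xh_cell (miota T)). Qed.
Let HTTc : is_cell (T $c (T $c c)) [:: T $h (T $h J')] (Some (T $h (T $h (ht_map J)))) (vid (T $o (T $o (al_ob A)))) (T $v (T $v f)).
Proof. by have := F_is_cell T HTc; rewrite F_vid. Qed.
Let HTJb' : is_cell (T $c Jb') [:: T $h (T $h J')] (Some (T $h J')) (T $v a) (T $v b).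
Proof. exact: (F_is_cell T HJb'). Qed.
Let Hta := al_assoc_cell A. Let Htn := al_assoc_cell C. Let Htb := al_assoc_cell B.
Let Hua := al_unit_cell A. Let Hun := al_unit_cell C. Let Hub := al_unit_cell B.

(** It is enough to compare both sides after composition with the cartesian [c]. There the equation
    combines the associativity axiom of [f], naturality of μ at [c], the associativity axiom of [J],
    and the image of [E] under [T]. *)
Lemma restr_assocE : ccomp Jb' [:: mu_h J'] ⊙ al_assoc B = al_assoc A ⊙ ccomp Jb' [:: T $c Jb'].
Proof.
have [C1 H1] := ccomp1_on HJb' Hmu; have [C2 H2] := ccomp1_on HJb' HTJb'.
have L1 := rpaste_cell H1 Htb; have L2 := lpaste_cell Hta H2.
apply: (restriction_inj R L1 L2).
have [D1 _] := ccomp1_on Hc H1; have [D2 _] := ccomp1_on Hc H2.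
rewrite (ccomp_rwhisk H1 Htb D1) vc' (ccomp_lwhisk Hta H2 D2) vc.
rewrite (lwhisk_vid Hta); last by bnd.
rewrite (restr_whisk Hmu) (restr_whisk HTJb').
have [F0 F1] := ccomp1_on HJTc Hmu.
have S1 : is_vcell (fb ▷ mu (al_ob B)) (an ∘ T $v f ∘ mu (al_ob B)) (f ∘ b ∘ mu (al_ob B)).
  by apply: rwhisk_cell Hfb _; bnd.
have S2 : is_vcell (f ◁ al_assoc B) (f ∘ b ∘ mu (al_ob B)) (f ∘ b ∘ T $v b).
  by apply: is_cell_conv (lwhisk_cell Htb _) _ _; bnd; vnorm.
rewrite (rpasteA F1 S1 S2) -(lax_assocE Hf).
have S3 : is_vcell (al_assoc C ▷ T $v (T $v f)) (an ∘ T $v f ∘ mu (al_ob B)) (an ∘ T $v an ∘ T $v (T $v f)).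
  apply: is_cell_conv (rwhisk_cell Htn _) _ _; bnd.
  by rewrite -vcompA; [|bnd..]; rewrite -(mu_nat T fB fC); vnorm.
have HTfb : is_vcell (T $c fb) (T $v an ∘ T $v (T $v f)) (T $v f ∘ T $v b).
  by apply: is_cell_conv (F_is_cell T Hfb) _ _ => /=; vnorm.
have S4 : is_vcell (an ◁ T $c fb) (an ∘ T $v an ∘ T $v (T $v f)) (an ∘ T $v f ∘ T $v b).
  by apply: is_cell_conv (lwhisk_cell HTfb _) _ _; bnd; vnorm.
have S5 : is_vcell (fb ▷ T $v b) (an ∘ T $v f ∘ T $v b) (f ∘ b ∘ T $v b) by apply: rwhisk_cell Hfb _; bnd.
rewrite -(rpasteA F1 (vcell_hpaste S3 S4) S5) -(rpasteA F1 S3 S4).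
have [G0 _] := ccomp1_on HJ HTc.
have [G1 G1'] := ccomp1_on HTc Hmu.
rewrite -(ccomp_ccomp1 G0 G1) (mu_cell_nat Hc).
have HmuJ := mu_cell J; have HTJ := Tstr_cell J.
have [G2 G2'] := ccomp1_on HmuJ HTTc; have [G3 G3'] := ccomp1_on HJ HmuJ.
rewrite (ccomp_ccomp1 G3 G2).
have [G4 G4'] := ccomp1_on G3' HTTc.
rewrite -(ccomp_rpaste G3' Htn G4) ht_assocE.
have [G5 G5'] := ccomp1_on HJ HTJ; have [G6 G6'] := ccomp1_on G5' HTTc.
rewrite (ccomp_lpaste Hta G5' G6) (rwhisk_vid Hta); last by bnd.
have [G7 G7'] := ccomp1_on HTJ HTTc.
rewrite -(ccomp_ccomp1 G5 G7).
have -> : ccomp (T $c Jb) [:: T $c (T $c c)] = T $c (ccomp Jb [:: T $c c]) by rewrite (F_ccomp T G0).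
have HX : is_cell (T $c (ccomp Jb [:: T $c c])) [:: T $h (T $h J')] (Some (T $h (ht_map J))) (T $v a) (T $v an ∘ T $v (T $v f)).
  by apply: is_cell_conv (F_is_cell T HJTc) _ _ => //; vnorm.
have [G8 G8'] := ccomp1_on HJ HX.
have -> : al_assoc A ⊙ ccomp Jb [:: T $c (ccomp Jb [:: T $c c])] ⊙ (an ◁ T $c fb) =
  al_assoc A ⊙ ccomp (ccomp Jb [:: T $c c]) [:: T $c Jb'].
  rewrite vcompA in G8'; [|by bnd..].
  rewrite (lrpasteA Hta G8' S4).
  have := ccomp_rwhisk HX HTfb G8; rewrite (cell_vtgt HJ) => <-.
  rewrite -F_hpaste; [|by rewrite (cell_vtgt HJTc) (cell_vsrc Hfb)|by right; apply: cell_htgt Hfb].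
  rewrite -/restr_cell -E; have [I1 _] := ccomp1_on Hc HJb'.
  by rewrite (F_ccomp T I1) /=; have [I2 _] := ccomp1_on HTc HTJb'; rewrite (ccomp_ccomp1 G0 I2).
have [I3 I3'] := ccomp1_on HJTc HTJb'.
by rewrite (lrpasteA Hta I3' S5).
Qed.

Lemma restr_unitE : ccomp Jb' [:: iota_h J'] ⊙ al_unit B = al_unit A ⊙ hidc J'.
Proof.
have [C1 H1] := ccomp1_on HJb' Hiota; have H2 := hidc_cell J'; rewrite HJd HJc in H2.
have L1 := rpaste_cell H1 Hub; have L2 := lpaste_cell Hua H2.
apply: (restriction_inj R L1 L2).
have [D1 _] := ccomp1_on Hc H1; have [D2 _] := ccomp1_on Hc H2.
rewrite (ccomp_rwhisk H1 Hub D1) vc' (ccomp_lwhisk Hua H2 D2) vc.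
rewrite (lwhisk_vid Hua); last by bnd.
rewrite (restr_whisk Hiota).
have [F0 F1] := ccomp1_on HJTc Hiota.
have S1 : is_vcell (fb ▷ iota (al_ob B)) (an ∘ T $v f ∘ iota (al_ob B)) (f ∘ b ∘ iota (al_ob B)).
  by apply: rwhisk_cell Hfb _; bnd.
have S2 : is_vcell (f ◁ al_unit B) (f ∘ b ∘ iota (al_ob B)) f.
  by apply: is_cell_conv (lwhisk_cell Hub _) _ _; bnd; rewrite ?vcompE1 //; vnorm.
rewrite (rpasteA F1 S1 S2) (lax_unitE Hf).
have [G0 _] := ccomp1_on HJ HTc; have [G1 G1'] := ccomp1_on HTc Hiota.
rewrite -(ccomp_ccomp1 G0 G1) (iota_cell_nat Hc).
have HiJ := iota_cell J.
have [G2 G2'] := ccomp1_on HiJ Hc; have [G3 G3'] := ccomp1_on HJ HiJ.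
rewrite (ccomp_ccomp1 G3 G2).
have [G4 G4'] := ccomp1_on G3' Hc.
rewrite -(ccomp_rpaste G3' Hun G4) ht_unitE.
have H4 := hidc_cell (ht_map J); rewrite ht_map_dom ht_map_cod in H4.
have [G5 G5'] := ccomp1_on H4 Hc.
rewrite (ccomp_lpaste Hua H4 G5) (rwhisk_vid Hua); last by bnd.
congr (_ ⊙ _); rewrite (ccomp1h (cell_htgt Hc)).
by rewrite -[RHS]/(ccomp c (map hidc [:: J'])) -(cell_hsrc Hc) ccomph1 // (cell_hsrc Hc).
Qed.

Definition restrT : hTmor T := HTmor HJd HJc HJb' restr_assocE restr_unitE.
End RestrictionStructure.

(** * Restrictions in T-Alg *)

Section TAlgRestriction.
Variables (K : avdc) (T : monad K) (w : weakness).
Local Notation TA := (TAlg T w).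
Local Notation U := (TAlg_forget T w).
Implicit Types (Phi Chi C : cell TA) (f h k : vmor TA) (J : hmor TA) (Hs : seq (hmor TA)).

Lemma comp_str_lax u v a b : w <> Colax -> comp_str T w u v a b = (b ▷ T $v u) ⊙ (v ◁ a).
Proof. by rewrite /comp_str; case: w. Qed.

Lemma unary_lax (X : cell TA) Hs J f h : w <> Colax -> is_cell X Hs (Some J) f h ->
  ccomp (ht_cell J) [:: T $c (tc_cell X)] ⊙ vt_cell h = vt_cell f ⊙ ccomp (tc_cell X) (str_path (vt_dom f) Hs).
Proof.
move=> n H; have := lax_tc_eq X n; rewrite /cellZ /cellW /tgtS /srcP.
by case: H => /= -> -> -> ->.
Qed.

(** By the definition of J̄', [c] is a T-cell out of [restrT]. The last two conjuncts retain how the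
    restriction was built, which its universal property does not record; the left Beck-Chevalley
    condition for [JT] is proved from them. *)
Lemma TAlg_restriction J f (c : cell K) (J' : hmor K) : w <> Colax -> vcod f = hcod J ->
  restriction_r c J' (ht_map J) (vt_map f) ->
  exists C JT, [/\ restriction_r C JT J f, tc_cell C = c, ht_map JT = J',
    ht_dom JT = hdom J /\ ht_cod JT = vdom f &
    ccomp c [:: ht_cell JT] = ccomp (ht_cell J) [:: T $c c] ⊙ vt_cell f].
Proof.
move=> n ef R.
have Lf : lax_morphism (vt_dom f) (ht_cod J) (vt_map f) (vt_cell f).
  by have := w_morphism_lax n (vt_ok f); rewrite [vt_cod f]ef.
have fB := vt_map_dom f.
have [Jb' HJb' E] := restr_str_exists fB Lf R.
pose JT := restrT fB Lf R HJb' E.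
have ps : linked (@ht_dom K T) (@ht_cod K T) (vt_dom (vTid w (ht_dom J))) [:: JT] (vt_dom f) by [].
have pt : linked (@ht_dom K T) (@ht_cod K T) (vt_cod (vTid w (ht_dom J))) (oseq (Some J)) (vt_cod f).
  by split=> //; rewrite [vt_cod f]ef.
have Hc : is_cell c (map (@ht_map K T) [:: JT]) (omap (@ht_map K T) (Some J)) (vt_map (vTid w (ht_dom J))) (vt_map f).
  by have [H _] := R; rewrite ht_map_dom in H.
have HJ := ht_str_cell J.
have eq : Tcell_eq [:: JT] (Some J) (vTid w (ht_dom J)) f c.
  apply: Tcell_eq_lax => //; rewrite /lax_Tcell_eq /= E -/(restr_cell J (vt_cell f) c).
  by rewrite hpaste1E // (cell_vsrc (restr_cell_cell Lf R)).
pose C : cell TA := TCell ps pt Hc eq.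
exists C, JT; split=> //.
have HC : is_cell C [:: JT] (Some J) (vid (hdom J)) f by [].
have UCC (X : cell TA) Hs h k : is_cell X Hs (Some JT) h k -> tc_cell (ccomp C [:: X]) = ccomp c [:: tc_cell X].
  by move=> HX; apply: (F_ccomp U (ccomp1_on HC HX).1).
apply: restrictionI => //; last first.
  move=> X Y Hs h k HX HY /(congr1 (@tc_cell K T w)); rewrite (UCC _ _ _ _ HX) (UCC _ _ _ _ HY) => e.
  apply: (TAlg_cell_eq HX HY); apply: (restriction_inj R (F_is_cell U HX) (F_is_cell U HY) e).
move=> Chi Hs h k eh ek HChi; rewrite vcomp1E // in HChi.
have HU := F_is_cell U HChi.
have ek' : vcod k = vdom f by [].
have e1 : Fv U (f ∘ k) = vt_map f ∘ vt_map k := F_vcomp U ek'.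
rewrite e1 in HU.
have vh : vcod (vt_map h) = hdom (ht_map J) by rewrite vt_map_cod [vt_cod h]eh /= ht_map_dom.
have vk : vcod (vt_map k) = vdom (vt_map f) by rewrite vt_map_cod [vt_cod k]ek' vt_map_dom.
have [|||x Hx ex] := restriction_fact (h := vt_map h) (k := vt_map k) (chi := tc_cell Chi) (Hs := map (@ht_map K T) Hs) R.
- by rewrite vh (restriction_r_dom R).1.
- by rewrite vk (restriction_r_dom R).2.
- by rewrite vcomp1E.
have PH : linked (@ht_dom K T) (@ht_cod K T) (vt_dom h) Hs (vt_dom k).
  have := cell_hpath HChi; by rewrite vdom_comp.
have PT : linked (@ht_dom K T) (@ht_cod K T) (vt_cod h) (oseq (Some JT)) (vt_cod k).
  by split; [rewrite [vt_cod h]eh|rewrite [vt_cod k]ek].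
(* Cancelling the cartesian [c] reduces this to the T-cell equation of [Chi], whose vertical target
   is [f ∘ k]; hence the structure cell of a composite is unfolded in [e2]. *)
have eqx : Tcell_eq Hs (Some JT) h k x.
  apply: Tcell_eq_lax => //; rewrite /lax_Tcell_eq /=.
  have EC := unary_lax n HChi.
  have ekc : vt_cod k = vt_dom f by [].
  have e2 : vt_cell (f ∘ k : vmor TA) = (vt_cell f ▷ T $v (vt_map k)) ⊙ (vt_map f ◁ vt_cell k).
    rewrite -[f ∘ k]/(vTcomp f k) (vTcompE ekc); exact: comp_str_lax.
  rewrite e2 -ex in EC.
  have Hk := lax_vt_cell k n; rewrite ekc in Hk.
  have Hh := lax_vt_cell h n; rewrite [vt_cod h]eh in Hh.
  have Hf := lax_cell Lf.
  have HTx : is_cell (T $c x) (map (Fh T) (map (@ht_map K T) Hs)) (Some (T $h J')) (T $v (vt_map h)) (T $v (vt_map k)).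
    exact: (F_is_cell T Hx).
  have [C1 H1] := ccomp1_on HJb' HTx.
  have cH : vcod (al_str (vt_dom h)) = vdom (vt_map h) by bnd.
  have Cs : composable x (al_str (vt_dom h)) (str_path (vt_dom h) Hs) (al_str (vt_dom k)).
    apply: (composableI Hx (@str_path_nonnil _ _ _ _) (str_path_chain PH) (esym (str_path_htgts _ _)) cH).
  have H2 : is_cell (ccomp x (str_path (vt_dom h) Hs)) (map (Fh T) (map (@ht_map K T) Hs)) (Some J')
      (vt_map h ∘ al_str (vt_dom h)) (vt_map k ∘ al_str (vt_dom k)).
    by have := ccomp_cell Cs; rewrite str_path_hsrcs (cell_htgt Hx) (cell_vsrc Hx) (cell_vtgt Hx).
  apply: (restriction_inj R (rpaste_cell H1 Hk) (lpaste_cell Hh H2)).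
  have Hc' : is_cell c [:: J'] (Some (ht_map J)) (vid (al_ob (ht_dom J))) (vt_map f) := Hc.
  have [D1 D1'] := ccomp1_on Hc' H1; have [D2 _] := ccomp1_on Hc' H2.
  rewrite (ccomp_rwhisk H1 Hk D1) (cell_vtgt Hc') (ccomp_lwhisk Hh H2 D2) (cell_vsrc Hc').
  have e3 : vcod (T $v (vt_map h)) = vdom (al_str (ht_dom J)) by bnd; rewrite [vt_cod h]eh.
  have e4 : vcod (T $v (vt_map k)) = vdom (al_str (vt_dom f)) by bnd; rewrite ekc.
  have e5 : vcod (T $v (vt_map f)) = vdom (al_str (ht_cod J)) by bnd; rewrite [vt_cod f]ef.
  have e6 : vcod (T $v (vt_map k)) = vdom (T $v (vt_map f)) by bnd; rewrite ekc.
  rewrite (lwhisk_vid Hh); last by rewrite (vcod_comp e3) al_str_cod.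
  have [D3 _] := ccomp1_on Hc' Hx; rewrite (ccomp_ccomp1 D3 Cs) -EC.
  rewrite (restr_whisk Lf R HJb' E HTx).
  have HTc : is_cell (T $c c) [:: T $h J'] (Some (T $h (ht_map J))) (vid (T $o (al_ob (ht_dom J)))) (T $v (vt_map f)).
    by have := F_is_cell T Hc'; rewrite F_vid.
  have [G0 G0'] := ccomp1_on HJ HTc; have [G1 _] := ccomp1_on HTc HTx.
  have [G2 G2'] := ccomp1_on G0' HTx.
  rewrite -(ccomp_ccomp1 G0 G1).
  have -> : ccomp (T $c c) [:: T $c x] = T $c (ccomp c [:: x]) by rewrite (F_ccomp T D3).
  have [_ G3] := ccomp1_on HJ (F_is_cell T (ccomp1_on Hc' Hx).2).
  have G4 : is_vcell (vt_cell f ▷ T $v (vt_map k)) (al_str (ht_cod J) ∘ T $v (vt_map f ∘ vt_map k))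
      (vt_map f ∘ al_str (vt_dom f) ∘ T $v (vt_map k)).
    apply: is_cell_conv (rwhisk_cell Hf _) _ _ => //; first by rewrite (vdom_comp e5).
    by rewrite (F_vcomp T vk) vcompA.
  have G5 : is_vcell (vt_map f ◁ vt_cell k) (vt_map f ∘ al_str (vt_dom f) ∘ T $v (vt_map k)) (vt_map f ∘ (vt_map k ∘ al_str (vt_dom k))).
    apply: is_cell_conv (lwhisk_cell Hk _) _ erefl; first by rewrite (vcod_comp e4); bnd.
    by rewrite vcompA //; bnd.
  have G6 := rpasteA G3 G4 G5.
  by rewrite -G6.
pose X : cell TA := TCell PH PT Hx eqx.
have HX : is_cell X Hs (Some JT) h k by [].
exists X => //; apply: (TAlg_cell_eq (ccomp1_on HC HX).2); first by rewrite vcomp1E.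
by rewrite (UCC _ _ _ _ HX).
Qed.
End TAlgRestriction.

(** * Restricting the last morphism of the horizontal source *)

Section OnLast.
Variable K : avdc.
Implicit Types (eta c : cell K) (d l f : vmor K) (J : hmor K) (Js : seq (hmor K)).

Lemma on_last eta Js J J' o d l c f : is_cell eta (rcons Js J) o d l ->
  is_cell c [:: J'] (Some J) (vid (hdom J)) f ->
  composable eta (vid (vdom d)) (rcons (map hidc Js) c) f /\
  is_cell (ccomp eta (rcons (map hidc Js) c)) (rcons Js J') o d (l ∘ f).
Proof.
move=> H Hc; have := cell_hpath H; rewrite -!cats1 => /linked_cat [y p1 /= [ey _]].
have [q1 q2 q3] := map_hidc_path p1.
have C : composable eta (vid (vdom d)) (map hidc Js ++ [:: c]) f.
  apply: (composableI H); rewrite ?vcod_id //; first by case: (Js).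
    by apply/linked_cat; exists (vid y) => //; split; rewrite ?(cell_vtgt Hc) // (cell_vsrc Hc) ey.
  by rewrite htgts_cat q2 /htgts /= (cell_htgt Hc) cats1.
split=> //; have := ccomp_cell C.
by rewrite hsrcs_cat q3 /hsrcs /= cats0 (cell_htgt H) (cell_vsrc H) (cell_vtgt H) (cell_hsrc Hc) vcompf1.
Qed.

Lemma pointwise_lan_at wk eta d Js J l c J' f : pointwise_lan wk eta d (rcons Js J) l ->
  restriction_r c J' J f -> lan wk (ccomp eta (rcons (map hidc Js) c)) d (rcons Js J') (l ∘ f).
Proof.
case=> Js' [J2 [e _ P]] R; case: (rcons_inj e) => e1 e2; subst.
exact: P (restriction_r_cod R) R.
Qed.
End OnLast.

(** * Pointwise Kan extensions in T-Alg *)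

Section Pointwise.
Variables (K : avdc) (T : monad K) (w : weakness).
Local Notation TA := (TAlg T w).
Local Notation U := (TAlg_forget T w).
Implicit Types (Phi C : cell TA) (d l f : vmor TA) (J : hmor TA) (Js : seq (hmor TA)).

(** Both Kan extensions required by [TAlg_lan_lax] come from pointwise ones in [K]: η is restricted
    along the cell underlying [C], and m ∘ Tη along its image under [T], which is assumed
    cartesian. *)
Lemma TAlg_lan_restriction wk Phi Js J d l f C J' : w <> Colax -> is_cell Phi (rcons Js J) None d l ->
  pointwise_lan wk (tc_cell Phi) (vt_map d) (map (@ht_map K T) (rcons Js J)) (vt_map l) ->
  pointwise_lan wk (al_str (vt_cod d) ◁ T $c (tc_cell Phi)) (al_str (vt_cod d) ∘ T $v (vt_map d))
    (map (Fh T) (map (@ht_map K T) (rcons Js J))) (al_str (vt_cod d) ∘ T $v (vt_map l)) ->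
  vcod f = hcod J -> is_cell C [:: J'] (Some J) (vid (hdom J)) f ->
  restriction_r (tc_cell C) (ht_map J') (ht_map J) (vt_map f) -> cartesian (T $c (tc_cell C)) ->
  lan wk (ccomp Phi (rcons (map hidc Js) C)) d (rcons Js J') (l ∘ f).
Proof.
move=> n H L LT ef HC R TR.
have [c1 H1] := on_last H HC.
have HU := ncell_cell H; rewrite map_rcons in HU L LT.
have [HUC _] := R; have [d1 d1'] := on_last HU HUC.
have EU : tc_cell (ccomp Phi (rcons (map hidc Js) C)) =
    ccomp (tc_cell Phi) (rcons (map hidc (map (@ht_map K T) Js)) (tc_cell C)).
  rewrite -[LHS]/(Fc U _) (F_ccomp U c1) map_rcons -!map_comp; congr (ccomp _ (rcons _ _)).
have el : vcod f = vdom l.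
  by rewrite ef; have := cell_hpath H; rewrite -cats1 => /linked_cat [y _ [_ <-]].
have eU : vt_map (l ∘ f : vmor TA) = vt_map l ∘ vt_map f := F_vcomp U el.
apply: TAlg_lan_lax => //; first by case: (Js).
  by rewrite EU eU map_rcons; apply: pointwise_lan_at L R.
have RT : restriction_r (T $c (tc_cell C)) (T $h (ht_map J')) (T $h (ht_map J)) (T $v (vt_map f)).
  split=> //; have := F_is_cell T HUC; by rewrite F_vid F_hdom.
rewrite map_rcons in LT; have := pointwise_lan_at LT RT.
have HT := F_is_cell T HU; rewrite map_rcons in HT; have [d2 _] := on_last HT RT.1.
have dM : vcod (vt_map d) = al_ob (vt_cod d) := vt_map_cod d.
have el' : vcod (vt_map f) = vdom (vt_map l) by rewrite vt_map_cod vt_map_dom [vt_cod f]el.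
have lM' : vcod (vt_map l) = al_ob (vt_cod d) by rewrite (cell_vcod HU).
have e1 : vcod (T $v (vt_map f)) = vdom (T $v (vt_map l)) by rewrite F_vcod F_vdom el'.
have e2 : vcod (T $v (vt_map l)) = vdom (al_str (vt_cod d)) by rewrite F_vcod lM' al_str_dom.
rewrite EU eU (F_ccomp T d1) !map_rcons (F_vcomp T el') (vcompA e1 e2).
rewrite (lwhisk_ccomp (f := vid (vdom (T $v (vt_map d)))) (g := T $v (vt_map f)) (cell_htgt HT)); last 2 first.
- have -> : map (Fc T) (map hidc (map (@ht_map K T) Js)) = map hidc (map (Fh T) (map (@ht_map K T) Js)).
    by rewrite -!map_comp; apply: eq_map => J0 /=; rewrite F_hidc.
  exact: d2.
- by rewrite (cell_vsrc HT); bnd.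
congr (lan _ (ccomp _ (rcons _ _)) _ _ _).
by rewrite -!map_comp; apply: eq_map => J0 /=; rewrite F_hidc.
Qed.

(** The restriction [R] is given by its universal property in T-Alg alone. Comparing it with the
    restriction built from [K] shows that its underlying cell is cartesian in [K], hence preserved
    by [T]. *)
Lemma TAlg_pointwise_lan wk Phi Js J d l : w <> Colax -> is_cell Phi (rcons Js J) None d l ->
  (forall f, vcod f = hcod J -> has_restriction_r (ht_map J) (vt_map f) /\
     preserves_restriction_r T (ht_map J) (vt_map f)) ->
  pointwise_lan wk (tc_cell Phi) (vt_map d) (map (@ht_map K T) (rcons Js J)) (vt_map l) ->
  pointwise_lan wk (al_str (vt_cod d) ◁ T $c (tc_cell Phi)) (al_str (vt_cod d) ∘ T $v (vt_map d))
    (map (Fh T) (map (@ht_map K T) (rcons Js J))) (al_str (vt_cod d) ∘ T $v (vt_map l)) ->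
  pointwise_lan wk Phi d (rcons Js J) l.
Proof.
move=> n H X L LT; exists Js, J; split=> // f C J' ef R.
have [[c [Jc Rc]] Pr] := X f ef.
have [C0 [J0 [R0 E0 EJ _ _]]] := TAlg_restriction n ef Rc.
have R0' : restriction_r (Fc U C0) (Fh U J0) (Fh U J) (Fv U f) by rewrite /= E0 EJ.
have RU := functor_restriction R0 R R0'.
by apply: TAlg_lan_restriction ef R.1 RU (Pr _ _ RU).
Qed.
End Pointwise.

Lemma condition_p_creates_pointwise (K : avdc) (T : monad K) wk (d : vmor (TAlg T Lax)) (Js : seq (hmor (TAlg T Lax)))
    (Jn : hmor (TAlg T Lax)) (An : ob (TAlg T Lax)) :
  hpath (vdom d) (rcons Js Jn) An ->
  (forall f : vmor K, vcod f = Fo (TAlg_forget T Lax) An ->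
    has_restriction_r (Fh (TAlg_forget T Lax) Jn) f /\
    preserves_restriction_r T (Fh (TAlg_forget T Lax) Jn) f) ->
  condition_p true wk d (rcons Js Jn) -> condition_l true wk d (rcons Js Jn).
Proof.
move=> PJ X Cp eta l Le.
have nJ : rcons Js Jn <> [::] by case: (Js).
have He : is_cell eta (map (@ht_map K T) (rcons Js Jn)) None (vt_map d) l by case: Le => ? [? []].
have Lt := condition_p_lan Le Cp.
have [//|//|Phi HPhi] := lift_lax nJ PJ He Le _ Cp.
exists Phi; split=> //.
have [H ed ec em] := is_lift_cell PJ He (proj1 HPhi).
have eP : tc_cell Phi = eta by case: HPhi => -[].
have eA : hcod Jn = An by move: PJ; rewrite -cats1 => /linked_cat [y _ [_ <-]].
apply: TAlg_pointwise_lan => //; rewrite ?eP ?em //.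
by move=> f ef; apply: X; rewrite vt_map_cod [vt_cod f]ef eA.
Qed.

(** * The left Beck-Chevalley condition *)

Section Cocart.
Variable K : avdc.
Implicit Types (phi psi chi c x y : cell K) (phis : seq (cell K)) (f g h k : vmor K) (H J L : hmor K) (Hs Js : seq (hmor K)) (o : option (hmor K)).

Lemma weakly_cocartesian_fact f0 phis fn psi o h k : weakly_cocartesian f0 phis fn -> vcod f0 = vdom h -> vcod fn = vdom k ->
  is_cell psi (hsrcs phis) o (h ∘ f0) (k ∘ fn) ->
  exists2 x, is_cell x (htgts phis) o h k & ccomp x phis = psi.
Proof.
case=> _ W e1 e2 [p1 p2 p3 p4]; have [x [[Hx ex] _]] := W psi h k e1 e2 p1 p3 p4.
by exists x => //; rewrite -p2.
Qed.
Lemma weakly_cocartesian_inj f0 phis fn x y o h k : weakly_cocartesian f0 phis fn -> vcod f0 = vdom h -> vcod fn = vdom k ->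
  is_cell x (htgts phis) o h k -> is_cell y (htgts phis) o h k -> ccomp x phis = ccomp y phis -> x = y.
Proof.
case=> -[n c _] W e1 e2 Hx Hy e.
have [p1 p2 p3 p4] := ccomp_cell (composableI Hx n c erefl e1).
rewrite (cell_vsrc Hx) (cell_vtgt Hx) (cell_htgt Hx) in p2 p3 p4.
have [z [_ Uz]] := W _ h k e1 e2 p1 p3 p4; rewrite p2 in Uz.
by rewrite -(Uz x) // -(Uz y).
Qed.

Lemma weakly_cocartesianI f0 phis fn : unary_path f0 phis fn ->
  (forall psi o h k, vcod f0 = vdom h -> vcod fn = vdom k -> is_cell psi (hsrcs phis) o (h ∘ f0) (k ∘ fn) ->
     exists2 x, is_cell x (htgts phis) o h k & ccomp x phis = psi) ->
  (forall x y o h k, vcod f0 = vdom h -> vcod fn = vdom k ->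
     is_cell x (htgts phis) o h k -> is_cell y (htgts phis) o h k -> ccomp x phis = ccomp y phis -> x = y) ->
  weakly_cocartesian f0 phis fn.
Proof.
move=> U E I; split=> // psi h k e1 e2 p1 p3 p4.
have [|x Hx ex] := E psi (htgt psi) h k e1 e2; first by split.
by exists x; split=> // y [Hy ey]; apply: (I _ _ _ h k e1 e2 Hx Hy); rewrite ex ey.
Qed.

Lemma right_pointwise_cocartesian1 phi H L f0 : is_cell phi [:: H] (Some L) f0 (vid (hcod H)) ->
  right_pointwise_cocartesian f0 [:: phi] <->
  (forall f, vcod f = hcod H -> (has_restriction_r H f <-> has_restriction_r L f) /\
    forall c c' H' L' phi', restriction_r c H' H f -> restriction_r c' L' L f ->
      is_cell phi' [:: H'] (Some L') f0 (vid (vdom f)) -> ccomp phi [:: c] = ccomp c' [:: phi'] ->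
      cocartesian f0 [:: phi'] (vid (vdom f))).
Proof.
move=> Hphi; split.
  case=> phis [phi0 [Hs [H0 [L0 [e _ Hphi0 X]]]]].
  case: phis e X => [|p []] // [e]; rewrite -e in Hphi0 *.
  have := cell_hsrc Hphi0; rewrite (cell_hsrc Hphi); case: Hs Hphi0 => [|p []] // Hphi0 [eH].
  have := cell_htgt Hphi0; rewrite (cell_htgt Hphi) => -[eL]; rewrite -eH -eL (cell_vsrc Hphi).
  exact.
move=> X; exists [::], phi, [::], H, L; split=> //.
- by split=> //; [split; rewrite ?(cell_vsrc Hphi) ?(cell_vtgt Hphi)|rewrite /= (cell_htgt Hphi)].
- by rewrite (cell_vsrc Hphi).
- by rewrite (cell_vsrc Hphi).
Qed.

(** Take the identity for [f] and identity cells for both cartesian cells; the factorisation is then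
    [phi] itself. *)
Lemma right_pointwise_cocartesian_id phi H L f0 : is_cell phi [:: H] (Some L) f0 (vid (hcod H)) ->
  right_pointwise_cocartesian f0 [:: phi] -> cocartesian f0 [:: phi] (vid (hcod H)).
Proof.
move=> Hphi /(right_pointwise_cocartesian1 Hphi) X; have [_ Y] := X (vid (hcod H)) (vcod_id _).
have eL : hcod L = hcod H by have [_ <-] := unary_cod Hphi; rewrite vcod_id.
rewrite vdom_id in Y; apply: (Y (hidc H) (hidc L) H L) => //.
- exact: hidc_restriction_r.
- by rewrite -eL; apply: hidc_restriction_r.
- rewrite (ccomp1h (cell_htgt Hphi)).
  by rewrite -[LHS]/(ccomp phi (map hidc [:: H])) -(cell_hsrc Hphi) ccomph1 // (cell_hsrc Hphi).
Qed.

(** An identity cell is cartesian, so it may stand in the place of [cart]. *)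
Lemma right_extension_ids A Hs B : hpath A Hs B -> right_extension (vid A : vmor K) (map hidc Hs) (vid B).
Proof.
case: Hs => [|H Hs] /=; first by move=> ->; left.
case=> <- P; right; exists B, H, H, Hs, (hidc H); split=> //; first by rewrite vcod_id.
exact: hidc_restriction_l.
Qed.

Lemma paste_ids eta phis f X Js d l x Hs k : is_cell eta Js None d l -> composable eta f phis (vid X) ->
  is_cell x Hs None l k -> ccomp (eta ⊙ x) (phis ++ map hidc Hs) = ccomp eta phis ⊙ x.
Proof.
move=> He C Hx; have eX : X = vdom l by have := comp_ver_tgt C; rewrite (cell_vtgt He) vcod_id.
case: Hs Hx => [|H Hs] Hx.
  by rewrite cats0 (ccomp_rpaste He Hx C) (rwhisk_vid Hx) // eX.
have P := cell_hpath Hx; have [q1 q2 q3] := map_hidc_path P.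
have C' : composable x (vid (vdom l)) (map hidc (H :: Hs)) (vid (vdom k)).
  by apply: (composableI Hx) => //; rewrite vcod_id.
have Ex : ccomp x (map hidc (H :: Hs)) = x by rewrite -(cell_hsrc Hx) ccomph1 // (cell_hsrc Hx).
rewrite -{2}Ex; rewrite eX in C; rewrite (ccomp_pair C C') //.
  by rewrite (cell_vtgt He) (cell_vsrc Hx).
by left; apply: cell_htgt He.
Qed.
End Cocart.

Section LBC.
Variables (K : avdc) (T : monad K).
Local Notation apath := (linked (@ht_dom K T) (@ht_cod K T)).

(** The body of [left_Beck_Chevalley] with its witnesses as arguments. *)
Definition lbc_factor (J : hTmor T) (c : cell K) (J' : hmor K) (phi : cell K) : Prop :=
  [/\ restriction_r c J' (ht_map J) (al_str (ht_cod J)),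
    is_cell phi [:: T $h (ht_map J)] (Some J') (al_str (ht_dom J)) (vid (T $o (al_ob (ht_cod J)))),
    ccomp c [:: phi] = ht_cell J &
    right_pointwise_cocartesian (al_str (ht_dom J)) [:: phi]].

Lemma lbc_cocart J c J' phi : lbc_factor J c J' phi ->
  cocartesian (al_str (ht_dom J)) [:: phi] (vid (T $o (al_ob (ht_cod J)))).
Proof.
by case=> _ H _ R; have e : hcod (T $h (ht_map J)) = T $o (al_ob (ht_cod J)); [bnd|rewrite -e in H *; apply: right_pointwise_cocartesian_id H R].
Qed.

(* (J̄_1, ..., J̄_(i-1), J̄'_i, id, ..., id), where phi is the factor J̄'_i of J̄_i. *)
Definition stage (Js : seq (hTmor T)) (phi : cell K) (Hs : seq (hmor K)) : seq (cell K) :=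
  map (@ht_cell K T) Js ++ phi :: map hidc Hs.

Lemma stage_boundary (A0 : colax_algebra T) Js J c J' phi Hs B : apath A0 Js (ht_dom J) -> lbc_factor J c J' phi ->
  hpath (T $o (al_ob (ht_cod J))) Hs B ->
  [/\ chain (al_str A0) (stage Js phi Hs) (vid B),
    htgts (stage Js phi Hs) = map (@ht_map K T) Js ++ J' :: Hs &
    hsrcs (stage Js phi Hs) = map (Fh T) (map (@ht_map K T) Js) ++ T $h (ht_map J) :: Hs].
Proof.
move=> PJ [R Hp _ _] PH; have [q1 q2 q3] := map_hidc_path PH; split.
- apply/linked_cat; exists (al_str (ht_dom J)); first exact: map_ht_chain PJ.
  by split; rewrite ?(cell_vsrc Hp) ?(cell_vtgt Hp).
- by rewrite htgts_cat map_ht_htgts /htgts /= (cell_htgt Hp) /= -/(htgts _) q2.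
- by rewrite hsrcs_cat map_ht_hsrcs /hsrcs /= (cell_hsrc Hp) /= -/(hsrcs _) q3.
Qed.

Lemma stage_unary A0 Js J c J' phi Hs B : apath A0 Js (ht_dom J) -> lbc_factor J c J' phi ->
  hpath (T $o (al_ob (ht_cod J))) Hs B -> unary_path (al_str A0) (stage Js phi Hs) (vid B).
Proof.
move=> PJ F PH; have [x1 _ _] := stage_boundary PJ F PH.
split=> //; first by rewrite /stage; case: (Js).
rewrite /stage all_cat /=; case: F => _ Hp _ _; rewrite (cell_htgt Hp) /=.
by apply/andP; split; [elim: (Js)|elim: (Hs)] => //= X Xs ->; rewrite ?(cell_htgt (ht_str_cell X)) ?idE.
Qed.

(* Each stage is the preceding one followed by (id, ..., id, cart, J̄'_i, id, ..., id),
   which is weakly cocartesian because J̄'_i is cocartesian. *)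
Lemma lbc_weakly_cocartesian A0 Js J c J' phi Hs B : apath A0 Js (ht_dom J) ->
  List.Forall (@left_Beck_Chevalley K T) Js -> lbc_factor J c J' phi ->
  hpath (T $o (al_ob (ht_cod J))) Hs B -> weakly_cocartesian (al_str A0) (stage Js phi Hs) (vid B).
Proof.
elim/last_ind: Js J c J' phi Hs B => [|Js J0 IH] J c J' phi Hs B PJ FJ F PH.
  have [_ _ _ X] := lbc_cocart F.
  move: PJ => /= ->; apply: (X [::] _ (map hidc Hs)); first by left.
  exact: right_extension_ids.
move: PJ FJ; rewrite -cats1 => /linked_cat [A1 P0 /= [e0 e1]] /List.Forall_app [F0 /List.Forall_cons_iff [LJ0 _]].
rewrite cats1 -e0 in P0 *.
have [c0 [J0' [phi0 L0]]] := LJ0.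
have {}L0 : lbc_factor J0 c0 J0' phi0 by [].
have PH0 : hpath (T $o (al_ob (ht_cod J0))) (T $h (ht_map J) :: Hs) B.
  by split; rewrite ?F_hdom ?F_hcod ?ht_map_dom ?ht_map_cod ?e1.
have W1 := IH J0 c0 J0' phi0 (T $h (ht_map J) :: Hs) B P0 F0 L0 PH0.
have PU := ht_map_hpath P0.
pose s := rcons (map hidc (map (@ht_map K T) Js)) c0.
have [R0 Hp0 E0 _] := L0; have [R Hp E _] := F; have [Hc0 _] := R0.
(* The left extension ends in [c0], the restriction of [J0] along the structure map of [ht_cod J0].
   As [ht_cod J0] is [ht_dom J], this map is the vertical source of [phi], as the definition of
   cocartesian requires. *)
have W2 : weakly_cocartesian (vid (al_ob A0)) (s ++ [:: phi] ++ map hidc Hs) (vid B).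
  have [_ _ _ X] := lbc_cocart F; apply: X; last exact: right_extension_ids.
  right; exists (al_ob A0), (map (@ht_map K T) Js), (ht_map J0), J0', c0; split=> //.
  - by rewrite ht_map_dom.
  - by rewrite ht_map_cod al_str_cod e1.
  - by rewrite -e1.
have [q1 q2 q3] := map_hidc_path PH; have [r1 r2 r3] := map_hidc_path PU.
have hT : htgts (s ++ [:: phi] ++ map hidc Hs) = map (@ht_map K T) Js ++ ht_map J0 :: J' :: Hs.
  by rewrite /s -cats1 -catA !htgts_cat r2 q2 /htgts /= (cell_htgt Hc0) (cell_htgt Hp).
have hS : hsrcs (s ++ [:: phi] ++ map hidc Hs) = map (@ht_map K T) Js ++ J0' :: T $h (ht_map J) :: Hs.
  by rewrite /s -cats1 -catA !hsrcs_cat r3 q3 /hsrcs /= (cell_hsrc Hc0) (cell_hsrc Hp).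
have PJ : apath A0 (rcons Js J0) (ht_dom J) by rewrite -cats1; apply/linked_cat; exists (ht_dom J0).
have [x1 x2 x3] := stage_boundary P0 L0 PH0.
have [y1 y2 y3] := stage_boundary PJ F PH.
have e2 : map (@ht_map K T) (rcons Js J0) ++ J' :: Hs = map (@ht_map K T) Js ++ ht_map J0 :: J' :: Hs.
  by rewrite map_rcons cat_rcons.
have e3 : map (Fh T) (map (@ht_map K T) (rcons Js J0)) ++ T $h (ht_map J) :: Hs
  = map (Fh T) (map (@ht_map K T) Js) ++ T $h (ht_map J0) :: T $h (ht_map J) :: Hs.
  by rewrite !map_rcons cat_rcons.
have Z (x : cell K) o h k : vdom h = al_ob A0 -> vdom k = B ->
    is_cell x (map (@ht_map K T) Js ++ ht_map J0 :: J' :: Hs) o h k ->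
    ccomp (ccomp x (s ++ [:: phi] ++ map hidc Hs)) (stage Js phi0 (T $h (ht_map J) :: Hs))
    = ccomp x (stage (rcons Js J0) phi Hs) /\
    is_cell (ccomp x (s ++ [:: phi] ++ map hidc Hs)) (map (@ht_map K T) Js ++ J0' :: T $h (ht_map J) :: Hs) o h k.
  move=> eh ek Hx.
  have C : composable x (vid (al_ob A0)) (s ++ [:: phi] ++ map hidc Hs) (vid B).
    apply: (composableI Hx _ _ (esym hT)); rewrite ?vcod_id //; last by case: W2 => -[].
    by case: W2 => -[].
  split; last first.
    have := ccomp_cell C; rewrite hS (cell_htgt Hx) (cell_vsrc Hx) (cell_vtgt Hx).
    by rewrite !vcompE1.
  (* At each place, an outer and an inner cell: only [c0] with [phi0] composes to something new,
     namely J̄ of [J0]; in every other pair one of the cells is an identity. *)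
  pose z := map (fun J => (hidc (ht_map J), ht_cell J)) Js ++ (c0, phi0) :: (phi, hidc (T $h (ht_map J)))
     :: map (fun H => (hidc H, hidc H)) Hs.
  have z1 : map fst z = s ++ [:: phi] ++ map hidc Hs.
    by rewrite /z /s map_cat cat_rcons /= -!map_comp.
  have z2 : map snd z = stage Js phi0 (T $h (ht_map J) :: Hs).
    by rewrite /z /stage map_cat /= -!map_comp.
  have z3 : map (fun p => ccomp p.1 [:: p.2]) z = stage (rcons Js J0) phi Hs.
    rewrite /z /stage map_cat map_rcons cat_rcons /= -!map_comp E0; congr (_ ++ _ :: _ :: _).
    - by apply: eq_map => X /=; rewrite (ccomp1h (cell_htgt (ht_str_cell X))).
    - by rewrite -[[:: hidc _]]/(map hidc [:: T $h (ht_map J)]) -(cell_hsrc Hp) ccomph1 // (cell_hsrc Hp).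
    - by apply: eq_map => X /=; rewrite ccomp1h // idE.
  rewrite -z1 -z2 -z3; apply: (ccomp_zip (h := vid (al_ob A0)) (k := vid B) (f := al_str A0) (g := vid B)).
  - by rewrite z1.
  - by rewrite z2.
  have HH H : exists f' g', composable (hidc H : cell K) f' [:: hidc H] g'.
    by do 2 eexists; apply: (proj1 (ccomp1_on (hidc_cell H) (hidc_cell H))).
  apply/List.Forall_app; split.
    elim: (Js) => [|X Xs IHX] /=; constructor=> //=; do 2 eexists.
    exact: (proj1 (ccomp1_on (hidc_cell _) (ht_str_cell X))).
  constructor; first by do 2 eexists; apply: (proj1 (ccomp1_on Hc0 Hp0)).
  constructor; first by do 2 eexists; apply: (proj1 (ccomp1_on Hp (hidc_cell _))).
  by elim: (Hs) => [|X Xs IHX] /=; constructor=> //; apply: HH.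
apply: weakly_cocartesianI; first exact: stage_unary PJ F PH.
  move=> psi o h k; rewrite al_str_cod vcod_id y3 y2 e2 e3 => /esym eh /esym ek Hpsi.
  have [|||psi1] := weakly_cocartesian_fact (psi := psi) (o := o) (h := h) (k := k) W1; rewrite ?x3 ?al_str_cod ?vcod_id ?x2 //.
  move=> Hpsi1 ep1.
  have [|||psi2] := weakly_cocartesian_fact (psi := psi1) (o := o) (h := h) (k := k) W2; rewrite ?hS ?hT ?vcod_id ?vcompE1 //.
  move=> Hpsi2 ep2; exists psi2 => //.
  by rewrite -(proj1 (Z _ _ _ _ eh ek Hpsi2)) ep2.
move=> x y o h k; rewrite al_str_cod vcod_id y2 e2 => /esym eh /esym ek Hx Hy.
have [<- Hx1] := Z _ _ _ _ eh ek Hx; have [<- Hy1] := Z _ _ _ _ eh ek Hy.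
move=> e; apply: (weakly_cocartesian_inj (o := o) (h := h) (k := k) W2); rewrite ?hT ?vcod_id //.
by apply: (weakly_cocartesian_inj (o := o) (h := h) (k := k) W1); rewrite ?x2 ?al_str_cod ?vcod_id.
Qed.
End LBC.

(** * Kan extensions composed with Beck-Chevalley structure cells *)

Section LBCLan.
Variables (K : avdc) (T : monad K).
Local Notation apath := (linked (@ht_dom K T) (@ht_cod K T)).

(** Pointwiseness is used at the structure map of [An]. The universal property has to be tested with
    an arbitrary path [Hs] appended, which is why the stages carry such a tail: for each [Hs], a
    cell is factored first through the weakly cocartesian stage and then through the restricted Kan
    extension [e1]. *)
Lemma lbc_lan wk A0 Js J An (eta : cell K) d l : apath A0 (rcons Js J) An ->
  List.Forall (@left_Beck_Chevalley K T) (rcons Js J) ->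
  pointwise_lan wk eta d (map (@ht_map K T) (rcons Js J)) l ->
  lan wk (ccomp eta (map (@ht_cell K T) (rcons Js J))) (d ∘ al_str A0)
    (map (Fh T) (map (@ht_map K T) (rcons Js J))) (l ∘ al_str An).
Proof.
move=> PJ FJ L.
have He : is_cell eta (map (@ht_map K T) (rcons Js J)) None d l by case: L => ? [? []].
have nJ : rcons Js J <> [::] by case: (Js).
have dA := nullary_src_dom PJ nJ He; have lA := nullary_tgt_dom PJ nJ He.
have HS := eta_str_cell PJ nJ He.
move: FJ PJ; rewrite -cats1 => /List.Forall_app [FJ /List.Forall_cons_iff [[c [J' [phi F]]] _]].
rewrite !cats1 => PJ.
have {}F : lbc_factor J c J' phi by [].
have [P0 eA] : apath A0 Js (ht_dom J) /\ ht_cod J = An.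
  by move: PJ; rewrite -cats1 => /linked_cat [y p [/= e1 e2]]; rewrite e1.
have [R Hp E _] := F; have [Hc _] := R.
rewrite map_rcons in L He; have L1 := pointwise_lan_at L R.
have [D1 H1] := on_last He Hc.
rewrite eA in R Hp Hc D1 H1 L1.
set e1 := ccomp eta (rcons _ c) in L1 H1.
have HC0 : composable e1 (al_str A0) (map (@ht_cell K T) Js ++ [:: phi]) (vid (T $o (al_ob An))).
  apply: (composableI H1); first by case: (Js).
  - apply/linked_cat; exists (al_str (ht_dom J)); first exact: map_ht_chain P0.
    by split; rewrite ?(cell_vsrc Hp) ?(cell_vtgt Hp).
  - by rewrite htgts_cat map_ht_htgts /htgts /= (cell_htgt Hp) cats1.
  - by rewrite al_str_cod.
have ES : ccomp e1 (map (@ht_cell K T) Js ++ [:: phi]) = ccomp eta (map (@ht_cell K T) (rcons Js J)).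
  pose z := map (fun J => (hidc (ht_map J), ht_cell J)) Js ++ [:: (c, phi)].
  have z1 : map fst z = rcons (map hidc (map (@ht_map K T) Js)) c by rewrite /z map_cat -!map_comp cats1.
  have z2 : map snd z = map (@ht_cell K T) Js ++ [:: phi] by rewrite /z map_cat -!map_comp.
  have z3 : map (fun p => ccomp p.1 [:: p.2]) z = map (@ht_cell K T) (rcons Js J).
    rewrite /z map_cat map_rcons -cats1 /= -!map_comp E; congr (_ ++ _).
    by apply: eq_map => X /=; rewrite (ccomp1h (cell_htgt (ht_str_cell X))).
  rewrite /e1 -z1 -z2 -z3; apply: ccomp_zip.
  - by rewrite z1; apply: D1.
  - by rewrite z2; apply: comp_chain HC0.
  apply/List.Forall_app; split.
    elim: (Js) => [|X Xs IHX] /=; constructor=> //=; do 2 eexists.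
    exact: (proj1 (ccomp1_on (hidc_cell _) (ht_str_cell X))).
  by constructor=> //; do 2 eexists; apply: (proj1 (ccomp1_on Hc Hp)).
have stageP Hs k : hpath (vdom (l ∘ al_str An)) Hs (vdom k) ->
    [/\ weakly_cocartesian (al_str A0) (stage Js phi Hs) (vid (vdom k)),
      htgts (stage Js phi Hs) = rcons (map (@ht_map K T) Js) J' ++ Hs &
      hsrcs (stage Js phi Hs) = map (Fh T) (map (@ht_map K T) (rcons Js J)) ++ Hs].
  rewrite (vdom_comp (f := al_str An)); last by rewrite al_str_cod.
  rewrite al_str_dom -eA => PH.
  have [_ x2 x3] := stage_boundary P0 F PH.
  split; [exact: lbc_weakly_cocartesian FJ F PH|by rewrite x2 cat_rcons|].
  by rewrite x3 !map_rcons cat_rcons.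
(* The identities in the tail of the stage leave [x] as it is, while the remaining part, J̄'
   included, turns [e1] into the composite of [eta] with the structure cells. *)
have Z (x : cell K) Hs k : is_cell x Hs None (l ∘ al_str An) k ->
    ccomp (e1 ⊙ x) (stage Js phi Hs) = ccomp eta (map (@ht_cell K T) (rcons Js J)) ⊙ x.
  by move=> Hx; have := paste_ids H1 HC0 Hx; rewrite -catA ES.
have Pk Hs k phi0 : is_cell phi0 (map (Fh T) (map (@ht_map K T) (rcons Js J)) ++ Hs) None (d ∘ al_str A0) k ->
    hpath (vdom (l ∘ al_str An)) Hs (vdom k).
  move/cell_hpath/linked_cat => [y p]; have := cell_hpath HS => q; by rewrite (linked_uniq q p).
have vA : vcod (al_str A0) = vdom d by rewrite al_str_cod dA.
apply: lanI => //.
  move=> Hs k chi w0 Hchi; have [W s2 s3] := stageP Hs k (Pk _ _ _ Hchi).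
  have [|||psi] := weakly_cocartesian_fact (psi := chi) (o := None) (h := d) (k := k) W; rewrite ?s2 ?s3 ?vcod_id ?vcompE1 //.
  move=> Hpsi epsi; have [_ U] := L1; have [x [[Hx ex] _]] := U Hs k psi w0 Hpsi.
  by exists x => //; rewrite -(Z _ _ _ Hx) ex.
move=> Hs k x y w0 Hx Hy; rewrite -(Z _ _ _ Hx) -(Z _ _ _ Hy) => e.
have [W s2 s3] := stageP Hs k (cell_hpath Hx).
apply: (lan_inj L1 w0 Hx Hy); apply: (weakly_cocartesian_inj (o := None) (h := d) (k := k) W); rewrite ?s2 ?vcod_id //.
  exact: npaste_cell H1 Hx.
exact: npaste_cell H1 Hy.
Qed.
End LBCLan.

(** * Stability of the left Beck-Chevalley condition under restriction *)

Section LBCRestriction.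
Variables (K : avdc) (T : monad K).
Variables (J JT : hTmor T) (f : vmor K) (fb gb c : cell K).
Local Notation a := (al_str (ht_dom J)). Local Notation an := (al_str (ht_cod J)). Local Notation b := (al_str (ht_cod JT)).
Hypotheses (eA : ht_dom JT = ht_dom J)
  (Hfb : is_vcell fb (an ∘ T $v f) (f ∘ b)) (Hgb : is_vcell gb (f ∘ b) (an ∘ T $v f))
  (fg : fb ⊙ gb = vidc (an ∘ T $v f)) (gf : gb ⊙ fb = vidc (f ∘ b))
  (R : restriction_r c (ht_map JT) (ht_map J) f)
  (RT : restriction_r (T $c c) (T $h (ht_map JT)) (T $h (ht_map J)) (T $v f))
  (E : ccomp c [:: ht_cell JT] = ccomp (ht_cell J) [:: T $c c] ⊙ fb)
  (X : forall g, vcod g = hcod (ht_map J) -> has_restriction_r (ht_map J) g).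

Lemma has_restriction_r_fact (L : avdc) (c0 : cell L) J0 J1 g h : restriction_r c0 J1 J0 g -> vcod h = hcod J1 ->
  has_restriction_r J0 (g ∘ h) -> has_restriction_r J1 h.
Proof.
move=> R0 e [c1 [J2 R1]]; have [|x Rx _] := restriction_r_fact R0 R1; first by rewrite e (restriction_r_dom R0).2.
by exists x, J2.
Qed.

(* As f̄ is invertible, J'(id, b) is isomorphic to J(id, a_n)(id, Tf), so that the
   condition on J' at g is that on J at Tf ∘ g. *)
Lemma lbc_restriction : left_Beck_Chevalley J -> left_Beck_Chevalley JT.
Proof.
case=> [cn [Jn [phin [Rn Hphin En Pn]]]].
have fB : vdom f = al_ob (ht_cod JT) by rewrite -(restriction_r_dom R).2 ht_map_cod.
have fC : vcod f = al_ob (ht_cod J) by rewrite (restriction_r_cod R) ht_map_cod.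
have bf : vcod b = vdom f by rewrite al_str_cod fB.
(* J'(id, b) is obtained from J(id, f ∘ b) by factoring the latter through [c]. *)
have [cL [L RL']] := X (etrans (vcod_comp bf) (restriction_r_cod R)).
have [cb Rb eb] := restriction_r_fact R RL' bf.
have HJ := ht_str_cell J; have HJT := ht_str_cell JT; rewrite eA in HJT.
have HTc := RT.1; rewrite F_hdom ht_map_dom in HTc.
have [b1 b2] := restriction_r_dom Rb; have [a1 a2] := restriction_r_dom R; have [n1 n2] := restriction_r_dom Rn.
have bd := al_str_dom (ht_cod JT).
have [|||phi Hphi ephi] := restriction_fact (chi := ht_cell JT) (Hs := [:: T $h (ht_map JT)]) (h := a) (k := vid (T $o (al_ob (ht_cod JT)))) Rb.
- by rewrite b1 a1 al_str_cod ht_map_dom.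
- by rewrite vcod_id b2 bd.
- by rewrite vcomp1E ?vcompE1 // al_str_cod a1 ht_map_dom.
exists cb, L, phi; rewrite eA; split=> //.
have eT : T $o (al_ob (ht_cod JT)) = hcod (T $h (ht_map JT)) by rewrite F_hcod ht_map_cod.
have eTn : T $o (al_ob (ht_cod J)) = hcod (T $h (ht_map J)) by rewrite F_hcod ht_map_cod.
rewrite eT in Hphi; rewrite eTn in Hphin.
apply/(right_pointwise_cocartesian1 Hphi) => g eg; have {}Pn := proj1 (right_pointwise_cocartesian1 Hphin) Pn.
have eg1 : vcod g = vdom (T $v f) by rewrite eg -eT F_vdom fB.
have eg2 : vcod g = vdom b by rewrite eg -eT bd.
have eTf : vcod (T $v f) = vdom an by rewrite F_vcod fC al_str_dom.
have etf : vcod (T $v f ∘ g) = hcod (T $h (ht_map J)) by rewrite (vcod_comp eg1) F_vcod fC -eTn.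
have [Pn1 Pn2] := Pn _ etf.
split.
  (* Both restrictions exist outright. The one of [L] comes from restrictions of [J]; the one of TJ'
     comes from a restriction of [Jn], transferred to TJ at Tf ∘ g by [Pn1]. *)
  split=> _.
    apply: (has_restriction_r_fact Rb); first by rewrite b2.
    apply: (has_restriction_r_fact R); first by rewrite (vcod_comp eg2) al_str_cod ht_map_cod.
    by apply: X; rewrite (vcod_comp (f := b ∘ g)) ?fC ?ht_map_cod // (vcod_comp eg2).
  apply: (has_restriction_r_fact RT) => //; apply/Pn1.
  apply: (has_restriction_r_fact Rn); first by rewrite (vcod_comp eg1) n2.
  by apply: X; rewrite vcod_comp ?al_str_cod ?ht_map_cod // (vcod_comp eg1).
move=> c1 c2 H' L' phi' R1 R2 Hphi' e12.
have RX := restriction_r_comp R (restriction_r_comp Rb R2).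
have vg : vcod g = vdom (f ∘ b) by rewrite (vdom_comp bf).
have vg' : vcod g = vdom (an ∘ T $v f) by rewrite (vdom_comp eTf).
have Hfg := rwhisk_cell Hfb vg'; have Hgg := rwhisk_cell Hgb vg.
have fgg : (fb ▷ g) ⊙ (gb ▷ g) = vidc (an ∘ T $v f ∘ g) by rewrite -(rwhisk_hpaste Hfb Hgb) ?fg ?rwhisk_vidc //; left.
have gfg : (gb ▷ g) ⊙ (fb ▷ g) = vidc (f ∘ b ∘ g) by rewrite -(rwhisk_hpaste Hgb Hfb) ?gf ?rwhisk_vidc //; left.
have e3 : f ∘ (b ∘ g) = f ∘ b ∘ g by rewrite vcompA.
rewrite e3 in RX.
(* Pasting with [gb ▷ g] makes [L'] a restriction of J along [an ∘ (T $v f ∘ g)], so that it becomes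
   a restriction of [Jn] along [T $v f ∘ g], with cartesian cell [e]. *)
have RX' := restriction_rpaste RX Hgg Hfg gfg fgg.
rewrite -vcompA // in RX'.
have [|e Re ee] := restriction_r_fact Rn RX'; first by rewrite (vcod_comp eg1).
have evd : vdom (T $v f ∘ g) = vdom g by rewrite vdom_comp.
rewrite -evd in Hphi' *.
have RTc1 := restriction_r_comp RT R1.
apply: (Pn2 _ _ _ _ _ RTc1 Re Hphi').
have [G1 G1'] := ccomp1_on Hphin RTc1.1; have [G2 G2'] := ccomp1_on Re.1 Hphi'.
have ha : hdom (T $h (ht_map J)) = T $o (al_ob (ht_dom J)) by rewrite F_hdom ht_map_dom.
have hn : hdom Jn = al_ob (ht_dom J) by rewrite n1 ht_map_dom.
(* The remaining factorisation condition is tested after composition with the cartesian [cn]. There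
   [gb ▷ g], contained in [e], cancels against the [fb] that [E] introduces. *)
apply: (restriction_inj Rn (h := a) (k := T $v f ∘ g)).
- apply: is_cell_conv G1' _ _; first by rewrite ha vcompE1 // al_str_dom.
  by rewrite -eTn vcomp1E // (vcod_comp eg1) F_vcod fC.
- apply: is_cell_conv G2' _ _; first by rewrite hn vcomp1E // al_str_cod.
  by rewrite evd vcompE1 // vdom_comp.
have [D0 _] := ccomp1_on Rn.1 Hphin; have [D1 _] := ccomp1_on Rn.1 Re.1.
rewrite (ccomp_ccomp1 D0 G1) En (ccomp_ccomp1 D1 G2) ee.
rewrite evd in Hphi' G2 G2'.
have [C1 C1'] := ccomp1_on RX.1 Hphi'.
rewrite (ccomp_rpaste RX.1 Hgg C1) (rwhisk_vid Hgg); last by rewrite vdom_comp.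
have [F1 _] := ccomp1_on R.1 (restriction_r_comp Rb R2).1.
have [F2 F2'] := ccomp1_on (restriction_r_comp Rb R2).1 Hphi'.
have [F3 F3'] := ccomp1_on R2.1 Hphi'; have [F4 _] := ccomp1_on Rb.1 R2.1.
rewrite -(ccomp_ccomp1 F1 F2) -(ccomp_ccomp1 F4 F3) -e12.
have [F5 _] := ccomp1_on Hphi R1.1; have [F6 _] := ccomp1_on Rb.1 Hphi.
rewrite (ccomp_ccomp1 F6 F5) ephi.
have [F7 _] := ccomp1_on HJT R1.1; have [F8 _] := ccomp1_on R.1 HJT.
rewrite (ccomp_ccomp1 F8 F7) E.
have [F9 F9'] := ccomp1_on HJ HTc.
have [I1 I1'] := ccomp1_on F9' R1.1.
rewrite (ccomp_rpaste F9' Hfb I1) (rpasteA I1' Hfg Hgg) fgg hpasteE1 ?(cell_vtgt I1') //.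
have [I2 _] := ccomp1_on HTc R1.1.
by rewrite (ccomp_ccomp1 F9 I2).
Qed.
End LBCRestriction.

(** * Transfer to a full sub-avdc *)

Section FullSub.
Variables (K : avdc) (P : hmor K -> Prop).
Local Notation S := (full_sub P).
Local Notation I := (full_sub_incl P).
Implicit Types (Phi Chi : cell S) (d l f : vmor S) (J : hmor S) (Js : seq (hmor S)).

Lemma sub_cell_eq Phi Chi Js o d l : is_cell Phi Js o d l -> is_cell Chi Js o d l ->
  sc_cell Phi = sc_cell Chi -> Phi = Chi.
Proof. by case=> <- <- <- <- [e1 e2 e3 e4]; apply: sub_ext. Qed.

Lemma sub_lift (x : cell K) Js o d l : is_cell x (map sval Js) (omap sval o) d l ->
  exists2 X : cell S, is_cell X Js o d l & sc_cell X = x.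
Proof. by case=> e1 e2 e3 e4; exists (@SubCell K P Js o x e1 e2). Qed.

(** By fullness, a factor found in [K] is a cell of the sub-avdc as soon as its horizontal boundary
    lies there, and the boundary of the given cell guarantees this. *)
Lemma sub_lan wk Phi Js d l : is_cell Phi Js None d l -> lan (K := K) wk (sc_cell Phi) d (map sval Js) l ->
  lan wk Phi d Js l.
Proof.
move=> H L.
have UP (X : cell S) Hs k : is_cell X Hs None l k -> sc_cell (Phi ⊙ X) = (sc_cell Phi : cell K) ⊙ sc_cell X.
  move=> HX; apply: (F_hpaste I); first by rewrite (cell_vtgt H) (cell_vsrc HX).
  by left; apply: cell_htgt H.
apply: lanI => //.
  move=> Hs k Chi w0 HC.
  have HC' : is_cell (sc_cell Chi) (map sval Js ++ map sval Hs) None d k by rewrite -map_cat; apply: (F_is_cell I HC).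
  have [|x [[Hx ex] _]] := proj2 L (map sval Hs) k (sc_cell Chi) _ HC'; first by move/w0 => ->.
  have [X HX eX] := @sub_lift x Hs None l k Hx.
  exists X => //; apply: (sub_cell_eq (npaste_cell H HX) HC).
  by rewrite (UP _ _ _ HX) eX.
move=> Hs k X Y w0 HX HY /(congr1 (@sc_cell K P)); rewrite (UP _ _ _ HX) (UP _ _ _ HY) => e.
apply: (sub_cell_eq HX HY); apply: (lan_inj L (Hs := map sval Hs)) e; first by move/w0 => ->.
  exact: (F_is_cell I HX).
exact: (F_is_cell I HY).
Qed.

Lemma sub_restriction C J' J f : is_cell C [:: J'] (Some J) (vid (hdom J)) f ->
  restriction_r (K := K) (sc_cell C) (sval J') (sval J) f -> restriction_r C J' J f.
Proof.
move=> H R.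
have UP (X : cell S) Hs h k : is_cell X Hs (Some J') h k -> sc_cell (ccomp C [:: X]) = ccomp (sc_cell C : cell K) [:: sc_cell X].
  by move=> HX; apply: (F_ccomp I (ccomp1_on H HX).1).
apply: restrictionI => //.
  move=> Chi Hs h k eh ek HC.
  have [//|//||x Hx ex] := restriction_fact (h := h) (k := k) (chi := sc_cell Chi) (Hs := map sval Hs) R.
    exact: (F_is_cell I HC).
  have [X HX eX] := @sub_lift x Hs (Some J') h k Hx.
  exists X => //; apply: (sub_cell_eq (ccomp1_on H HX).2 HC).
  by rewrite (UP _ _ _ _ HX) eX.
move=> X Y Hs h k HX HY /(congr1 (@sc_cell K P)); rewrite (UP _ _ _ _ HX) (UP _ _ _ _ HY) => e.
apply: (sub_cell_eq HX HY); apply: (restriction_inj R (F_is_cell I HX) (F_is_cell I HY) e).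
Qed.
End FullSub.

(** The lift is made in T-Alg for pseudo morphisms, with [lbc_lan] supplying the invertibility of
    l̄, and lies in the subcategory by fullness. Its pointwise property is then checked at each
    restriction [RC] of the subcategory. *)
Lemma condition_p_creates_lbc (K : avdc) (T : monad K) (d : vmor (TAlg_lbc T)) (Js : seq (hmor (TAlg_lbc T)))
    (Jn : hmor (TAlg_lbc T)) (An : ob (TAlg_lbc T)) :
  hpath (vdom d) (rcons Js Jn) An ->
  (forall f : vmor K, vcod f = Fo (TAlg_lbc_forget T) An ->
    has_restriction_r (Fh (TAlg_lbc_forget T) Jn) f /\
    preserves_restriction_r T (Fh (TAlg_lbc_forget T) Jn) f) ->
  condition_p true false (Fv (TAlg_lbc_incl T) d) (map (Fh (TAlg_lbc_incl T)) (rcons Js Jn)) ->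
  creates_lan (TAlg_lbc_forget T) true false d (rcons Js Jn).
Proof.
move=> PJ X Cp eta l.
have n : Pseudo <> Colax by [].
pose Us : seq (hmor (TAlg T Pseudo)) := map sval (rcons Js Jn).
have eU : map (Fh (TAlg_lbc_forget T)) (rcons Js Jn) = map (@ht_map K T) Us by rewrite /Us -map_comp.
rewrite eU => Le.
have nJ : Us <> [::] by rewrite /Us; case: (Js).
have PU : hpath (G := TAlg T Pseudo) (vdom d) Us An.
  have : forall A (Xs : seq (hmor (TAlg_lbc T))) B, hpath A Xs B -> hpath (G := TAlg T Pseudo) A (map sval Xs) B.
    by move=> A Xs B; elim: Xs A => //= Y Xs IH A [e /IH H]; split.
  exact.
have FU : List.Forall (@left_Beck_Chevalley K T) Us.
  rewrite /Us; elim: (rcons Js Jn) => [|Y Xs IH] /=; constructor=> //; exact: (proj2_sig Y).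
have He : is_cell eta (map (@ht_map K T) Us) None (vt_map d) l by case: Le => ? [? []].
have Lt := @condition_p_lan K T Pseudo d Us eta l false true Le Cp.
have Le' : pointwise_lan false eta (vt_map d) (map (@ht_map K T) Us) l := Le.
have eUr : Us = rcons (map sval Js) (sval Jn) by rewrite /Us map_rcons.
have [|Phi HPhi] := @lift_lax K T Pseudo d Us An nJ PU eta l false He true Le n Cp.
  move=> lb Hl E _.
  have [gb [Hb Hb' b1 b2]] := pseudo_inverse d.
  apply: (lan_compare (defines_lan_lan Lt) _ Hl Hb Hb' b1 b2 E).
  move: PU FU Le'; rewrite eUr => PU FU; exact: lbc_lan PU FU.
have [H ed ec em] := is_lift_cell PU He (proj1 HPhi).
have eP : tc_cell Phi = eta by case: HPhi => -[].
have [PhiS HS eS] := @sub_lift (TAlg T Pseudo) (@left_Beck_Chevalley K T) Phi (rcons Js Jn) None d (vtgt Phi) H.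
exists PhiS; split.
  split; first by split; [apply: cell_hsrc HS|apply: cell_vsrc HS|rewrite /= eS].
  move=> Y [e1 e2 e3]; have eY : Phi = sc_cell Y.
    by apply: (proj2 HPhi); split; [rewrite (cell_hsrc (sub_is_cell Y)) e1|apply: e2|apply: e3].
  apply: sub_ext; rewrite ?eS ?eY //.
  - by rewrite e1 (cell_hsrc HS).
  - have := cell_htgt (sub_is_cell Y); rewrite -eY (cell_htgt H) (cell_htgt HS); by case: (htgt Y).
  - by rewrite e2 (cell_vsrc HS).
  - by rewrite (cell_vtgt HS) eY.
rewrite /= eS.
have eA : hcod Jn = An by move: PJ; rewrite -cats1 => /linked_cat [y _ [_ <-]].
have XJ (g : vmor K) : vcod g = hcod (ht_map (sval Jn)) -> has_restriction_r (ht_map (sval Jn)) g.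
  by move=> eg; apply: (proj1 (X g _)); rewrite eg ht_map_cod -eA.
exists Js, Jn; split=> // f C J'' ef RC.
have ef' : vcod (vt_map f) = hcod (ht_map (sval Jn)) by rewrite vt_map_cod [vt_cod f]ef ht_map_cod.
have ef'' : vcod (vt_map f) = Fo (TAlg_lbc_forget T) An by rewrite ef' ht_map_cod /= -eA.
have [[c [Jc Rc]] Pr] := X _ ef''.
have [C0 [J0 [R0 E0 EJ [Ed Ecd] Est]]] := @TAlg_restriction K T Pseudo (sval Jn) f c Jc n ef Rc.
(* With this, the restriction constructed in T-Alg is one in the subcategory too. It can be compared
   there with the arbitrary restriction [RC], whose underlying cell is therefore cartesian in
   [K]. *)
have LJ0 : left_Beck_Chevalley J0.
  have [gb [Hb Hb' b1 b2]] := pseudo_inverse f.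
  have ecf : vt_cod f = ht_cod (sval Jn) := ef.
  have evd : vt_dom f = ht_cod J0 by rewrite Ecd.
  rewrite evd ecf in Hb Hb' b1 b2.
  rewrite -EJ in Rc Pr; apply: (lbc_restriction Ed Hb Hb' b1 b2 Rc _ Est XJ (proj2_sig Jn)).
  split; last exact: Pr Rc.
  by have := F_is_cell T Rc.1; rewrite F_vid -(F_hdom T).
pose J0s : hmor (TAlg_lbc T) := exist _ J0 LJ0.
have [C0s HC0 eC0] := @sub_lift (TAlg T Pseudo) (@left_Beck_Chevalley K T) C0 [:: J0s] (Some Jn) (vid (hdom (sval Jn))) f R0.1.
have R0s : restriction_r C0s J0s Jn f by apply: sub_restriction HC0 _; rewrite eC0.
have RF : restriction_r (Fc (TAlg_lbc_forget T) C0s) (Fh (TAlg_lbc_forget T) J0s) (Fh (TAlg_lbc_forget T) Jn) (Fv (TAlg_lbc_forget T) f).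
  by rewrite /= eC0 E0 EJ.
have RU := functor_restriction R0s RC RF.
have [c1 c2] := on_last HS RC.1.
apply: sub_lan => //.
have -> : sc_cell (ccomp PhiS (rcons (map hidc Js) C)) = ccomp (Phi : cell (TAlg T Pseudo)) (rcons (map hidc (map sval Js)) (sc_cell C)).
  rewrite -[LHS]/(Fc (TAlg_lbc_incl T) _) (F_ccomp (TAlg_lbc_incl T) c1) map_rcons -!map_comp /= eS.
  by [].
rewrite map_rcons.
rewrite eUr in H Lt Le'.
apply: (@TAlg_lan_restriction K T Pseudo false Phi (map sval Js) (sval Jn) d (vtgt Phi) f (sc_cell C) (sval J'')) => //.
- by rewrite eP em.
- by rewrite eP em.
- exact: (F_is_cell (TAlg_lbc_incl T) RC.1).
- exact: Pr RU.
Qed.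

Theorem theorem7p11 (K : avdc) (T : monad K) :
  (forall wk : bool,
    (* (a) *)
    (forall (d : vmor (TAlg T Lax)) (Js : seq (hmor (TAlg T Lax))) (An : ob (TAlg T Lax)),
      Js <> [::] -> hpath (vdom d) Js An ->
      condition_p false wk d Js -> condition_l false wk d Js)
    (* (b) *)
    /\ (forall (d : vmor (TAlg T Colax)) (Js : seq (hmor (TAlg T Colax))) (An : ob (TAlg T Colax)),
      Js <> [::] -> hpath (vdom d) Js An ->
      condition_e false wk d Js -> condition_l false wk d Js)
    (* (c) *)
    /\ (forall (d : vmor (TAlg T Pseudo)) (Js : seq (hmor (TAlg T Pseudo))) (An : ob (TAlg T Pseudo)),
      Js <> [::] -> hpath (vdom d) Js An ->
      [/\ condition_p false wk d Js -> condition_e false wk d Js -> condition_l false wk d Js,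
          condition_p false wk d Js -> condition_l false wk d Js -> condition_e false wk d Js &
          condition_e false wk d Js -> condition_l false wk d Js -> condition_p false wk d Js]))
  (* pointwise version of (a) *)
  /\ (forall (wk : bool) (d : vmor (TAlg T Lax)) (Js : seq (hmor (TAlg T Lax)))
        (Jn : hmor (TAlg T Lax)) (An : ob (TAlg T Lax)),
      hpath (vdom d) (rcons Js Jn) An ->
      (forall f : vmor K, vcod f = Fo (TAlg_forget T Lax) An ->
        has_restriction_r (Fh (TAlg_forget T Lax) Jn) f /\
        preserves_restriction_r T (Fh (TAlg_forget T Lax) Jn) f) ->
      condition_p true wk d (rcons Js Jn) -> condition_l true wk d (rcons Js Jn))
  (* pseudo T-morphisms and the left Beck-Chevalley condition *)
  /\ (forall (d : vmor (TAlg_lbc T)) (Js : seq (hmor (TAlg_lbc T)))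
        (Jn : hmor (TAlg_lbc T)) (An : ob (TAlg_lbc T)),
      hpath (vdom d) (rcons Js Jn) An ->
      (forall f : vmor K, vcod f = Fo (TAlg_lbc_forget T) An ->
        has_restriction_r (Fh (TAlg_lbc_forget T) Jn) f /\
        preserves_restriction_r T (Fh (TAlg_lbc_forget T) Jn) f) ->
      condition_p true false (Fv (TAlg_lbc_incl T) d) (map (Fh (TAlg_lbc_incl T)) (rcons Js Jn)) ->
      creates_lan (TAlg_lbc_forget T) true false d (rcons Js Jn)).
Proof.
split; [move=> wk; split; [|split]|split].
- by move=> d Js An nJ PJ; apply: condition_p_creates nJ PJ _.
- by move=> d Js An nJ PJ; apply: condition_e_creates nJ PJ.
- move=> d Js An nJ PJ; split=> [Cp Ce|Cp Cl|Ce Cl].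
  + exact: condition_p_creates nJ PJ _ Cp.
  + exact: condition_pl_e nJ PJ Cp Cl.
  + exact: condition_el_p nJ PJ Ce Cl.
- by move=> wk d Js Jn An; apply: condition_p_creates_pointwise.
- by move=> d Js Jn An; apply: condition_p_creates_lbc.
Qed.
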